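(* Let $Z=[a,b]$, $d\ge1$, $l\ge0$ an integer, $\alpha>0$, and let $f:Z\times[0,1]^d\to\mathbb{R}$ be $l+1$ times continuously differentiable on $Z\times[0,1]^d$, with a constant $C_f>0$ such that \[ \Bigl|\frac{\partial^{r+1}f(z,x)}{\partial z\,\partial x_{s_1}\cdots\partial x_{s_r}}\Bigr|\le C_f,\quad x\in[0,1]^d, \] for all $0\le r\le l$, $s_1,\dots,s_r\in\{1,\dots,d\}$, and \[ \Bigl|\frac{\partial^{l+1}f(z,x^{(1)})}{\partial z\,\partial x_{s_1}\cdots\partial x_{s_l}}-\frac{\partial^{l+1}f(z,x^{(2)})}{\partial z\,\partial x_{s_1}\cdots\partial x_{s_l}}\Bigr|\le C_f|x^{(1)}-x^{(2)}|^\alpha \] for all $x^{(1)},x^{(2)}\in[0,1]^d$, $z\in Z$, $s_1,\dots,s_l\in\{1,\dots,d\}$. Let $\mu$ be a stochastic measure on the Borel subsets of $[0,1]^d$. If $l+\alpha>d/2$, then the paths of the random function \[ \tilde\eta(z)=\int_{[0,1]^d}S^{(d)}_1(f(z,\cdot),x)\,d\mu(x)+\sum_{k=1}^\infty\int_{[0,1]^d}\bigl(S^{(d)}_{2^k}(f(z,\cdot),x)-S^{(d)}_{2^{k-1}}(f(z,\cdot),x)\bigr)\,d\mu(x) \] have bounded derivatives on $Z$, and \[ \frac{d\tilde\eta(z)}{dz}=\int_{[0,1]^d}\frac{\partial f(z,x)}{\partial z}\,d\mu(x), \] where the right-hand side is understood as its version given by the analogous series with $f$ replaced by $\partial f/\partial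 z$.
   Context: Let $(\Omega,\mathcal F,\mathsf P)$ be a complete probability space and $L_0$ the set of all real random variables on it, with convergence in probability. A stochastic measure (SM) on a measurable space $(X,\mathcal B)$ is a $\sigma$-additive map $\mu:\mathcal B\to L_0$ (finitely additive, and $\mu(A_n)\to0$ in probability whenever $A_n\downarrow\emptyset$). Every bounded measurable deterministic function is integrable w.r.t. $\mu$, with $\int\sum_ic_i\mathbf 1_{A_i}d\mu=\sum_ic_i\mu(A_i)$ for simple functions. In the series above all integrands are simple functions, and a single fixed version of $\mu$ is used for all values of $\mu$ appearing. One-dimensional Haar functions on $[0,1]$: $\chi_1\equiv1$; for $n=2^j+i$, $1\le i\le2^j$, $j\ge0$, put $\Delta_n^+=((i-1)2^{-j},(2i-1)2^{-j-1})$, $\Delta_n^-=((2i-1)2^{-j-1},i2^{-j})$, $\chi_n=2^{j/2}$ on $\Delta_n^+$, $-2^{j/2}$ on $\Delta_n^-$, $0$ outside $[(i-1)2^{-j},i2^{-j}]$; at discontinuity points in $(0,1)$ $\chi_n$ equals the average of its one-sided limits, $\chi_n(0)=\chi_n(0+)$, $\chi_n(1)=\chi_n(1-)$. Multivariate Haar functions $\chi^{(d)}_{n_1,\dots,n_d}(x)=\prod_{s=1}^d\chi_{n_s}(x_s)$, coefficients $c^{(d)}_{n_1,\dots,n_d}(g)=\int_{[0,1]^d}g\,\chi^{(d)}_{n_1,\dots,n_d}\,dx$, partial sums $S^{(d)}_{2^k}(g,x)=\sum_{(n_1,\dots,n_d)\in\{1,\dots,2^k\}^d}c^{(d)}_{n_1,\dots,n_d}(g)\chi^{(d)}_{n_1,\dots,n_d}(x)$.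 *)

(* Defs.v *)
From HB Require Import structures.
From mathcomp Require Import all_boot all_order all_algebra.
From mathcomp Require Import all_classical all_reals all_analysis.
Set Implicit Arguments. Unset Strict Implicit. Unset Printing Implicit Defensive.
Import Order.TTheory GRing.Theory Num.Theory.
Import numFieldNormedType.Exports.
Local Open Scope classical_set_scope.
Local Open Scope ring_scope.

Section Defs.
Variable R : realType.

(* n = 2^j + i, 1 <= i <= 2^j; j = trunc_log 2 (n-1), i = n - 2^j.
   Values at the discontinuity points follow the paper's convention. *)
Definition haar (n : nat) (x : R) : R :=
  if n == 1%N then 1 else if n == 0%N then 0 else
  let j := trunc_log 2 n.-1 in
  let i := (n - 2 ^ j)%N in
  let lo := (i.-1)%:R / (2 ^ j)%:R : R in
  let mid := (i.*2.-1)%:R / (2 ^ j.+1)%:R : R in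
  let hi := i%:R / (2 ^ j)%:R : R in
  let amp := Num.sqrt ((2 ^ j)%:R : R) in
  if (lo < x) && (x < mid) then amp
  else if (mid < x) && (x < hi) then - amp
  else if x == mid then 0
  else if x == lo then (if lo == 0 then amp else amp / 2)
  else if x == hi then (if hi == 1 then - amp else - amp / 2)
  else 0.

Definition cube (d : nat) : set 'rV[R]_d :=
  [set x | forall s : 'I_d, 0 <= x ord0 s <= 1].

Definition haar_d (d : nat) (n : 'I_d -> nat) (x : 'rV[R]_d) : R :=
  \prod_(s < d) haar (n s) (x ord0 s).

Definition setcoord (d : nat) (x : 'rV[R]_d) (k : nat) (t : R) : 'rV[R]_d :=
  \row_(j < d) (if (j : nat) == k then t else x ord0 j).

(* iterated Lebesgue integral over [0,1] of the coordinates 0..k-1;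
   iint d h 0 is the integral of h over [0,1]^d (Fubini). *)
Fixpoint iint (d : nat) (k : nat) (h : 'rV[R]_d -> R) (x : 'rV[R]_d) : R :=
  match k with
  | 0%N => h x
  | k'.+1 => \int[@lebesgue_measure R]_(t in `[0%R, 1%R]) iint k' h (setcoord x k' t)
  end.

Arguments cube : clear implicits.

Definition cube_integral (d : nat) (h : 'rV[R]_d -> R) : R := iint d h 0.

Definition haar_coef (d : nat) (g : 'rV[R]_d -> R) (n : 'I_d -> nat) : R :=
  cube_integral (fun x => g x * haar_d n x).

Definition haar_S (d : nat) (k : nat) (g : 'rV[R]_d -> R) (x : 'rV[R]_d) : R :=
  \sum_(n : {ffun 'I_d -> 'I_(2 ^ k)})
     haar_coef g (fun s => (n s).+1) * haar_d (fun s => (n s).+1) x.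

Definition enorm (d : nat) (x : 'rV[R]_d) : R :=
  Num.sqrt (\sum_(s < d) x ord0 s ^+ 2).

Fixpoint pderiv (d : nat) (ds : seq (option 'I_d))
    (f : R -> 'rV[R]_d -> R) : R -> 'rV[R]_d -> R :=
  match ds with
  | [::] => f
  | Some s :: ds' => fun z x => 'D_(delta_mx ord0 s) (pderiv ds' f z) x
  | None :: ds' => fun z x => 'D_1 (fun z' => pderiv ds' f z' x) z
  end.

Definition pderivable (d : nat) (o : option 'I_d) (ds : seq (option 'I_d))
    (f : R -> 'rV[R]_d -> R) (z : R) (x : 'rV[R]_d) : Prop :=
  match o with
  | Some s => derivable (pderiv ds f z) x (delta_mx ord0 s)
  | None => derivable (fun z' => pderiv ds f z' x) z 1
  end.

Definition Ck_on (d : nat) (k : nat) (U : set (R * 'rV[R]_d))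
    (f : R -> 'rV[R]_d -> R) : Prop :=
  (forall ds : seq (option 'I_d), (size ds < k)%N ->
     forall o p, U p -> pderivable o ds f p.1 p.2) /\
  (forall ds : seq (option 'I_d), (size ds <= k)%N ->
     forall p, U p -> {for p, continuous (fun q : R * 'rV[R]_d => pderiv ds f q.1 q.2)}).

Definition Ck_box (d : nat) (k : nat) (a b : R) (f : R -> 'rV[R]_d -> R) : Prop :=
  exists U : set (R * 'rV[R]_d), open U /\
    (forall z x, a <= z <= b -> cube d x -> U (z, x)) /\ Ck_on k U f.

Definition borel_cube (d : nat) (A : set 'rV[R]_d) : Prop :=
  <<s [set U : set 'rV[R]_d | open U] >> A /\ A `<=` cube d.

End Defs.

Section SM.
Variables (R : realType) (dO : measure_display) (Omega : measurableType dO).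
Variable (P : probability Omega R).

Definition complete_prob : Prop :=
  forall N : set Omega, measurable N -> P N = 0%E ->
    forall A, A `<=` N -> measurable A.

(* mu : a fixed version of a map from Borel subsets of [0,1]^d to L_0 *)
Definition stochastic_measure (d : nat) (mu : set 'rV[R]_d -> Omega -> R) : Prop :=
  (forall A, borel_cube A -> measurable_fun setT (mu A)) /\
  (forall A B, borel_cube A -> borel_cube B -> A `&` B = set0 ->
     {ae P, forall w, mu (A `|` B) w = mu A w + mu B w}) /\
  (forall A : nat -> set 'rV[R]_d, (forall n, borel_cube (A n)) ->
     (forall n, A n.+1 `<=` A n) -> \bigcap_n A n = set0 ->
     forall e : R, 0 < e ->
       (fun n => P [set w | e <= `|mu (A n) w|]) @ \oo --> 0%E).

(* integral over [0,1]^d of a simple function h w.r.t. the fixed version mu: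
   sum over the (finitely many) values c of h on [0,1]^d of c mu(h = c) *)
Definition sm_int (d : nat) (mu : set 'rV[R]_d -> Omega -> R)
    (h : 'rV[R]_d -> R) (w : Omega) : R :=
  (\sum_(c \in h @` @cube R d) c * mu (@cube R d `&` h @^-1` [set c]) w)%R.

Definition haar_term (d : nat) (mu : set 'rV[R]_d -> Omega -> R)
    (g : 'rV[R]_d -> R) (k : nat) (w : Omega) : R :=
  if k == 0%N then sm_int mu (haar_S 0 g) w
  else sm_int mu (fun x => haar_S k g x - haar_S k.-1 g x) w.

End SM.

(* Main.v *)
(* A stochastic measure is bounded in probability: if |mu(A)| could be arbitrarily
   large, exhaustivity would fail, since an unbounded piece splits into many large
   atoms, a random union of them keeps a large value by a concentration estimate, and
   its complement stays unbounded, so that infinitely many disjoint large pieces can be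
   cut off.  Random signs then turn boundedness into an almost sure bound of
   sum_i (int h_i d mu)^2 for step functions with sum_i |h_i| <= 1 on the cube.
   A product Haar coefficient is bounded by a mixed difference of g over a dyadic box;
   averaging over the order of the coordinates gives the decay 2^(-gamma |levels|) with
   gamma = min(1, (l + alpha) / d) > 1/2 for f(z',.) - f(z,.), with a factor |z' - z|.
   As gamma > 1/2, Cauchy-Schwarz and the square function bound make the series of
   increments summable uniformly in z, and it can be differentiated term by term. *)
Require Import Defs.
From HB Require Import structures.
From mathcomp Require Import all_boot all_order all_algebra.
From mathcomp Require Import all_classical all_reals all_analysis.
From mathcomp Require Import measurable_realfun.
From mathcomp Require Import ring lra zify.
Set Implicit Arguments. Unset Strict Implicit. Unset Printing Implicit Defensive.
Import Order.TTheory GRing.Theory Num.Theory.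
Import numFieldNormedType.Exports.
Local Open Scope classical_set_scope.
Local Open Scope ring_scope.

(** * Averages over random signs and random subsets *)

(** One null set must serve all z at once, although z ranges over an uncountable interval.
    Randomness is therefore confined to the integrals of the countably many Haar products [psid]:
    off a null set independent of the integrand, each term of the series is a finite linear
    combination of these numbers with coefficients depending on z, and the remaining argument
    ([termwise_derivative]) is deterministic. The bounds by Cf control only increments of f in z, so
    the series has to be anchored at one point, z = a. There a much weaker decay, obtained from
    compactness, is enough: for a single fixed function the square function bound can be applied to
    whole dyadic blocks instead of single Haar products. A stochastic measure is additive only
    almost surely, with a null set depending on the sets. Working on the countable algebra of dyadic
    sets removes this obstacle, and the abstract boundedness argument can assume additivity at every
    point of Omega. *)

Section BernoulliAverage.
Variable R : realType.
Implicit Types (ps ys : seq R) (F G : seq bool -> R).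

(** Expectation over independent bits, true with the probabilities listed in [ps]. The recursion
    keeps the auxiliary randomness finite, so that no product space with Omega has to be formed. *)
Fixpoint ber ps F : R :=
  if ps is p :: ps' then
    p * ber ps' (fun b => F (true :: b)) + (1 - p) * ber ps' (fun b => F (false :: b))
  else F [::].

Definition indb (b : bool) : R := if b then 1 else 0.

Definition probs ps := all (fun p => 0 <= p <= 1) ps.

Lemma eq_ber ps F G : (forall b, size b = size ps -> F b = G b) -> ber ps F = ber ps G.
Proof.
elim: ps F G => [|p ps IH] F G FG /=; first exact: FG.
by congr (_ * _ + _ * _); apply: IH => b sb; apply: FG; rewrite /= sb.
Qed.

Lemma ler_ber ps F G : probs ps ->
  (forall b, size b = size ps -> F b <= G b) -> ber ps F <= ber ps G.
Proof.
elim: ps F G => [|p ps IH] F G /= => [_|/andP[/andP[p0 p1] hps]] FG; first exact: FG.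
apply: lerD; apply: ler_wpM2l => //; rewrite ?subr_ge0 //; apply: IH => // b sb;
  by apply: FG; rewrite /= sb.
Qed.

Lemma ber_cst ps (c : R) : ber ps (fun=> c) = c.
Proof. by elim: ps => //= p ps ->; rewrite -mulrDl addrC subrK mul1r. Qed.

Lemma berD ps F G : ber ps (fun b => F b + G b) = ber ps F + ber ps G.
Proof. by elim: ps F G => //= p ps IH F G; rewrite !IH; ring. Qed.

Lemma berZ ps c F : ber ps (fun b => c * F b) = c * ber ps F.
Proof. by elim: ps F => //= p ps IH F; rewrite !IH; ring. Qed.

Lemma berB ps F G : ber ps (fun b => F b - G b) = ber ps F - ber ps G.
Proof. by elim: ps F G => //= p ps IH F G; rewrite !IH; ring. Qed.

(** The first moment method, by which the random choices of signs and subsets below become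
    deterministic ones. *)
Lemma ber_exists ps F : probs ps -> exists2 b, size b = size ps & ber ps F <= F b.
Proof.
elim: ps F => [|p ps IH] F /=; first by exists [::].
case/andP => /andP[p0 p1] hps.
have [b1 s1 h1] := IH (fun b => F (true :: b)) hps.
have [b2 s2 h2] := IH (fun b => F (false :: b)) hps.
have [h|h] := lerP (F (false :: b2)) (F (true :: b1)).
  exists (true :: b1); rewrite /= ?s1 //; nra.
exists (false :: b2); rewrite /= ?s2 //; nra.
Qed.

Lemma probs_nseq n p : 0 <= p <= 1 -> probs (nseq n p).
Proof. by move=> hp; rewrite /probs all_nseq hp orbT. Qed.

Definition half n : seq R := nseq n 2^-1.

Lemma probs_half n : probs (half n).
Proof. by apply: probs_nseq; apply/andP; split; lra. Qed.

Definition sgb (b : bool) (y : R) := if b then y else - y.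

Definition signsum (b : seq bool) ys : R := \sum_(u <- zip b ys) sgb u.1 u.2.
Definition masksum (b : seq bool) ys : R := \sum_(y <- mask b ys) y.
Definition sqsum ys : R := \sum_(y <- ys) y ^+ 2.

Lemma sqsum_ge0 ys : 0 <= sqsum ys.
Proof. by apply: sumr_ge0 => y _; exact: sqr_ge0. Qed.

Lemma signsums0 b : signsum b [::] = 0.
Proof. by rewrite /signsum; case: b => [|c b]; rewrite big_nil. Qed.

Lemma signsum0s ys : signsum [::] ys = 0.
Proof. by rewrite /signsum; case: ys => [|y ys]; rewrite big_nil. Qed.

Lemma signsum_cons c b y ys : signsum (c :: b) (y :: ys) = sgb c y + signsum b ys.
Proof. by rewrite /signsum /= big_cons. Qed.

Lemma masksum_cons c b y ys :
  masksum (c :: b) (y :: ys) = (if c then y else 0) + masksum b ys.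
Proof. by rewrite /masksum /=; case: c; rewrite ?big_cons ?add0r. Qed.

Lemma sqsum_cons y ys : sqsum (y :: ys) = y ^+ 2 + sqsum ys.
Proof. by rewrite /sqsum big_cons. Qed.

Lemma ber_signsum2 ys :
  ber (half (size ys)) (fun b => signsum b ys ^+ 2) = sqsum ys.
Proof.
elim: ys => [|y ys IH] /=; first by rewrite /signsum /sqsum !big_nil expr0n.
rewrite sqsum_cons -IH.
rewrite (_ : 1 - 2^-1 = 2^-1 :> R); last lra.
rewrite -mulrDr -berD -berZ -[in RHS](ber_cst (half (size ys)) (y ^+ 2)) -berD.
by apply: eq_ber => b _; rewrite !signsum_cons /=; field.
Qed.

(** Odd powers cancel between the two signs, leaving S^4 + 6 y^2 S^2 + y^4. With [ber_signsum2] for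
    the middle term, the induction closes because 3 Q^2 + 6 y^2 Q + y^4 <= 3 (Q + y^2)^2. *)
Lemma ber_signsum4 ys :
  ber (half (size ys)) (fun b => signsum b ys ^+ 4) <= 3 * sqsum ys ^+ 2.
Proof.
elim: ys => [|y ys IH] /=; first by rewrite /signsum /sqsum !big_nil !expr0n mulr0.
rewrite sqsum_cons (_ : 1 - 2^-1 = 2^-1 :> R); last lra.
rewrite -mulrDr -berD -berZ.
rewrite (@eq_ber _ _ (fun b => signsum b ys ^+ 4 +
   (6 * y ^+ 2 * signsum b ys ^+ 2 + y ^+ 4))); last first.
  by move=> b _; rewrite !signsum_cons /=; field.
rewrite !berD berZ ber_cst ber_signsum2.
have := sqsum_ge0 ys; move: (sqsum ys) (ber _ _) IH => Q E IH Q0.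
have : 0 <= y ^+ 4 by apply: exprn_even_ge0.
by rewrite (_ : y ^+ 4 = y ^+ 2 * y ^+ 2); [move: (y ^+ 2) => z; nra|ring].
Qed.

(* Paley-Zygmund, from the pointwise bound 1[u >= 1/2] >= 2/5 (u - 1/2) - u^2/30 *)
Lemma ber_signsum_large ys : 0 < sqsum ys ->
  10^-1 <= ber (half (size ys)) (fun b => indb (sqsum ys / 2 <= signsum b ys ^+ 2)).
Proof.
set Q := sqsum ys => Q0.
(* For u = x^2 / Q the moments are E u = 1 and E u^2 <= 3, so [f] has mean at least 2/5 * 1/2 - 3/30
   = 1/10. *)
pose f b := 2 / 5 * (Q^-1 * signsum b ys ^+ 2 - 2^-1) -
  30^-1 * ((Q ^+ 2)^-1 * signsum b ys ^+ 4).
apply: (@le_trans _ _ (ber (half (size ys)) f)).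
  rewrite /f berB berZ berB !berZ ber_cst ber_signsum2 -/Q mulVf ?gt_eqF//.
  have := ber_signsum4 ys; rewrite -/Q; set E := ber _ _ => hE.
  have : (Q ^+ 2)^-1 * E <= 3.
    by rewrite mulrC ler_pdivrMr ?exprn_gt0.
  lra.
apply: ler_ber => [|b _]; first exact: probs_half.
rewrite /f; set x := signsum b ys.
have -> : (Q ^+ 2)^-1 * x ^+ 4 = (Q^-1 * x ^+ 2) ^+ 2.
  by field; rewrite gt_eqF.
have -> : (Q / 2 <= x ^+ 2) = (2^-1 <= Q^-1 * x ^+ 2).
  by rewrite -(ler_pM2l Q0) mulrA mulfV ?gt_eqF// mul1r.
move: (Q^-1 * x ^+ 2) => u; rewrite /indb; case: ifPn => [_|].
  by have := sqr_ge0 (u - 6); nra.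
by rewrite -ltNge => hu; have := sqr_ge0 u; nra.
Qed.

(** A sign that is + with probability (1 + l) / 2 has mean l and variance 1 - l^2 <= 1. The two
    claims go together: the vanishing mean removes the cross term in the induction for the second
    moment. *)
Lemma ber_round (ls : seq (R * R)) : all (fun u => `|u.1| <= 1) ls ->
  ber [seq (1 + u.1) / 2 | u <- ls] (fun b =>
    (signsum b (unzip2 ls) - \sum_(u <- ls) u.1 * u.2)) = 0 /\
  ber [seq (1 + u.1) / 2 | u <- ls] (fun b =>
    (signsum b (unzip2 ls) - \sum_(u <- ls) u.1 * u.2) ^+ 2) <= sqsum (unzip2 ls).
Proof.
elim: ls => [|[l y] ls IH] /=.
  by rewrite /signsum /sqsum !big_nil subr0 expr0n.
case/andP => hl hls; have [IH1 IH2] := IH hls.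
set S := \sum_(u <- ls) u.1 * u.2 in IH1 IH2.
pose D b := signsum b (unzip2 ls) - S.
set ps := [seq _ | u <- ls] in IH1 IH2 *.
have e1 b : signsum (true :: b) (y :: unzip2 ls) - \sum_(u <- (l, y) :: ls) u.1 * u.2 =
   D b + (1 - l) * y.
  by rewrite signsum_cons big_cons /D /= -/S; ring.
have e2 b : signsum (false :: b) (y :: unzip2 ls) - \sum_(u <- (l, y) :: ls) u.1 * u.2 =
   D b - (1 + l) * y.
  by rewrite signsum_cons big_cons /D /= -/S; ring.
split.
  rewrite (eq_ber (G := fun b => D b + (1 - l) * y)) //.
  rewrite [X in _ + _ * X](eq_ber (G := fun b => D b - (1 + l) * y)) //.
  by rewrite berD berB !ber_cst IH1; field.
rewrite (eq_ber (G := fun b => D b ^+ 2 + (2 * ((1 - l) * y) * D b + ((1 - l) * y) ^+ 2)));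
  last by move=> b _; rewrite e1; ring.
rewrite [X in _ + _ * X](eq_ber
  (G := fun b => D b ^+ 2 + ((- 2 * ((1 + l) * y)) * D b + ((1 + l) * y) ^+ 2))); last first.
  by move=> b _; rewrite e2; ring.
rewrite !berD !berZ !ber_cst IH1 sqsum_cons.
move: IH2; rewrite -/D; set E := ber _ _ => hE.
have : l ^+ 2 <= 1 by move: hl; rewrite ler_norml => /andP[]; nra.
have := sqr_ge0 y; nra.
Qed.

End BernoulliAverage.

Section BernoulliMask.
Variable R : realType.
Implicit Types ys : seq R.

Lemma ber_masksum (p : R) ys :
  ber (nseq (size ys) p) (fun b => masksum b ys) = p * \sum_(y <- ys) y.
Proof.
elim: ys => [|y ys IH] /=; first by rewrite /masksum !big_nil mulr0.
rewrite (eq_ber (G := fun b => y + masksum b ys)); last by move=> b _; rewrite masksum_cons.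
rewrite [X in _ + _ * X](eq_ber (G := fun b => masksum b ys)); last first.
  by move=> b _; rewrite masksum_cons add0r.
by rewrite berD ber_cst IH big_cons; ring.
Qed.

(* If |y| >= 1, the intervals of radius 1/2 around x and x - y are disjoint, so
   one more summand moves a concentration bound c >= 1/2 to p (1 - c) + (1 - p) c. *)
Lemma ber_masksum_conc (p x : R) ys : 0 <= p <= 2^-1 ->
  ber (nseq (size ys) p) (fun b => indb R (`|masksum b ys - x| < 2^-1)) <=
  2^-1 + 2^-1 * (1 - 2 * p) ^+ count (fun y => 1 <= `|y|) ys.
Proof.
move=> /andP[p0 p1]; elim: ys x => [|y ys IH] x /=.
  by rewrite /indb expr0; case: ifP => _; lra.
pose f x := ber (nseq (size ys) p) (fun b => indb R (`|masksum b ys - x| < 2^-1)).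
have hp : probs (nseq (size ys) p) by apply: probs_nseq; lra.
rewrite (eq_ber (G := fun b => indb R (`|masksum b ys - (x - y)| < 2^-1))); last first.
  by move=> b _; rewrite masksum_cons; congr (indb _ (`|_| < _)); ring.
rewrite [X in _ + _ * X](eq_ber (G := fun b => indb R (`|masksum b ys - x| < 2^-1)));
  last by move=> b _; rewrite masksum_cons add0r.
have := IH x; have := IH (x - y); rewrite -/(f x) -/(f (x - y)).
set c := count _ ys.
have q0 : 0 <= (1 - 2 * p) ^+ c by apply: exprn_ge0; lra.
case: (boolP (1 <= `|y|)) => [hy|_]; last by rewrite add0n; move=> ? ?; nra.
have : f x + f (x - y) <= 1.
  rewrite /f -berD -[leRHS](ber_cst (nseq (size ys) p)); apply: ler_ber => // b _.
  rewrite /indb; case: ifP => h1; case: ifP => h2; try lra.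
  have : `|y| < 1.
    have -> : y = (masksum b ys - (x - y)) - (masksum b ys - x) by ring.
    by apply: le_lt_trans (ler_normB _ _) _; lra.
  by move=> ?; lra.
rewrite add1n exprS; move: (f x) (f (x - y)) ((1 - 2 * p) ^+ c) q0 => u v q q0 *.
nra.
Qed.

End BernoulliMask.

(** * Probabilities on Omega as real expectations of indicators *)

Section Expectation.
Variables (R : realType) (dO : measure_display) (Omega : measurableType dO).
Variable P : probability Omega R.

Definition bmeas (F : Omega -> R) :=
  measurable_fun setT F /\ exists M, forall w, `|F w| <= M.

Lemma bmeas_integrable F : bmeas F -> P.-integrable setT (EFin \o F).
Proof.
move=> [mF [M hM]].
apply: measurable_bounded_integrable => //.
- by apply: (le_lt_trans (probability_le1 P measurableT)); rewrite ltry.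
- exists M; split; rewrite ?num_real// => x Mx w _.
  by apply: le_trans (hM w) _; exact: ltW.
Qed.

Definition Ex (F : Omega -> R) : R := \int[P]_w F w.

Lemma bmeas_cst c : bmeas (fun=> c).
Proof. by split; [exact: measurable_cst|exists `|c|]. Qed.

Lemma bmeasD F G : bmeas F -> bmeas G -> bmeas (fun w => F w + G w).
Proof.
move=> [mF [M hM]] [mG [N hN]]; split; first exact: measurable_funD.
by exists (M + N) => w; apply: le_trans (ler_normD _ _) _; exact: lerD.
Qed.

Lemma bmeasZ c F : bmeas F -> bmeas (fun w => c * F w).
Proof.
move=> [mF [M hM]]; split; first exact: measurable_funM.
by exists (`|c| * M) => w; rewrite normrM ler_wpM2l.
Qed.

Lemma bmeas_ind (c : Omega -> bool) : measurable_fun setT c -> bmeas (fun w => indb R (c w)).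
Proof.
move=> mc; split; last by exists 1 => w; rewrite /indb; case: ifP; rewrite ?normr1 ?normr0.
by apply: measurable_fun_ifT => //; exact: measurable_cst.
Qed.

Lemma Ex_cst c : Ex (fun=> c) = c.
Proof. by rewrite /Ex Rintegral_cst // [X in fine X](probability_setT P) mulr1. Qed.

Lemma ExD F G : bmeas F -> bmeas G -> Ex (fun w => F w + G w) = Ex F + Ex G.
Proof. by move=> hF hG; rewrite /Ex RintegralD //; exact: bmeas_integrable. Qed.

Lemma ExZ c F : bmeas F -> Ex (fun w => c * F w) = c * Ex F.
Proof. by move=> hF; rewrite /Ex RintegralZl //; exact: bmeas_integrable. Qed.

Lemma ler_Ex F G : bmeas F -> bmeas G -> (forall w, F w <= G w) -> Ex F <= Ex G.
Proof. by move=> hF hG h; apply: le_Rintegral => //; exact: bmeas_integrable. Qed.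

Lemma bmeas_ber ps (F : seq bool -> Omega -> R) : (forall b, bmeas (F b)) ->
  bmeas (fun w => ber ps (fun b => F b w)).
Proof.
elim: ps F => [|p ps IH] F hF //=.
by apply: bmeasD; apply: bmeasZ; apply: IH => b.
Qed.

Lemma Ex_ber ps (F : seq bool -> Omega -> R) : (forall b, bmeas (F b)) ->
  Ex (fun w => ber ps (fun b => F b w)) = ber ps (fun b => Ex (F b)).
Proof.
elim: ps F => [|p ps IH] F hF //=.
rewrite ExD; try by apply: bmeasZ; apply: bmeas_ber => b.
rewrite !ExZ; try by apply: bmeas_ber => b.
by rewrite !IH.
Qed.

(** Real-valued and defined through an expectation, so that linearity allows its exchange with
    [ber]; [pr_set] identifies it with the measure of the event. *)
Definition pr (c : Omega -> bool) : R := Ex (fun w => indb R (c w)).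

Lemma pr_ge0 c : 0 <= pr c.
Proof. by apply: Rintegral_ge0 => w _; rewrite /indb; case: ifP. Qed.

Lemma le_pr (c e : Omega -> bool) : measurable_fun setT c -> measurable_fun setT e ->
  (forall w, c w -> e w) -> pr c <= pr e.
Proof.
move=> mc me ce; apply: ler_Ex => [||w]; try exact: bmeas_ind.
by have := ce w; rewrite /indb; case: (c w) => [->|] //; case: ifP.
Qed.

Lemma pr_le1 c : measurable_fun setT c -> pr c <= 1.
Proof.
move=> mc; rewrite -[leRHS](Ex_cst 1); apply: ler_Ex => [||w]; first exact: bmeas_ind.
  exact: bmeas_cst.
by rewrite /indb; case: ifP.
Qed.

Lemma pr_or (c e1 e2 : Omega -> bool) : measurable_fun setT c ->
  measurable_fun setT e1 -> measurable_fun setT e2 ->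
  (forall w, c w -> e1 w || e2 w) -> pr c <= pr e1 + pr e2.
Proof.
move=> mc m1 m2 h; rewrite /pr -ExD; try exact: bmeas_ind.
apply: ler_Ex => [||w]; first exact: bmeas_ind.
  by apply: bmeasD; exact: bmeas_ind.
have := h w; rewrite /indb; case: (c w) => [/(_ isT)|_]; case: (e1 w); case: (e2 w) => //=; lra.
Qed.

Lemma measurable_pred (c : Omega -> bool) : measurable_fun setT c -> measurable [set w | c w].
Proof.
move=> mc; have := mc measurableT [set true] I; rewrite setTI.
by congr measurable; apply/funext => w; apply/propext.
Qed.

Lemma pr_set (c : Omega -> bool) : measurable_fun setT c ->
  P [set w | c w] = (pr c)%:E.
Proof.
move=> mc.
have mS := measurable_pred mc.
rewrite -[LHS]fineK ?fin_num_measure// -[in LHS](setIT [set w | c w]).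
rewrite -(integral_indic P measurableT mS) /pr /Ex /Rintegral; congr (fine _)%:E.
apply: eq_integral => w _; rewrite indicE /indb; congr (_%:E).
by case: ifPn => cw; [rewrite mem_set|rewrite memNset //; exact/negP].
Qed.

End Expectation.

Section ProbabilityTools.
Variables (R : realType) (dO : measure_display) (Omega : measurableType dO).
Variable P : probability Omega R.
Local Notation pr := (pr P).

(** Exchange of the two expectations: a bound k for the random bits at each fixed w in [e] passes to
    the averaged probability. Combined with [ber_exists], it provides one choice of bits that is
    good for many w. *)
Lemma pr_ber ps (c : seq bool -> Omega -> bool) (e : Omega -> bool) k :
  probs ps -> measurable_fun setT e -> (forall b, measurable_fun setT (c b)) ->
  (forall w, e w -> k <= ber ps (fun b => indb R (c b w))) ->
  k * pr e <= ber ps (fun b => pr (c b)).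
Proof.
move=> hps me mc h; rewrite /pr -Ex_ber; last by move=> b; exact: bmeas_ind.
rewrite -ExZ; last exact: bmeas_ind.
apply: ler_Ex => [||w]; first by apply: bmeasZ; exact: bmeas_ind.
  by apply: bmeas_ber => b; exact: bmeas_ind.
case: (boolP (e w)) => [/h|_]; first by rewrite /indb mulr1.
rewrite {1}/indb mulr0 -(ber_cst ps 0); apply: ler_ber => // b _.
by rewrite /indb; case: ifP.
Qed.

Lemma pr_tail (f : Omega -> R) (e : R) : measurable_fun setT f -> 0 < e ->
  exists s : R, pr (fun w => s < `|f w|) <= e.
Proof.
move=> mf e0; pose F (n : nat) := [set w | n%:R < `|f w|].
have mc n : measurable_fun setT (fun w => n%:R < `|f w|).
  by apply: measurable_fun_ltr; [exact: measurable_cst|exact: measurableT_comp].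
have mF n : measurable (F n) by exact: measurable_pred.
have F0 : \bigcap_n F n = set0.
  apply/seteqP; split => // w /= h; have := h (Num.truncn `|f w|).+1 I.
  by rewrite /F /= ltNge => /negP; apply; apply: ltW; exact: truncnS_gt.
have : P (F n) @[n --> \oo] --> P (\bigcap_n F n).
  apply: nonincreasing_cvg_mu => //.
  - by apply: le_lt_trans (probability_le1 P _) _; rewrite ?ltry.
  - exact: bigcap_measurable.
  - move=> i j ij; apply/subsetPset => w /=; rewrite /F /=.
    by apply: le_lt_trans; rewrite ler_nat.
rewrite F0 measure0 => /fine_cvgP[_ /cvgrPdist_le /(_ e e0)] [n _ /(_ n (leqnn n))].
rewrite /= sub0r normrN /F pr_set// /= => h; exists n%:R.
exact: le_trans (ler_norm _) h.
Qed.

End ProbabilityTools.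

(** * Boundedness in probability *)

Section BoundedRange.
Variables (R : realType) (dO : measure_display) (Omega : measurableType dO).
Variable P : probability Omega R.
Local Notation pr := (pr P).
Local Notation ind := (indb R).
Variables (X : Type) (X0 : set X) (AA : set (set X)) (m : set X -> Omega -> R).
Hypothesis AA_X0 : AA X0.
Hypothesis AA_sub : forall A, AA A -> A `<=` X0.
Hypothesis AA_D : forall A B, AA A -> AA B -> AA (A `\` B).
Hypothesis m_meas : forall A, AA A -> measurable_fun setT (m A).
Hypothesis m_add : forall A B w, AA A -> AA B -> A `&` B = set0 ->
  m (A `|` B) w = m A w + m B w.

Lemma AA_I A B : AA A -> AA B -> AA (A `&` B).
Proof. by move=> hA hB; rewrite -setDD; apply: AA_D => //; exact: AA_D. Qed.

Lemma AA_0 : AA set0.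
Proof. by rewrite -(setDv X0); exact: AA_D. Qed.

Lemma AA_U A B : AA A -> AA B -> AA (A `|` B).
Proof.
move=> hA hB; rewrite (_ : A `|` B = X0 `\` ((X0 `\` A) `\` B)).
  by do !apply: AA_D.
apply/seteqP; split => x.
  by case=> hx; [have := AA_sub hA hx|have := AA_sub hB hx] => hX; split=> // -[[]].
move=> [hx h]; apply: contrapT => /not_orP[nA nB]; exact: h.
Qed.

Lemma m0 w : m set0 w = 0.
Proof.
have := m_add w AA_0 AA_0 (setI0 _); rewrite setU0 => /eqP.
by rewrite -subr_eq0 opprD addrA subrr sub0r oppr_eq0 => /eqP.
Qed.

Lemma m_split A D w : AA A -> AA D -> m A w = m (A `&` D) w + m (A `\` D) w.
Proof.
move=> hA hD; rewrite -m_add; first by rewrite setDE -setIUr setUCr setIT.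
- exact: AA_I.
- exact: AA_D.
- by apply/seteqP; split => // x [[]] _ ? [].
Qed.

Definition cup (pi : seq (set X)) : set X := \big[setU/set0]_(A <- pi) A.

Fixpoint disj (pi : seq (set X)) : Prop :=
  if pi is A :: pi' then [/\ AA A, A `&` cup pi' = set0 & disj pi'] else True.

Definition vals pi w : seq R := [seq m A w | A <- pi].

Lemma cup_cons A pi : cup (A :: pi) = A `|` cup pi.
Proof. by rewrite /cup big_cons. Qed.

Lemma disj_cup pi : disj pi -> AA (cup pi).
Proof.
elim: pi => [|A pi IH] /=; first by rewrite /cup big_nil => _; exact: AA_0.
by case=> hA _ /IH hpi; rewrite cup_cons; exact: AA_U.
Qed.

Lemma m_cup pi w : disj pi -> m (cup pi) w = \sum_(y <- vals pi w) y.
Proof.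
elim: pi => [|A pi IH] /=; first by rewrite /cup !big_nil m0.
by case=> hA h0 hpi; rewrite cup_cons m_add ?big_cons -?IH //; exact: disj_cup.
Qed.

Lemma cup_mask b pi : cup (mask b pi) `<=` cup pi.
Proof.
elim: pi b => [|A pi IH] [|[] b] //=; first by rewrite /cup big_nil.
  by rewrite !cup_cons; exact: setUS.
by rewrite cup_cons; apply: subset_trans (IH b) _; exact: subsetUr.
Qed.

Lemma disj_mask b pi : disj pi -> disj (mask b pi).
Proof.
elim: pi b => [|A pi IH] [|[] b] //= [hA h0 hpi]; last exact: IH.
by split => //; [apply: subsetI_eq0 h0 => //; exact: cup_mask|exact: IH].
Qed.

Lemma m_cup_mask b pi w : disj pi -> m (cup (mask b pi)) w = masksum b (vals pi w).
Proof. by move=> h; rewrite (m_cup _ (disj_mask b h)) /masksum /vals map_mask. Qed.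

Lemma cup_map (f : set X -> set X) pi : f set0 = set0 ->
  (forall A B, f (A `|` B) = f A `|` f B) -> cup (map f pi) = f (cup pi).
Proof.
move=> f0 fU; elim: pi => [|A pi IH] /=; first by rewrite /cup !big_nil.
by rewrite !cup_cons fU IH.
Qed.

Lemma cup_map_I D pi : cup [seq A `&` D | A <- pi] = cup pi `&` D.
Proof. by apply: cup_map => *; rewrite ?set0I ?setIUl. Qed.

Lemma cup_map_D D pi : cup [seq A `\` D | A <- pi] = cup pi `\` D.
Proof. by apply: cup_map => *; rewrite ?set0D ?setDUl. Qed.

Lemma disj_map_I D pi : AA D -> disj pi -> disj [seq A `&` D | A <- pi].
Proof.
move=> hD; elim: pi => [|A pi IH] //= [hA h0 hpi]; split; [exact: AA_I| |exact: IH].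
by rewrite cup_map_I setIACA h0 set0I.
Qed.

Lemma disj_map_D D pi : AA D -> disj pi -> disj [seq A `\` D | A <- pi].
Proof.
move=> hD; elim: pi => [|A pi IH] //= [hA h0 hpi]; split; [exact: AA_D| |exact: IH].
by rewrite cup_map_D !setDE setIACA h0 set0I.
Qed.

Lemma cup_cat pi1 pi2 : cup (pi1 ++ pi2) = cup pi1 `|` cup pi2.
Proof. by rewrite /cup big_cat. Qed.

Lemma disj_cat pi1 pi2 : disj pi1 -> disj pi2 -> cup pi1 `&` cup pi2 = set0 ->
  disj (pi1 ++ pi2).
Proof.
elim: pi1 => [|A pi1 IH] //= [hA h0 h1] h2; rewrite cup_cons setIUl.
move=> e; have [e1 e2] : A `&` cup pi2 = set0 /\ cup pi1 `&` cup pi2 = set0.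
  by split; apply/seteqP; split => // x hx; rewrite -e; [left|right].
split => //; last exact: IH.
by rewrite cup_cat setIUr h0 e1 setU0.
Qed.

Lemma meas_vals (f : R -> R) pi : measurable_fun setT f -> disj pi ->
  measurable_fun setT (fun w => \sum_(y <- vals pi w) f y).
Proof.
move=> mf; elim: pi => [|A pi IH] /= => [_|[hA _ hpi]].
  by rewrite (_ : (fun _ => _) = cst 0) //; apply/funext => w; rewrite big_nil.
rewrite (_ : (fun _ => _) = (fun w => f (m A w) + \sum_(y <- vals pi w) f y)).
  apply: measurable_funD; last exact: IH.
  by apply: measurableT_comp => //; exact: m_meas.
by apply/funext => w; rewrite big_cons.
Qed.

Lemma meas_sqsum pi : disj pi -> measurable_fun setT (fun w => sqsum (vals pi w)).
Proof. by apply: meas_vals; exact: exprn_measurable. Qed.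

Lemma meas_gt (t : R) A : AA A -> measurable_fun setT (fun w => t < `|m A w|).
Proof.
move=> hA; apply: measurable_fun_ltr; first exact: measurable_cst.
by apply: measurableT_comp => //; exact: m_meas.
Qed.

Lemma meas_ge (t : R) A : AA A -> measurable_fun setT (fun w => t <= `|m A w|).
Proof.
move=> hA; apply: measurable_fun_ler; first exact: measurable_cst.
by apply: measurableT_comp => //; exact: m_meas.
Qed.

(** Unboundedness is measured by sums of squares over partitions, not by values of single sets: such
    sums add up over disjoint pieces ([sqsum_grid]) and survive refinement up to a factor
    ([sqsum_refine]), whereas values of sets may cancel. *)
Definition unb B (c : R) := forall t : R, exists pi,
  [/\ disj pi, cup pi `<=` B & c <= pr (fun w => t < sqsum (vals pi w))].

Lemma signsum_mask b ys : size b = size ys ->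
  signsum b ys = masksum b ys - masksum (map negb b) ys :> R.
Proof.
elim: ys b => [|y ys IH] [|c b] //=; first by rewrite /signsum /masksum !big_nil subr0.
by case=> /IH e; rewrite signsum_cons !masksum_cons e; case: c => /=; ring.
Qed.

Lemma size_vals pi w : size (vals pi w) = size pi.
Proof. exact: size_map. Qed.

Lemma meas_signsum b pi : disj pi -> measurable_fun setT (fun w => signsum b (vals pi w)).
Proof.
elim: pi b => [|A pi IH] [|c b] /=;
  try by move=> _; rewrite (_ : (fun _ => _) = cst 0) //;
  apply/funext => w; rewrite /signsum /= big_nil.
case=> hA _ hpi.
rewrite (_ : (fun _ => _) = (fun w => sgb c (m A w) + signsum b (vals pi w))).
  apply: measurable_funD; last exact: IH.
  case: c; first exact: m_meas.
  by apply: (measurableT_comp (f := @GRing.opp R)) => //; exact: m_meas.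
by apply/funext => w; rewrite signsum_cons.
Qed.

(** Where the sum of squares exceeds 8 s^2, at least a tenth of the sign choices give a squared
    signed sum of at least half of it, hence above 4 s^2 ([ber_signsum_large]). Averaging over w
    yields one choice [b] independent of w. *)
Lemma pr_sqsum_signs n (ys : Omega -> seq R) (s : R) : 0 <= s ->
  (forall w, size (ys w) = n) ->
  (forall b, measurable_fun setT (fun w => signsum b (ys w))) ->
  measurable_fun setT (fun w => sqsum (ys w)) ->
  exists2 b, size b = n &
  10^-1 * pr (fun w => 8 * s ^+ 2 < sqsum (ys w)) <=
    pr (fun w => 2 * s < `|signsum b (ys w)|).
Proof.
move=> s0 sys ms mq.
have mF b : measurable_fun setT (fun w => 2 * s < `|signsum b (ys w)|).
  by apply: measurable_fun_ltr; [exact: measurable_cst|exact: measurableT_comp].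
have [b sb hb] := ber_exists
  (fun b => pr (fun w => 2 * s < `|signsum b (ys w)|)) (probs_half R n).
exists b; first by rewrite sb size_nseq.
apply: le_trans hb; apply: pr_ber => //; first exact: probs_half.
  by apply: measurable_fun_ltr; first exact: measurable_cst.
move=> w hw.
have Q0 : 0 < sqsum (ys w) by apply: le_lt_trans hw; rewrite mulr_ge0 ?sqr_ge0.
apply: le_trans (ber_signsum_large Q0) _; rewrite sys.
apply: ler_ber => [|c _]; first exact: probs_half.
rewrite /indb; case: ifP => h1; case: ifP => // h2; exfalso; move/negP: h2; apply.
rewrite -(@ltr_pXn2r _ 2) ?nnegrE ?mulr_ge0 // real_normK ?num_real //.
nra.
Qed.

(** The signed sum is the value on the union of the plus atoms minus the value on the union of the
    minus atoms; if it exceeds 2 t, one of the two exceeds t. *)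
Lemma pr_signsum b pi (t : R) : disj pi -> size b = size pi ->
  pr (fun w => 2 * t < `|signsum b (vals pi w)|) <=
  pr (fun w => t < `|m (cup (mask b pi)) w|) +
  pr (fun w => t < `|m (cup (mask (map negb b) pi)) w|).
Proof.
move=> hpi sb; have hmask b' : AA (cup (mask b' pi)) by apply: disj_cup; exact: disj_mask.
apply: pr_or.
- apply: measurable_fun_ltr; first exact: measurable_cst.
  by apply: measurableT_comp => //; exact: meas_signsum.
- exact: meas_gt.
- exact: meas_gt.
- move=> w; rewrite signsum_mask ?size_vals // !m_cup_mask // => h.
  have {}h := lt_le_trans h (ler_normB _ _).
  apply/orP; have [h'|h'] := ltP t `|masksum b (vals pi w)|; first by left.
  by right; lra.
Qed.

(** The factor 1/20 is 1/10 from the choice of signs times 1/2 from the choice between the plus set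
    and the minus set. *)
Lemma unb_large B c : unb B c -> forall t : R,
  exists D, [/\ AA D, D `<=` B & c / 20 <= pr (fun w => t < `|m D w|)].
Proof.
move=> hB t; have [pi [hpi piB hc]] := hB (8 * `|t| ^+ 2).
have [b sb hb] := pr_sqsum_signs (normr_ge0 t) (size_vals pi)
  (fun b => meas_signsum b hpi) (meas_sqsum hpi).
have hmask b' : AA (cup (mask b' pi)) by apply: disj_cup; exact: disj_mask.
have hm2 := pr_signsum `|t| hpi sb.
have hle A : AA A -> pr (fun w => `|t| < `|m A w|) <= pr (fun w => t < `|m A w|).
  move=> hA; apply: le_pr; [exact: meas_gt|exact: meas_gt|].
  by move=> w; apply: le_lt_trans; exact: ler_norm.
have h3 := hle _ (hmask b); have h4 := hle _ (hmask (map negb b)).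
have [h|h] := lerP (c / 20) (pr (fun w => t < `|m (cup (mask b pi)) w|)).
  by exists (cup (mask b pi)); split => //; apply: subset_trans piB; exact: cup_mask.
exists (cup (mask (map negb b) pi)); split => //.
  by apply: subset_trans piB; exact: cup_mask.
lra.
Qed.

Definition cnt (th : R) ys := count (fun y : R => th <= `|y|) ys.

(** A sum of size 2 th has a summand of size th, so splitting loses nothing in the count once the
    threshold is halved; an index with both summands large is counted twice on the right. *)
Lemma cnt_split th (yzs : seq (R * R)) :
  (cnt (2 * th) [seq (u.1 + u.2)%R | u <- yzs] +
   has (fun u => (th <= `|u.1|) && (th <= `|u.2|))%R yzs <=
   cnt th (unzip1 yzs) + cnt th (unzip2 yzs))%N.
Proof.
elim: yzs => [|[y z] l IH] //=.
have : ((2 * th <= `|y + z|)%R + ((th <= `|y|) && (th <= `|z|))%R <=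
        (th <= `|y|)%R + (th <= `|z|)%R)%N.
  case: (lerP th `|y|) => hy; case: (lerP th `|z|) => hz /=; rewrite ?addn0 ?addn1 //;
    try by case: (_ <= _).
  suff /lt_geF -> : `|y + z| < 2 * th by [].
  by apply: le_lt_trans (ler_normD _ _) _; lra.
move: IH; rewrite /cnt /=; case: (has _ _) => /=; case: (_ && _) => /=; lia.
Qed.

Lemma meas_cnt th pi : disj pi -> measurable_fun setT (fun w => (cnt th (vals pi w))%:R : R).
Proof.
have e ys : (cnt th ys)%:R = \sum_(y <- ys) ind (th <= `|y|) :> R.
  by elim: ys => [|y ys IH]; rewrite ?big_nil ?big_cons //= natrD -IH /indb; case: (_ <= _).
move=> hpi; under eq_fun do rewrite e.
apply: meas_vals => //; apply: measurable_fun_ifT; try exact: measurable_cst.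
by apply: measurable_fun_ler; [exact: measurable_cst|exact: normr_measurable].
Qed.

(* Cut by sets D_1, D_2, ... whose measures live on rapidly growing scales: each D_k
   splits some atom into two pieces that are both large. *)
Lemma many_large_atoms B (c : R) : AA B -> 0 < c ->
  (forall t : R, exists D, [/\ AA D, D `<=` B & c <= pr (fun w => t < `|m D w|)]) ->
  forall n (th : R), 0 < th -> exists pi, [/\ disj pi, cup pi = B &
    exists K : Omega -> R, [/\ bmeas K, forall w, 0 <= K w <= n%:R,
      forall w, K w <= (cnt th (vals pi w))%:R & n%:R * (c / 2) <= Ex P K]].
Proof.
move=> hB c0 hD; elim=> [|n IH] th th0.
  exists [:: B]; split; first by split => //; rewrite /cup big_nil setI0.
    by rewrite /cup big_seq1.
  exists (fun=> 0); split; [exact: bmeas_cst|by move=> w; rewrite lexx| |].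
    by move=> w; rewrite ler0n.
  by rewrite mul0r Ex_cst.
(* The threshold is doubled in the induction hypothesis because [cnt_split] halves it at each
   cut. *)
have [|pi [hpi piB [K [mK K0 Kc EK]]]] := IH (2 * th); first lra.
pose S w : R := \sum_(y <- vals pi w) `|y|.
have mS : measurable_fun setT S by apply: meas_vals.
have c2 : 0 < c / 2 by lra.
have [s hs] := pr_tail P mS c2.
have S0 w : 0 <= S w by apply: sumr_ge0.
(* If |m D| exceeds [t], some atom A has a piece inside D larger than |s| + th. As |m A| <= S <= s
   off an event of probability at most c / 2, the piece of A outside D then exceeds th too. *)
pose t := (size pi)%:R * (`|s| + th).
have [D [hDA DB hDc]] := hD t.
pose pi' := [seq A `&` D | A <- pi] ++ [seq A `\` D | A <- pi].
pose F w := (t < `|m D w|) && (S w <= s).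
have mF1 : measurable_fun setT (fun w => t < `|m D w|) by exact: meas_gt.
have mF2 : measurable_fun setT (fun w => S w <= s).
  by apply: measurable_fun_ler => //; exact: measurable_cst.
have mF : measurable_fun setT F by exact: measurable_and.
have hF : c / 2 <= pr F.
  have : pr (fun w => t < `|m D w|) <= pr F + pr (fun w => s < `|S w|).
    apply: pr_or => //.
      apply: measurable_fun_ltr; first exact: measurable_cst.
      exact: measurableT_comp.
    move=> w h; rewrite /F h /=; have [//|h'] := lerP (S w) s.
    by rewrite (lt_le_trans h' (ler_norm _)).
  lra.
exists pi'; split.
- apply: disj_cat; [exact: disj_map_I|exact: disj_map_D|].
  by rewrite cup_map_I cup_map_D; apply/seteqP; split => // x [[_ h] []].
- by rewrite cup_cat cup_map_I cup_map_D setDE -setIUr setUCr setIT.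
exists (fun w => K w + ind (F w)); split.
- by apply: bmeasD => //; exact: bmeas_ind.
- move=> w; have /andP[k1 k2] := K0 w; rewrite /indb -natr1; case: ifP => _; apply/andP; split; lra.
- move=> w.
  pose l := [seq (m (A `&` D) w, m (A `\` D) w) | A <- pi].
  have e1 : unzip1 l = vals [seq A `&` D | A <- pi] w by rewrite /l /unzip1 /vals -!map_comp.
  have e2 : unzip2 l = vals [seq A `\` D | A <- pi] w by rewrite /l /unzip2 /vals -!map_comp.
  have eV : [seq u.1 + u.2 | u <- l] = vals pi w.
    rewrite /l /vals -map_comp; elim: (pi) hpi => //= A r IHr [hA _ hr].
    by rewrite -m_split // IHr.
  have := cnt_split th l; rewrite eV e1 e2.
  rewrite /pi' /vals map_cat /cnt count_cat -/(cnt _ _).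
  move=> h; apply: le_trans (_ : (cnt (2 * th) (vals pi w) + F w)%:R <= _).
    rewrite natrD; apply: lerD; first exact: Kc.
    by rewrite /indb; case: (F w).
  rewrite ler_nat; apply: leq_trans h; rewrite leq_add2l.
  case: (boolP (F w)) => //= /andP[h1 h2]; rewrite lt0b.
  apply: contraLR h1 => /hasPn h1; rewrite -leNgt.
  have -> : m D w = \sum_(u <- l) u.1.
    rewrite -(big_map fst xpredT id) -/(unzip1 l) e1 -m_cup; last exact: disj_map_I.
    by rewrite cup_map_I piB setIC setIidl.
  have -> : t = \sum_(u <- l) (`|s| + th).
    by rewrite big_const_seq count_predT iter_addr_0 size_map /t mulr_natl.
  apply: le_trans (ler_norm_sum _ _ _) _; rewrite [leLHS]big_seq [leRHS]big_seq.
  apply: ler_sum => u ul; have := h1 _ ul; rewrite negb_and -!ltNge.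
  case/orP => h3; first by have := normr_ge0 s; lra.
  have h4 : `|u.1 + u.2| <= S w.
    rewrite /S -eV big_map (big_rem _ ul) /= lerDl; apply: sumr_ge0 => *; exact: normr_ge0.
  have := ler_norm s; have := ler_normB (u.1 + u.2) u.2; rewrite addrK; lra.
- rewrite ExD //; last exact: bmeas_ind.
  by rewrite -natr1 mulrDl mul1r; apply: lerD.
Qed.

Lemma unb_le B c c' : c' <= c -> unb B c -> unb B c'.
Proof. by move=> h hB t; have [pi [? ? ?]] := hB t; exists pi; split => //; lra. Qed.

(** The mean of K is at least M c / 40, while K is at most N plus M times the indicator of the
    event. Taking M > 80 N / c leaves probability c / 40 - c / 80, which does not depend on N. *)
Lemma unb_many_large B (c : R) (N : nat) : AA B -> 0 < c -> unb B c ->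
  exists pi, [/\ disj pi, cup pi = B &
    c / 80 <= pr (fun w => N%:R <= (cnt 1 (vals pi w))%:R :> R)].
Proof.
move=> hB c0 /unb_large hD.
have c1 : 0 < c / 20 by lra.
pose M := (Num.truncn (N%:R * (80 / c))).+1.
have [pi [hpi piB [K [mK K0 Kc EK]]]] := many_large_atoms hB c1 hD M (ltr01 : 0 < 1 :> R).
exists pi; split => //.
set e := fun w : Omega => _.
have me : measurable_fun setT e.
  by apply: measurable_fun_ler; [exact: measurable_cst|exact: meas_cnt].
have M0 : N%:R * (80 / c) < M%:R by exact: truncnS_gt.
have M0' : 0 < M%:R :> R by rewrite ltr0n.
have : M%:R * (c / 20 / 2) <= N%:R + M%:R * pr e.
  have mI : bmeas (fun w => ind (e w)) by exact: bmeas_ind.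
  have mMI : bmeas (fun w => M%:R * ind (e w)) by exact: bmeasZ.
  have mN : bmeas (fun _ : Omega => N%:R : R) by exact: bmeas_cst.
  have -> : N%:R + M%:R * pr e = Ex P (fun w => N%:R + M%:R * ind (e w)).
    by rewrite ExD // ExZ // Ex_cst.
  apply: le_trans EK _; apply: ler_Ex => [//||w]; first exact: bmeasD.
  have /andP[_ k2] := K0 w; have := Kc w.
  rewrite /indb /e; case: ifP => [_ _|/negbT]; first by have := ler0n R N; lra.
  rewrite -ltNge; lra.
have h : N%:R * 80 < M%:R * c by rewrite -ltr_pdivrMr // -mulrA.
move: (pr e) => q hq; nra.
Qed.

Lemma cup_disj_grid pi rho : disj pi -> disj rho ->
  disj (flatten [seq [seq a `&` e | a <- pi] | e <- rho]) /\
  cup (flatten [seq [seq a `&` e | a <- pi] | e <- rho]) = cup pi `&` cup rho.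
Proof.
move=> hpi; elim: rho => [|e rho IH] /=; first by rewrite /cup !big_nil setI0.
case=> he h0 /IH[h1 h2]; split.
  apply: disj_cat => //; first exact: disj_map_I.
  by rewrite cup_map_I h2 setIACA h0 setI0.
by rewrite cup_cat h2 cup_map_I cup_cons setIUr.
Qed.

Lemma pr_ber_le ps (c : seq bool -> Omega -> bool) (k : R) :
  (forall b, measurable_fun setT (c b)) ->
  (forall w, ber ps (fun b => ind (c b w)) <= k) ->
  ber ps (fun b => pr (c b)) <= k.
Proof.
move=> mc h; rewrite /pr -Ex_ber => [|b]; last exact: bmeas_ind.
rewrite -[leRHS](Ex_cst P); apply: ler_Ex => [||//]; last exact: bmeas_cst.
by apply: bmeas_ber => b; exact: bmeas_ind.
Qed.

Lemma sqr_sum_le (I : Type) (r : seq I) (f : I -> R) :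
  (\sum_(i <- r) f i) ^+ 2 <= (size r)%:R * \sum_(i <- r) f i ^+ 2.
Proof.
elim: r => [|i r IH] /=; first by rewrite !big_nil expr0n mul0r.
rewrite !big_cons -natr1.
have : 0 <= \sum_(j <- r) (f i - f j) ^+ 2 by apply: sumr_ge0 => *; exact: sqr_ge0.
have -> : \sum_(j <- r) (f i - f j) ^+ 2 =
  (size r)%:R * f i ^+ 2 - 2 * f i * \sum_(j <- r) f j + \sum_(j <- r) f j ^+ 2.
  elim: r {IH} => [|j r IHr] /=; first by rewrite !big_nil; ring.
  by rewrite !big_cons IHr -natr1; ring.
move: IH; set S := \sum_(j <- r) f j; set Q := \sum_(j <- r) f j ^+ 2; nra.
Qed.

Lemma masksum_negb b ys : size b = size ys ->
  masksum (map negb b) ys = \sum_(y <- ys) y - masksum b ys :> R.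
Proof.
elim: ys b => [|y ys IH] [|c b] //=; first by rewrite /masksum !big_nil subr0.
by case=> /IH e; rewrite !masksum_cons big_cons e; case: c => /=; ring.
Qed.

Lemma sqsum_grid pi rho w :
  sqsum (vals (flatten [seq [seq a `&` e | a <- pi] | e <- rho]) w) =
  \sum_(e <- rho) sqsum (vals [seq a `&` e | a <- pi] w).
Proof.
elim: rho => [|e rho IH] /=; first by rewrite /sqsum !big_nil.
by rewrite big_cons -IH /vals map_cat /sqsum big_cat.
Qed.

(** Cauchy-Schwarz on each atom of [pi], which [rho] cuts into [size rho] pieces. *)
Lemma sqsum_refine pi rho w : disj pi -> disj rho -> cup pi `<=` cup rho ->
  sqsum (vals pi w) <= (size rho)%:R *
    \sum_(e <- rho) sqsum (vals [seq a `&` e | a <- pi] w).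
Proof.
move=> hpi hrho; elim: pi hpi => [|a pi IH] /=.
  by move=> _ _; rewrite {1}/sqsum big_nil mulr_ge0 //; apply: sumr_ge0 => *; exact: sqsum_ge0.
move=> [ha h0 hpi]; rewrite cup_cons => hsub.
rewrite sqsum_cons.
under [X in _ <= _ * X]eq_bigr do rewrite sqsum_cons.
rewrite big_split mulrDr; apply: lerD; last first.
  by apply: IH => // x hx; apply: hsub; right.
have -> : m a w = \sum_(e <- rho) m (a `&` e) w.
  rewrite (_ : m a w = m (cup [seq e `&` a | e <- rho]) w); last first.
    by congr m; rewrite cup_map_I setIC setIidl // => x hx; apply: hsub; left.
  rewrite m_cup; last exact: disj_map_I.
  by rewrite /vals -map_comp big_map; apply: eq_bigr => e _ /=; rewrite setIC.
exact: sqr_sum_le.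
Qed.

(** A is a random union of atoms of a partition [rho] with many large atoms, each atom being taken
    with a small probability p. The number of large atoms gives |m A| >= 1/2 with a fixed chance
    ([ber_masksum_conc]), while smallness of p lets the complement keep half of the sum of squares
    except with probability 2 p. *)
Lemma unb_step B (c0 c delta : R) : AA B -> 0 < c0 -> c0 <= c -> 0 < delta -> unb B c ->
  exists A, [/\ AA A, A `<=` B, c0 / 640 <= pr (fun w => 2^-1 <= `|m A w|) &
    unb (B `\` A) (c - delta)].
Proof.
move=> hB hc0 c0c hdelta hunb.
(* Here 1/320 = 1/80 * 1/4: the first factor is from [unb_many_large], the second is what the
   concentration bound 1/2 + 1/2 * 1/2 leaves. *)
pose c3 := c0 / 320.
have c30 : 0 < c3 by rewrite /c3; lra.
(* Small enough that a mean loss of 2 p, weighted by 1 / delta, costs at most half of [c3]. *)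
pose p := Num.min (delta * c3 / 4) 4^-1.
have p0 : 0 < p by rewrite /p lt_min; apply/andP; split; [nra|lra].
have p1 : p <= 4^-1 by rewrite /p ge_min lexx orbT.
have p2 : 2 * p / delta <= c3 / 2.
  by rewrite ler_pdivrMr //; have : p <= delta * c3 / 4 by [rewrite /p ge_min lexx]; lra.
have [N hN] : exists N, (1 - 2 * p) ^+ N <= 2^-1.
  have : (1 - 2 * p) ^+ n @[n --> \oo] --> (0 : R).
    by apply: cvg_expr; rewrite ger0_norm; lra.
  move=> /cvgrPdist_le /(_ (2^-1)) [|n _ /(_ n (leqnn n))]; first by lra.
  by rewrite /= sub0r normrN => h; exists n; exact: le_trans (ler_norm _) h.
have [rho [hrho rhoB hl]] := unb_many_large N hB hc0 (unb_le c0c hunb).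
pose A b := cup (mask b rho).
have hA b : AA (A b) by apply: disj_cup; exact: disj_mask.
have hpp : probs (nseq (size rho) p) by apply: probs_nseq; lra.
have h1 : c3 <= ber (nseq (size rho) p) (fun b => pr (fun w => 2^-1 <= `|m (A b) w|)).
  apply: le_trans (_ : 4^-1 * pr (fun w => N%:R <= (cnt 1 (vals rho w))%:R :> R) <= _).
    by rewrite /c3; lra.
  apply: pr_ber => //.
  - by apply: measurable_fun_ler; [exact: measurable_cst|exact: meas_cnt].
  - by move=> b; exact: meas_ge.
  move=> w hw.
  have hp2 : 0 <= p <= 2^-1 by lra.
  have := ber_masksum_conc 0 (vals rho w) hp2.
  rewrite size_vals -/(cnt 1 _) => hconc.
  have hpow : (1 - 2 * p) ^+ cnt 1 (vals rho w) <= 2^-1.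
    by apply: le_trans hN; apply: ler_wiXn2l; [lra|lra|rewrite -(ler_nat R)].
  rewrite (eq_ber (G := fun b => 1 + -1 * ind (`|masksum b (vals rho w) - 0| < 2^-1))).
    by rewrite berD ber_cst berZ; lra.
  move=> b _; rewrite subr0 m_cup_mask // /indb; case: lerP => _; lra.
have hgood t : exists b, [/\ size b = size rho,
    c0 / 640 <= pr (fun w => 2^-1 <= `|m (A b) w|) &
    exists pi, [/\ disj pi, cup pi `<=` B `\` A b &
      c - delta <= pr (fun w => t < sqsum (vals pi w))]].
  (* The factor [size rho] pays for refining [pi] by [rho], the factor 2 for the half that may be
     removed together with A. *)
  have [pi [hpi piB hQ]] := hunb (2 * `|t| * (size rho)%:R).
  pose E w := 2 * `|t| * (size rho)%:R < sqsum (vals pi w).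
  pose pib b := flatten [seq [seq a `&` e | a <- pi] | e <- mask (map negb b) rho].
  have [hpib cpib] : (forall b, disj (pib b)) /\
      (forall b, cup (pib b) = cup pi `&` cup (mask (map negb b) rho)).
    by split => b; have [] := cup_disj_grid hpi (disj_mask (map negb b) hrho).
  have mE : measurable_fun setT E.
    by apply: measurable_fun_ltr; [exact: measurable_cst|exact: meas_sqsum].
  have mG b : measurable_fun setT (fun w => t < sqsum (vals (pib b) w)).
    by apply: measurable_fun_ltr; [exact: measurable_cst|exact: meas_sqsum].
  pose loss b := pr (fun w => E w && ~~ (t < sqsum (vals (pib b) w))).
  have mL b : measurable_fun setT (fun w => E w && ~~ (t < sqsum (vals (pib b) w))).
    by apply: measurable_and => //; exact: measurable_neg.
  have hloss : ber (nseq (size rho) p) loss <= 2 * p.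
    apply: pr_ber_le => // w.
    case: (boolP (E w)) => [Ew|_]; last first.
      rewrite (eq_ber (G := fun=> 0)) ?ber_cst //; lra.
    pose qs := [seq sqsum (vals [seq a `&` e | a <- pi] w) | e <- rho].
    pose S := \sum_(q <- qs) q.
    have St : 2 * `|t| < S.
      have := sqsum_refine w hpi hrho; rewrite rhoB => /(_ piB) h.
      have := lt_le_trans Ew h; rewrite mulrC.
      have [->|s0] := posnP (size rho); first by rewrite !mul0r ltxx.
      by rewrite ltr_pM2l ?ltr0n // /S /qs big_map.
    have S0 : 0 < S by have := normr_ge0 t; lra.
    (* Markov's inequality: since |t| < S / 2, the complement can fail to exceed t only if the
       removed part is at least S / 2, and the removed part has mean p * S. *)
    apply: le_trans (_ : ber (nseq (size rho) p) (fun b => 2 / S * masksum b qs) <= _).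
      apply: ler_ber => // b; rewrite size_nseq => sb /=.
      rewrite sqsum_grid.
      have -> : \sum_(e <- mask (map negb b) rho) sqsum (vals [seq a `&` e | a <- pi] w) =
          S - masksum b qs.
        by rewrite -masksum_negb ?size_map // /masksum /qs -map_mask big_map.
      have hm : 0 <= masksum b qs.
        rewrite /masksum /qs -map_mask big_map; apply: sumr_ge0 => *; exact: sqsum_ge0.
      rewrite /indb -leNgt; case: ifP => h; last by rewrite mulr_ge0 // divr_ge0 // ltW.
      have : S <= 2 * masksum b qs by have := ler_norm t; lra.
      by rewrite mulrAC ler_pdivlMr // mul1r.
    have := ber_masksum p qs; rewrite {1}/qs size_map berZ => ->.
    by rewrite -/S (_ : 2 / S * (p * S) = 2 * p) //; field; rewrite gt_eqF.
  (* A single functional handles both requirements. A value of at least [c3] / 2 = c0 / 640 bounds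
     the probability from below and, probabilities being at most 1, bounds the loss by delta. *)
  have [b sb hb] := ber_exists (fun b => pr (fun w => 2^-1 <= `|m (A b) w|) +
     - delta^-1 * loss b) hpp.
  move: sb; rewrite size_nseq => sb.
  have hF : c3 / 2 <= pr (fun w => 2^-1 <= `|m (A b) w|) + - delta^-1 * loss b.
    apply: le_trans hb; rewrite berD berZ.
    have : delta^-1 * ber (nseq (size rho) p) loss <= 2 * p / delta.
      by rewrite mulrC ler_wpM2r // invr_ge0 ltW.
    lra.
  have l0 : 0 <= delta^-1 * loss b by rewrite mulr_ge0 ?invr_ge0 ?pr_ge0 // ltW.
  exists b; split => //; first by rewrite /c3 in hF; lra.
  exists (pib b); split => //.
    rewrite cpib => x [hx1 hx2]; split; first exact: piB.
    move=> hx3; have : cup (mask b rho) `&` cup (mask (map negb b) rho) = set0.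
      elim: (rho) b hrho {sb hb hF l0 hx2 hx3} => [|e r IHr] [|[] b] //=;
        try by rewrite /cup !big_nil ?set0I ?setI0.
        move=> [_ h0 /IHr hr]; rewrite cup_cons setIUl hr setU0.
        by apply: subsetI_eq0 h0 => //; exact: cup_mask.
      move=> [_ h0 /IHr hr]; rewrite cup_cons setIUr hr setU0 setIC.
      by apply: subsetI_eq0 h0 => //; exact: cup_mask.
    by move/seteqP => [/(_ x) h _]; exact: h.
  have : pr E <= pr (fun w => t < sqsum (vals (pib b) w)) + loss b.
    by apply: pr_or => // w ->; case: (_ < _).
  have hp1 : pr (fun w => 2^-1 <= `|m (A b) w|) <= 1 by apply: pr_le1; exact: meas_ge.
  have : loss b <= delta.
    have : delta^-1 * loss b <= 1 by lra.
    by rewrite mulrC ler_pdivrMr // mul1r.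
  rewrite /E in hQ *; lra.
(* In [hgood] the mask depends on t. There are finitely many masks; if each admissible one failed at
   a level T b, all would fail at the sum of the |T b|, against [hgood] at that level. *)
apply: contrapT => /forallNP hno.
have : forall b : (size rho).-tuple bool, exists t : R,
    c0 / 640 <= pr (fun w => 2^-1 <= `|m (A b) w|) ->
    ~ exists pi, [/\ disj pi, cup pi `<=` B `\` A b &
      c - delta <= pr (fun w => t < sqsum (vals pi w))].
  move=> b; have [hk|hk] := boolP (c0 / 640 <= pr (fun w => 2^-1 <= `|m (A b) w|));
    last by exists 0.
  apply: contrapT => /forallNP hb; apply: (hno (A b)); split => //.
    by rewrite -rhoB; exact: cup_mask.
  by move=> t; apply: contrapT => hn; apply: (hb t) => _.
move=> /choice[T hT].
have [b [/eqP sb hb [pi [hpi piB hc]]]] := hgood (\sum_b `|T b|).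
apply: (hT (Tuple sb)) => //; exists pi; split => //.
apply: le_trans hc _; apply: le_pr.
- by apply: measurable_fun_ltr; [exact: measurable_cst|exact: meas_sqsum].
- by apply: measurable_fun_ltr; [exact: measurable_cst|exact: meas_sqsum].
move=> w; apply: le_lt_trans; apply: le_trans (ler_norm _) _.
by rewrite (bigD1 (Tuple sb)) //= lerDl sumr_ge0.
Qed.

Hypothesis m_exhaustive : forall A : nat -> set X, (forall n, AA (A n)) ->
  (forall i j, (i < j)%N -> A i `&` A j = set0) ->
  forall k : R, 0 < k -> exists n, pr (fun w => 2^-1 <= `|m (A n) w|) < k.

Theorem bounded_range (e : R) : 0 < e ->
  exists t : R, forall A, AA A -> pr (fun w => t < `|m A w|) < e.
Proof.
move=> e0; apply: contrapT => /forallNP hno.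
have hX : unb X0 e.
  move=> t; have /existsNP[A /not_implyP[hA /negP]] := hno (`|t| + 1); rewrite -leNgt => h.
  exists [:: A]; split; first by split => //; rewrite /cup big_nil setI0.
    by rewrite /cup big_seq1; exact: AA_sub.
  apply: le_trans h _; apply: le_pr; first exact: meas_gt.
    apply: measurable_fun_ltr; first exact: measurable_cst.
    by apply: meas_sqsum; split => //; rewrite /cup big_nil setI0.
  move=> w h; rewrite /sqsum /vals /= big_seq1 -real_normK ?num_real //.
  by have := ler_norm t; have := normr_ge0 t; nra.
(* The thresholds decrease from e but stay above e / 2, so the losses delta are summable and the
   lower bound e / 2 / 640 for the pieces cut off never deteriorates. *)
pose c n : R := e / 2 * (1 + 2^-1 ^+ n).
have cE n : c n.+1 = c n - e / 2 * 2^-1 ^+ n.+1 by rewrite /c exprS; field.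
have hc n : e / 2 <= c n.
  have : 0 <= 2^-1 ^+ n :> R by apply: exprn_ge0; lra.
  by rewrite /c; move: (_ ^+ n) => q q0; nra.
have : forall nB : nat * set X, exists A, AA nB.2 -> unb nB.2 (c nB.1) ->
   [/\ AA A, A `<=` nB.2, e / 2 / 640 <= pr (fun w => 2^-1 <= `|m A w|) &
    unb (nB.2 `\` A) (c nB.1.+1)].
  move=> [n B] /=; have [[hB hu]|h] := pselect (AA B /\ unb B (c n)); last first.
    by exists set0 => hB hu; exfalso; apply: h.
  have d0 : 0 < e / 2 * 2^-1 ^+ n.+1 by rewrite mulr_gt0 ?exprn_gt0 //; lra.
  have e2 : 0 < e / 2 by lra.
  by have [A hA] := unb_step hB e2 (hc n) d0 hu; exists A => _ _; rewrite cE.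
move=> /choice[g hg].
pose B := fix B n := if n is n'.+1 then B n' `\` g (n', B n') else X0.
have hB n : AA (B n) /\ unb (B n) (c n).
  elim: n => [|n [h1 h2]]; first by split => //; rewrite /c expr0 (_ : e / 2 * _ = e) //; field.
  by have [a1 a2 a3 a4] := hg (n, B n) h1 h2; split => //; exact: AA_D.
have hA n := hg (n, B n) (hB n).1 (hB n).2.
have e2 : 0 < e / 2 / 640 by lra.
have Bsub n k : B (n + k)%N `<=` B n.
  elim: k => [|k IH]; first by rewrite addn0.
  by rewrite addnS => x [/IH].
have [||n] := m_exhaustive (A := fun n => g (n, B n)) _ _ e2.
- by move=> n; have [] := hA n.
- move=> i j ij; apply/seteqP; split => // x [hi hj].
  have [_ /(_ x hj) hBj _ _] := hA j.
  by have := Bsub i.+1 (j - i.+1)%N; rewrite subnKC // => /(_ _ hBj)[].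
- by have [_ _ h _] := hA n; rewrite ltNge h.
Qed.

Lemma meas_lincomb (I : Type) (r : seq I) (at_ : I -> set X) (l : I -> R) :
  disj (map at_ r) -> measurable_fun setT (fun w => \sum_(i <- r) l i * m (at_ i) w).
Proof.
elim: r => [|i r IH] /= => [_|[hA _ hr]].
  by under eq_fun do rewrite big_nil; exact: measurable_cst.
under eq_fun do rewrite big_cons.
apply: measurable_funD; last exact: IH.
by apply: measurable_funM; [exact: measurable_cst|exact: m_meas].
Qed.

(* Randomized rounding: a coefficient l in [-1, 1] is the mean of a random sign. *)
Theorem bounded_convex_range (e : R) : 0 < e ->
  exists2 t : R, 0 <= t & forall (I : Type) (r : seq I) (at_ : I -> set X) (l : I -> R),
    disj (map at_ r) -> (forall i, `|l i| <= 1) ->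
    pr (fun w => t < `|\sum_(i <- r) l i * m (at_ i) w|) < e.
Proof.
move=> e0; have e40 : 0 < e / 40 by lra.
have [t0 ht0] := bounded_range e40.
pose t1 : R := `|t0|; have t10 : 0 <= t1 by exact: normr_ge0.
have hsg b pi : disj pi -> size b = size pi ->
    pr (fun w => 2 * t1 < `|signsum b (vals pi w)|) < e / 20.
  move=> hpi sb; apply: le_lt_trans (pr_signsum t1 hpi sb) _.
  have hle A : AA A -> pr (fun w => t1 < `|m A w|) < e / 40.
    move=> hA; apply: le_lt_trans (ht0 _ hA); apply: le_pr; [exact: meas_gt|exact: meas_gt|].
    by move=> w; apply: le_lt_trans; exact: ler_norm.
  have hmask b' : AA (cup (mask b' pi)) by apply: disj_cup; exact: disj_mask.
  by have := hle _ (hmask b); have := hle _ (hmask (map negb b)); lra.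
(* Chosen so that a rounding variance of at most 8 t1^2 is at most s^2 / 2; Chebyshev then puts the
   rounded sum within s of the true one with probability at least 1/2. *)
pose s : R := 4 * t1 + 1.
exists (2 * t1 + s); first by rewrite /s; lra.
move=> I r at_ l hd hl; set pi := map at_ r in hd *.
pose ls w := [seq (l i, m (at_ i) w) | i <- r].
have lsE w : unzip2 (ls w) = vals pi w by rewrite /ls /vals /pi /unzip2 -!map_comp.
have sumE w : \sum_(u <- ls w) u.1 * u.2 = \sum_(i <- r) l i * m (at_ i) w.
  by rewrite big_map.
have all1 w : all (fun u => `|u.1| <= 1) (ls w).
  by rewrite all_map; elim: (r) => //= i r' ->; rewrite hl.
pose ps := [seq (1 + l i) / 2 | i <- r].
have hps : probs ps.
  rewrite /probs all_map; elim: (r) => //= i r' ->; rewrite andbT.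
  by have := hl i; rewrite ler_norml => /andP[]; lra.
have psE w : [seq (1 + u.1) / 2 | u <- ls w] = ps by rewrite -map_comp.
pose L w := \sum_(i <- r) l i * m (at_ i) w.
have mL : measurable_fun setT L by exact: meas_lincomb.
pose Qb w := sqsum (vals pi w) <= 8 * t1 ^+ 2.
have mQb : measurable_fun setT Qb.
  by apply: measurable_fun_ler; [exact: meas_sqsum|exact: measurable_cst].
have mC : measurable_fun setT (fun w => 2 * t1 + s < `|L w|).
  by apply: measurable_fun_ltr; [exact: measurable_cst|exact: measurableT_comp].
have mS b : measurable_fun setT (fun w => 2 * t1 < `|signsum b (vals pi w)|).
  apply: measurable_fun_ltr; [exact: measurable_cst|apply: measurableT_comp => //].
  exact: meas_signsum.
have mCQ : measurable_fun setT (fun w => (2 * t1 + s < `|L w|) && Qb w).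
  exact: measurable_and.
have h1 : pr (fun w => 2 * t1 + s < `|L w|) <=
    pr (fun w => (2 * t1 + s < `|L w|) && Qb w) + pr (fun w => 8 * t1 ^+ 2 < sqsum (vals pi w)).
  apply: pr_or => //.
    by apply: measurable_fun_ltr; [exact: measurable_cst|exact: meas_sqsum].
  by move=> w -> /=; rewrite /Qb; case: lerP.
(* The budget: a large sum of squares has probability below 10 * e / 20, and a large L with a small
   sum of squares has probability below 2 * e / 20. *)
have [b sb hb] := pr_sqsum_signs t10 (size_vals pi) (fun b => meas_signsum b hd) (meas_sqsum hd).
have h2 := hsg _ _ hd sb.
have [c sc hc] := ber_exists (fun b => pr (fun w => 2 * t1 < `|signsum b (vals pi w)|)) hps.
have {sc}sc : size c = size pi by rewrite sc /ps /pi !size_map.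
have h3 := hsg _ _ hd sc.
suff : 2^-1 * pr (fun w => (2 * t1 + s < `|L w|) && Qb w) <=
    ber ps (fun b => pr (fun w => 2 * t1 < `|signsum b (vals pi w)|)) by lra.
apply: pr_ber => // w /andP[hw hQ].
have [_] := ber_round (all1 w); rewrite psE sumE lsE -/(L w) => hvar.
have s0 : 0 < s by rewrite /s; lra.
apply: le_trans (_ : ber ps (fun b => 1 + - (s ^+ 2)^-1 * (signsum b (vals pi w) - L w) ^+ 2) <= _).
  rewrite berD ber_cst berZ mulNr.
  suff : (s ^+ 2)^-1 * ber ps (fun b => (signsum b (vals pi w) - L w) ^+ 2) <= 2^-1 by lra.
  rewrite mulrC ler_pdivrMr ?exprn_gt0 //; apply: le_trans hvar _; apply: le_trans hQ _.
  by rewrite /s; nra.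
apply: ler_ber => // b' _.
have sq0 : 0 <= (s ^+ 2)^-1 * (signsum b' (vals pi w) - L w) ^+ 2.
  by rewrite mulr_ge0 ?sqr_ge0 // invr_ge0 sqr_ge0.
rewrite mulNr /indb; case: ltrP => h; first lra.
have h5 : s <= `|signsum b' (vals pi w) - L w|.
  have := ler_normD (signsum b' (vals pi w)) (L w - signsum b' (vals pi w)).
  by rewrite addrC subrK distrC; lra.
suff : 1 <= (s ^+ 2)^-1 * (signsum b' (vals pi w) - L w) ^+ 2 by lra.
rewrite mulrC ler_pdivlMr ?exprn_gt0 // mul1r -[leRHS]real_normK ?num_real //.
by rewrite lerXn2r ?nnegrE // ltW.
Qed.

(** For every choice of signs the signed sum of the functions h is bounded by 1, so its integral is
    controlled by [bounded_convex_range], uniformly in the signs; [pr_sqsum_signs] then passes to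
    the sum of squares at the price of a factor 10. *)
Theorem bounded_square_function (e : R) : 0 < e ->
  exists s : R, forall (I : Type) (r : seq I) (at_ : I -> set X) (hs : seq (I -> R)),
    disj (map at_ r) -> (forall i, \sum_(h <- hs) `|h i| <= 1) ->
    pr (fun w => s < sqsum [seq \sum_(i <- r) h i * m (at_ i) w | h <- hs]) < e.
Proof.
move=> e0; have e10 : 0 < e / 10 by lra.
have [t t0 ht] := bounded_convex_range e10.
exists (8 * t ^+ 2) => I r at_ hs hd hsum.
pose T (h : I -> R) w := \sum_(i <- r) h i * m (at_ i) w.
have signE b w : signsum b [seq T h w | h <- hs] =
    T (fun i => signsum b [seq h i | h <- hs]) w.
  elim: (hs) b => [|h hs' IH] [|c b] /=;
    try (by rewrite ?signsum0s ?signsums0 /T; under eq_bigr do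
      rewrite ?signsum0s ?signsums0 mul0r; rewrite big1).
  rewrite signsum_cons IH /T.
  under [RHS]eq_bigr do rewrite signsum_cons mulrDl.
  rewrite big_split; congr (_ + _).
  case: c => //=; rewrite -sumrN; by apply: eq_bigr => i _; rewrite mulNr.
have signle b i : `|signsum b [seq h i | h <- hs]| <= 1.
  apply: le_trans (hsum i); elim: (hs) b => [|h hs' IH] [|c b] /=;
    try (by rewrite ?signsum0s ?signsums0 normr0; apply: sumr_ge0).
  rewrite signsum_cons big_cons; apply: le_trans (ler_normD _ _) _.
  by apply: lerD; [case: c; rewrite /= ?normrN|exact: IH].
have mT (h : I -> R) : measurable_fun setT (T h) by exact: meas_lincomb.
have [||b _ hb] := pr_sqsum_signs (ys := fun w => [seq T h w | h <- hs]) t0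
    (fun w => size_map _ _).
- by move=> b; under eq_fun do rewrite signE; exact: mT.
- elim: (hs) => [|h hs' IH].
    by rewrite /sqsum; under eq_fun do rewrite big_nil; exact: measurable_cst.
  under eq_fun do rewrite /= sqsum_cons.
  by apply: measurable_funD => //; exact: measurable_funX.
suff : pr (fun w => 2 * t < `|signsum b [seq T h w | h <- hs]|) < e / 10 by lra.
under eq_fun do rewrite signE.
apply: le_lt_trans (ht _ _ _ _ hd (signle b)); rewrite -/(T _); apply: le_pr.
- by apply: measurable_fun_ltr; [exact: measurable_cst|exact: measurableT_comp].
- apply: measurable_fun_ltr; first exact: measurable_cst.
  by apply: measurableT_comp => //; exact: mT.
- by move=> w; apply: le_lt_trans; lra.
Qed.

End BoundedRange.

(** * Dyadic step functions and their integrals *)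

Section DyadicCells.
Variables (R : realType) (d : nat).
Local Notation V := 'rV[R]_d.
Local Notation cube := (@cube R d).

(* The position of x relative to all dyadic points of level <= k, in each coordinate;
   singletons are separated from open intervals because the Haar functions take
   intermediate values at their jumps. *)
Definition codeT k : finType := {ffun 'I_d * 'I_k.+1 * 'I_(2 ^ k).+1 -> bool * bool}.

Definition code k (x : V) : codeT k :=
  [ffun p : 'I_d * 'I_k.+1 * 'I_(2 ^ k).+1 =>
    let q := (p.2 : nat)%:R / (2 ^ p.1.2)%:R in (q < x ord0 p.1.1, x ord0 p.1.1 < q)].

Definition cell k (S : {set codeT k}) : set V := [set x | cube x /\ code k x \in S].

(** This algebra is countable, which is what allows one null set for all additivity relations. *)
Definition dyadic : set (set V) := [set A | exists k (S : {set codeT k}), A = cell S].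

Definition step k (h : V -> R) := forall x y, cube x -> cube y ->
  code k x = code k y -> h x = h y.

Lemma code_refine k k' x y : (k <= k')%N -> code k' x = code k' y -> code k x = code k y.
Proof.
move=> kk e; apply/ffunP => -[[s j] i]; rewrite !ffunE /=.
have h1 : (j < k'.+1)%N by apply: leq_trans (ltn_ord j) _.
have h2 : (i < (2 ^ k').+1)%N by apply: leq_trans (ltn_ord i) _; rewrite ltnS leq_exp2l.
by have := congr1 (fun f : codeT k' => f (s, Ordinal h1, Ordinal h2)) e; rewrite !ffunE.
Qed.

Lemma step_le k k' h : (k <= k')%N -> step k h -> step k' h.
Proof. by move=> kk hs x y cx cy e; apply: hs => //; exact: code_refine e. Qed.

Lemma cell_refine k k' (S : {set codeT k}) : (k <= k')%N ->
  exists S' : {set codeT k'}, cell S = cell S'.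
Proof.
move=> kk; exists [set t : codeT k' | `[< exists x, [/\ cube x, code k' x = t & code k x \in S] >]]%SET.
apply/seteqP; split => x [cx hx]; split => //.
  by rewrite inE; apply/asboolP; exists x.
move: hx; rewrite inE => /asboolP[y [cy e hy]].
by rewrite -(code_refine kk e).
Qed.

Lemma dyadic_common A B : dyadic A -> dyadic B ->
  exists k (S T : {set codeT k}), A = cell S /\ B = cell T.
Proof.
move=> [k [S ->]] [k' [T ->]].
have [S' ->] := cell_refine S (leq_maxl k k').
have [T' ->] := cell_refine T (leq_maxr k k').
by exists (maxn k k'), S', T'.
Qed.

Lemma cellD k (S T : {set codeT k}) : cell (S :\: T) = cell S `\` cell T.
Proof.
apply/seteqP; split => x.
  by case=> cx; rewrite inE => /andP[h1 h2]; split => // -[_]; exact/negP.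
by case=> -[cx h] h'; split => //; rewrite inE h andbT; apply/negP => h2; exact: h'.
Qed.

Lemma cellU k (S T : {set codeT k}) : cell (S :|: T) = cell S `|` cell T.
Proof.
apply/seteqP; split => x.
  by case=> cx; rewrite inE => /orP[]; [left|right].
by case=> -[cx h]; split => //; rewrite inE h ?orbT.
Qed.

Lemma cellT k : cell [set: codeT k]%SET = cube.
Proof. by apply/seteqP; split => x; [case|split; rewrite ?inE]. Qed.

Lemma dyadic_cube : dyadic cube.
Proof. by exists 0%N, [set: _]%SET; rewrite cellT. Qed.

Lemma dyadic_sub A : dyadic A -> A `<=` cube.
Proof. by move=> [k [S ->]] x []. Qed.

Lemma dyadicD A B : dyadic A -> dyadic B -> dyadic (A `\` B).
Proof.
by move=> hA hB; have [k [S [T [-> ->]]]] := dyadic_common hA hB; exists k, (S :\: T); rewrite cellD.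
Qed.

Lemma borel_coord (s : 'I_d) (q : R) :
  <<s [set U : set V | open U] >> [set x | q < x ord0 s] /\
  <<s [set U : set V | open U] >> [set x | x ord0 s < q].
Proof.
have c : continuous (fun x : V => x ord0 s) by move=> x; exact: coord_continuous.
split; apply: sub_sigma_algebra => /=.
  have := @open_comp _ _ (fun x : V => x ord0 s) [set y | q < y]; apply => //.
have := @open_comp _ _ (fun x : V => x ord0 s) [set y | y < q]; apply => //.
Qed.

Local Notation BT := (g_sigma_algebraType [set U : set V | open U]).

Lemma measurable_cube : measurable (cube : set BT).
Proof.
rewrite (_ : cube = \bigcap_(s in [set: 'I_d]) (~` [set x | x ord0 s < 0] `&`
   ~` [set x | 1 < x ord0 s])).
  apply: fin_bigcap_measurable => // s _.
  have [h1 _] := borel_coord s 1; have [_ h2] := borel_coord s 0.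
  by apply: measurableI; apply: measurableC.
apply/seteqP; split => x.
  by move=> h s _; have /andP[h0 h1] := h s; split; apply/negP; rewrite -leNgt.
move=> h s; have [] := h s I => /negP h0 /negP h1.
by rewrite !leNgt h0.
Qed.

Lemma borel_cell k (S : {set codeT k}) : borel_cube (cell S).
Proof.
split; last by move=> x [].
have : measurable (cell S : set BT); last by [].
rewrite (_ : cell S = cube `&` \bigcup_(t in [set t | t \in S])
   \bigcap_(p in [set: 'I_d * 'I_k.+1 * 'I_(2 ^ k).+1]) [set x | code k x p = t p]).
  apply: measurableI; first exact: measurable_cube.
  apply: fin_bigcup_measurable => // t _.
  apply: fin_bigcap_measurable => // -[[s j] i] _.
  set q : R := (i : nat)%:R / (2 ^ j)%:R.
  have [h1 h2] := borel_coord s q.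
  have mb (b : bool) (A : set BT) : measurable A -> measurable (if b then A else ~` A).
    by case: b => // mA; exact: measurableC.
  have := measurableI _ _ (mb (t (s, j, i)).1 _ h1) (mb (t (s, j, i)).2 _ h2).
  congr (_.-measurable _); apply/seteqP; split => x /=; rewrite ffunE /= -/q.
    case: (t _) => b1 b2 /= [].
    by case: b1 => [->|/negP/negbTE ->]; case: b2 => [->|/negP/negbTE ->].
  by move=> <- /=; split; case: ifPn => h; [exact: h|exact/negP|exact: h|exact/negP].
apply/seteqP; split => x.
  by case=> cx h; split => //; exists (code k x).
by case=> cx [t ht h]; split => //; rewrite (_ : code k x = t) //; apply/ffunP => p; exact: h.
Qed.

Lemma dyadic_borel A : dyadic A -> borel_cube A.
Proof. by move=> [k [S ->]]; exact: borel_cell. Qed.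

Lemma borel_bigcup (A : nat -> set V) (D : set nat) : (forall n, borel_cube (A n)) ->
  borel_cube (\bigcup_(n in D) A n).
Proof.
move=> hA; split; last by move=> x [n _ hx]; have [_] := hA n; apply.
have : measurable ((\bigcup_(n in D) A n) : set BT); last by [].
by apply: bigcup_measurable => n _; have [] := hA n.
Qed.

(* 0 when no point of the cube has code t *)
Definition rep k (t : codeT k) : V := xget 0 [set x | cube x /\ code k x = t].

Lemma repP k x : cube x -> cube (rep (code k x)) /\ code k (rep (code k x)) = code k x.
Proof. by move=> cx; rewrite /rep; case: xgetP => [y _ [] //|/(_ x)[]]. Qed.

Lemma step_rep k h x : step k h -> cube x -> h x = h (rep (code k x)).
Proof. by move=> hs cx; have [c1 c2] := repP k cx; apply: hs. Qed.

End DyadicCells.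

(** * A version of the measure that is additive at every point, on dyadic sets *)

Section DyadicMeasure.
Variables (R : realType) (dO : measure_display) (Omega : measurableType dO).
Variables (P : probability Omega R) (d : nat).
Local Notation V := 'rV[R]_d.
Local Notation dyadic := (@dyadic R d).

Lemma pr_ae_le (c e : Omega -> bool) : measurable_fun setT c -> measurable_fun setT e ->
  {ae P, forall w, c w -> e w} -> pr P c <= pr P e.
Proof.
move=> mc me [N [mN N0 hN]]; rewrite -lee_fin -!pr_set //.
apply: le_trans (_ : P ([set w | e w] `|` N) <= _)%E.
  apply: le_measure; rewrite ?inE; [exact: measurable_pred|by apply: measurableU => //; exact: measurable_pred|].
  move=> w cw; have [ew|new] := boolP (e w); first by left.
  by right; apply: hN => /= /(_ cw); exact/negP.
apply: le_trans (measureU2 _ _ _) _ => //; first exact: measurable_pred.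
by rewrite [X in (_ + X)%E](N0 : P N = 0%E) adde0.
Qed.

Lemma ae_forall_count (T : countType) (Q : T -> Omega -> Prop) :
  (forall t, {ae P, forall w, Q t w}) -> {ae P, forall w, forall t, Q t w}.
Proof.
move=> h; have : {ae P, forall w, forall n, if unpickle n is Some t then Q t w else True}.
  apply: ae_foralln => n; case: (unpickle n) => [t|]; first exact: h.
  by apply: aeW.
apply: filterS => w hw t; by have := hw (pickle t); rewrite pickleK.
Qed.

Variable mu : set V -> Omega -> R.
Hypothesis hmu : stochastic_measure P mu.

(** The tail unions C n decrease to the empty set, hence have measures tending to 0 in probability,
    and mu (A n) is almost surely mu (C n) - mu (C n.+1). The tails are Borel but need not be
    dyadic, so this is done for [mu] itself. *)
Lemma sm_exhaustive (A : nat -> set V) : (forall n, dyadic (A n)) ->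
  (forall i j, (i < j)%N -> A i `&` A j = set0) ->
  forall k : R, 0 < k -> exists n, pr P (fun w => 2^-1 <= `|mu (A n) w|) < k.
Proof.
move=> hA disjA k k0; have [mmu [addmu contmu]] := hmu.
pose C n := \bigcup_(i in [set i | (n <= i)%N]) A i.
have bA n : borel_cube (A n) by exact: dyadic_borel.
have bC n : borel_cube (C n) by exact: borel_bigcup.
have mg B : borel_cube B -> measurable_fun setT (fun w => 4^-1 <= `|mu B w|).
  move=> bB; apply: measurable_fun_ler; first exact: measurable_cst.
  by apply: measurableT_comp => //; exact: mmu.
have C0 : \bigcap_n C n = set0.
  apply/seteqP; split => // x h.
  have [i _ hi] := h 0%N I; have [j /= ij hj] := h i.+1 I.
  by have := disjA _ _ ij => /seteqP[/(_ x) + _]; apply.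
have Cdec n : C n.+1 `<=` C n by move=> x [i /= h hi]; exists i => //=; exact: ltnW.
have e4 : 0 < 4^-1 :> R by rewrite invr_gt0.
have := contmu C bC Cdec C0 _ e4 => /fine_cvgP[_ /cvgrPdist_lt /(_ (k / 2))].
have k2 : 0 < k / 2 by rewrite divr_gt0.
move=> /(_ k2)[n _ hn]; exists n.
have hn1 := hn n (leqnn n); have hn2 := hn n.+1 (leqnSn n).
rewrite /= !sub0r !normrN !(pr_set _ (mg _ (bC _))) /= in hn1 hn2.
suff : pr P (fun w => 2^-1 <= `|mu (A n) w|) <=
    pr P (fun w => 4^-1 <= `|mu (C n) w|) + pr P (fun w => 4^-1 <= `|mu (C n.+1) w|).
  have := ler_norm (pr P (fun w => 4^-1 <= `|mu (C n) w|)).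
  have := ler_norm (pr P (fun w => 4^-1 <= `|mu (C n.+1) w|)); lra.
have mA : measurable_fun setT (fun w => 2^-1 <= `|mu (A n) w|).
  apply: measurable_fun_ler; first exact: measurable_cst.
  by apply: measurableT_comp => //; exact: mmu.
apply: le_trans (_ : pr P (fun w => (4^-1 <= `|mu (C n) w|) || (4^-1 <= `|mu (C n.+1) w|)) <= _).
  apply: pr_ae_le => //; first by apply: measurable_or; exact: mg.
  have CE : C n = A n `|` C n.+1.
    apply/seteqP; split => x.
      case=> i /=; rewrite leq_eqVlt => /orP[/eqP <-|h] hi; first by left.
      by right; exists i.
    by case=> [h|/Cdec //]; exists n => /=.
  have AC0 : A n `&` C n.+1 = set0.
    apply/seteqP; split => // x [h1 [i /= ni h2]].
    by have := disjA _ _ ni => /seteqP[/(_ x) + _]; apply.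
  have := addmu _ _ (bA n) (bC n.+1) AC0; apply: filterS => w; rewrite -CE => e h.
  apply/orP; have [|h1] := lerP 4^-1 `|mu (C n) w|; [by left|right].
  have e' : mu (A n) w = mu (C n) w - mu (C n.+1) w by rewrite e addrK.
  by move: h; rewrite e'; have := ler_normB (mu (C n) w) (mu (C n.+1) w); lra.
apply: pr_or => //; [by apply: measurable_or; exact: mg|exact: mg|exact: mg].
Qed.

(** One null set N serves all pairs of dyadic sets, as these are countably many. Replacing the
    measure by 0 on N makes additivity hold at every w, as [BoundedRange] requires. *)
Lemma sm_dyadic_version : exists m : set V -> Omega -> R,
  [/\ forall A, dyadic A -> measurable_fun setT (m A),
      forall A B w, dyadic A -> dyadic B -> A `&` B = set0 -> m (A `|` B) w = m A w + m B w,
      forall A : nat -> set V, (forall n, dyadic (A n)) ->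
        (forall i j, (i < j)%N -> A i `&` A j = set0) ->
        forall k : R, 0 < k -> exists n, pr P (fun w => 2^-1 <= `|m (A n) w|) < k &
      {ae P, forall w, forall A, dyadic A -> m A w = mu A w}].
Proof.
have [mmu [addmu _]] := hmu.
have : {ae P, forall w, forall t : {k : nat & ({set codeT d k} * {set codeT d k})%type},
    let S := (tagged t).1 in let T := (tagged t).2 in
    (cell S : set V) `&` cell T = set0 ->
    mu (cell S `|` cell T) w = mu (cell S) w + mu (cell T) w}.
  apply: ae_forall_count => -[k [S T]] /=.
  have [h|h] := pselect ((cell S : set V) `&` cell T = set0); last by apply: aeW.
  have := addmu _ _ (borel_cell R S) (borel_cell R T) h.
  by apply: filterS => w hw _.
move=> [N [mN N0 hN]].
pose m A w := mu A w * \1_(~` N) w.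
have mE A w : ~ N w -> m A w = mu A w by move=> nN; rewrite /m indicE mem_set ?mulr1.
have m0 A w : N w -> m A w = 0 by move=> nN; rewrite /m indicE memNset ?mulr0 // => /(_ nN).
exists m; split.
- move=> A hA; apply: measurable_funM; first by apply: mmu; exact: dyadic_borel.
  exact: measurable_indic (measurableC mN).
- move=> A B w hA hB AB0; have [nN|nN] := pselect (N w); first by rewrite !m0 // addr0.
  have [k [S [T [eA eB]]]] := dyadic_common hA hB.
  rewrite !mE //; move: AB0; rewrite eA eB => AB0.
  have := contra_not (hN w) nN => /= /contrapT.
  by move=> /(_ (existT _ k (S, T)) AB0).
- move=> A hA disjA k k0; have [n hn] := sm_exhaustive hA disjA k0; exists n.
  apply: le_lt_trans hn; apply: pr_ae_le.
  + apply: measurable_fun_ler; first exact: measurable_cst.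
    apply: measurableT_comp => //; apply: measurable_funM.
      by apply: mmu; exact: dyadic_borel.
    exact: measurable_indic (measurableC mN).
  + apply: measurable_fun_ler; first exact: measurable_cst.
    by apply: measurableT_comp => //; apply: mmu; exact: dyadic_borel.
  + exists N; split => // w /= h; apply: contrapT => nN; apply: h.
    by rewrite mE.
- by exists N; split => // w /= h; apply: contrapT => nN; apply: h => A _; exact: mE.
Qed.

End DyadicMeasure.

Section StepIntegral.
Variables (R : realType) (dO : measure_display) (Omega : measurableType dO).
Variables (P : probability Omega R) (d : nat).
Local Notation V := 'rV[R]_d.
Local Notation cube := (@cube R d).
Local Notation dyadic := (@dyadic R d).
Local Notation atom t := (@cell R d _ [set t]%SET).

Lemma cube_rep k (t : codeT d k) : cube (@rep R d _ t).
Proof.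
rewrite /rep; case: xgetP => [y _ [] //|_] s.
by rewrite mxE lexx ler01.
Qed.

Lemma cup_atoms k (s : seq (codeT d k)) :
  cup [seq atom t | t <- s] = @cell R d _ [set t in s]%SET.
Proof.
elim: s => [|t s IH] /=.
  by rewrite /cup big_nil; apply/seteqP; split => // x []; rewrite !inE.
by rewrite cup_cons IH -cellU; congr cell; apply/setP => u; rewrite !inE.
Qed.

Lemma disj_atoms k (s : seq (codeT d k)) : uniq s -> disj dyadic [seq atom t | t <- s].
Proof.
elim: s => [|t s IH] //= /andP[ts us]; split; [by exists k, [set t]%SET| |exact: IH].
rewrite cup_atoms; apply/seteqP; split => // x [[_ h1] [_ h2]]; move: h1 h2 ts.
by rewrite !inE => /eqP -> ->.
Qed.

Section Version.
Variables (mu m : set V -> Omega -> R).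
Hypothesis m_add : forall A B w, dyadic A -> dyadic B -> A `&` B = set0 ->
  m (A `|` B) w = m A w + m B w.

Lemma m_cell k (S : {set codeT d k}) w :
  m (@cell R d _ S) w = \sum_(t in S) m (atom t) w.
Proof.
have := m_cup (dyadic_cube R d) (@dyadic_sub R d) (@dyadicD R d) m_add w
  (disj_atoms (enum_uniq S)).
rewrite cup_atoms (_ : [set t in enum S]%SET = S); last first.
  by apply/setP => t; rewrite inE mem_enum.
by move=> ->; rewrite /vals -map_comp big_map big_enum.
Qed.

Lemma m_empty w : m set0 w = 0.
Proof. exact: (m0 (dyadic_cube R d) (@dyadicD R d) m_add). Qed.

(** The sum over values of h becomes a sum over codes by splitting each level set into atoms. Codes
    attained at no point of the cube have a meaningless representative, but their atoms are empty
    and have measure 0. *)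
Lemma sm_int_step w k h : (forall A, dyadic A -> m A w = mu A w) -> step k h ->
  sm_int mu h w = \sum_(t : codeT d k) h (@rep R d _ t) * m (atom t) w.
Proof.
move=> hm hs; pose live (t : codeT d k) := code k (@rep R d _ t) == t.
have liveP x : cube x -> live (code k x).
  by move=> cx; rewrite /live; have [_ ->] := repP k cx.
have dead t : ~~ live t -> m (atom t) w = 0.
  move=> dt; rewrite (_ : atom t = set0) ?m_empty //.
  apply/seteqP; split => // x [cx]; rewrite inE => /eqP e.
  by have := liveP x cx; rewrite e (negbTE dt).
pose s := undup [seq h (@rep R d _ t) | t <- enum (codeT d k) & live t].
have sE : h @` cube = [set` s].
  apply/seteqP; split => y.
    case=> x cx <-; rewrite /= mem_undup; apply/mapP; exists (code k x).
      by rewrite mem_filter liveP // mem_enum.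
    exact: step_rep.
  rewrite /= mem_undup => /mapP[t _ ->]; exists (@rep R d _ t) => //; exact: cube_rep.
rewrite /sm_int sE -fsbig_seq ?undup_uniq //.
have cellE c : cube `&` h @^-1` [set c] = @cell R d k [set t | h (@rep R d k t) == c]%SET.
  apply/seteqP; split => x [cx] /=.
    by move=> e; split => //; rewrite inE -(step_rep hs cx) e.
  by rewrite inE -(step_rep hs cx) => /eqP.
under eq_bigr => c _.
  rewrite cellE -hm; last by exists k, [set t | h (@rep R d _ t) == c]%SET.
  rewrite m_cell mulr_sumr.
  under eq_bigl do rewrite inE.
  over.
rewrite (exchange_big_dep predT) //=; apply: eq_bigr => t _.
have [lt|dt] := boolP (live t); last by rewrite dead // mulr0 big1 // => c _; rewrite mulr0.
rewrite big_mkcond (bigD1_seq (h (@rep R d _ t))) ?undup_uniq //=; last first.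
  by rewrite mem_undup; apply/mapP; exists t => //; rewrite mem_filter lt mem_enum.
by rewrite eqxx big1 ?addr0 // => c; rewrite eq_sym => /negbTE ->.
Qed.

End Version.

Variable mu : set V -> Omega -> R.
Hypothesis hmu : stochastic_measure P mu.

(** All functions are quantified inside the almost sure statement; this is what later permits
    uncountably many z. *)
Theorem sm_int_linear : {ae P, forall w, forall k (I : Type) (r : seq I) (c : I -> R)
    (h : I -> V -> R) (g : V -> R), (forall i, step k (h i)) ->
    (forall x, cube x -> g x = \sum_(i <- r) c i * h i x) ->
    sm_int mu g w = \sum_(i <- r) c i * sm_int mu (h i) w}.
Proof.
have [m [_ madd _ mE]] := sm_dyadic_version hmu.
move: mE; apply: filterS => w mE k I r c h g hs hg.
have gs : step k g.
  by move=> x y cx cy e; rewrite !hg //; apply: eq_bigr => i _; rewrite (hs i x y).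
rewrite (sm_int_step madd mE gs).
under [RHS]eq_bigr do rewrite (sm_int_step madd mE (hs _)) mulr_sumr.
rewrite exchange_big; apply: eq_bigr => t _.
rewrite hg; last exact: cube_rep.
by rewrite mulr_suml; apply: eq_bigr => i _; rewrite mulrA.
Qed.

(** Bounds in probability uniform in n become an almost sure bound because the sums Q n increase:
    the events Q n > s j increase to U j, of probability at most 1 / (j + 1), and the intersection
    of the U j is null. Monotonicity is assumed for every functional phi since it is applied to the
    integral against the version m. *)
Theorem sm_int_square_bounded (I : nat -> Type) (r : forall n, seq (I n))
    (h : forall n, I n -> V -> R) :
  (forall n, exists k, forall i : I n, step k (h n i)) ->
  (forall n x, cube x -> \sum_(i <- r n) `|h n i x| <= 1) ->
  (forall n (phi : (V -> R) -> R), \sum_(i <- r n) phi (h n i) ^+ 2 <=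
     \sum_(i <- r n.+1) phi (h n.+1 i) ^+ 2) ->
  {ae P, forall w, exists M : R, forall n, \sum_(i <- r n) sm_int mu (h n i) w ^+ 2 <= M}.
Proof.
move=> /choice[kk hk] hsum hmono.
have [m [mm madd mexh mE]] := sm_dyadic_version hmu.
pose Q n w := \sum_(i <- r n) sm_int m (h n i) w ^+ 2.
have TE n (i : I n) w : sm_int m (h n i) w =
    \sum_(t : codeT d (kk n)) h n i (@rep R d _ t) * m (atom t) w.
  exact: sm_int_step.
have mT n (i : I n) : measurable_fun setT (sm_int m (h n i)).
  rewrite (funext (TE n i)).
  apply: (meas_lincomb mm (r := index_enum (codeT d (kk n))) (fun t => h n i (@rep R d _ t))).
  by apply: disj_atoms; exact: index_enum_uniq.
have mQ n : measurable_fun setT (Q n).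
  rewrite /Q; elim: (r n) => [|i s IH].
    by under eq_fun do rewrite big_nil; exact: measurable_cst.
  under eq_fun do rewrite big_cons.
  by apply: measurable_funD => //; exact: measurable_funX.
have mQs n (s : R) : measurable_fun setT (fun w => s < Q n w).
  by apply: measurable_fun_ltr; first exact: measurable_cst.
have Qmono n n' w : (n <= n')%N -> Q n w <= Q n' w.
  move=> nn; rewrite -(subnKC nn); elim: (n' - n)%N => [|j IH]; first by rewrite addn0.
  by rewrite addnS; apply: le_trans IH _; exact: (hmono _ (fun g => sm_int m g w)).
have hsq (e : R) : 0 < e -> exists s : R, forall n, pr P (fun w => s < Q n w) < e.
  move=> e0; have [s hs] := bounded_square_function (dyadic_cube R d) (@dyadic_sub R d)
    (@dyadicD R d) mm madd mexh e0.
  exists s => n.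
  have := hs _ (index_enum (codeT d (kk n))) (fun t => atom t)
    [seq (fun t => h n i (@rep R d _ t)) | i <- r n].
  move=> /(_ (disj_atoms (index_enum_uniq _))) hh.
  apply: le_lt_trans (hh _); last first.
    by move=> t; rewrite big_map; apply: hsum; exact: cube_rep.
  rewrite le_eqVlt; apply/orP; left; apply/eqP; congr (pr P _); apply/funext => w.
  congr (_ < _); rewrite /Q /sqsum -map_comp big_map.
  by apply: eq_bigr => i _; rewrite TE.
have /choice[s hs] : forall j : nat, exists s : R, forall n, pr P (fun w => s < Q n w) < j.+1%:R^-1.
  by move=> j; apply: hsq; rewrite invr_gt0 ltr0n.
pose U j := \bigcup_n [set w | s j < Q n w].
pose N := \bigcap_j U j.
have mF j n : measurable [set w | s j < Q n w] by exact: measurable_pred.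
have mU j : measurable (U j) by exact: bigcup_measurable.
have mN : measurable N by exact: bigcap_measurable.
have PU j : (P (U j) <= (j.+1%:R^-1)%:E)%E.
  have : P [set w | s j < Q n w] @[n --> \oo] --> P (U j).
    apply: nondecreasing_cvg_mu; [exact: mF|exact: mU|].
    move=> n n' nn; apply/subsetPset => w /=.
    by move=> h'; apply: lt_le_trans h' (Qmono _ _ _ nn).
  move=> hc; rewrite -(cvg_lim _ hc) //; apply: lime_le.
    by apply/cvg_ex; eexists; exact: hc.
  by apply: nearW => n; rewrite pr_set // lee_fin ltW.
have PN : P N = 0%E.
  apply/eqP; rewrite eq_le measure_ge0 andbT; apply/lee_addgt0Pr => e e0; rewrite add0e.
  have [j hj] : exists j : nat, j.+1%:R^-1 <= e.
    exists (Num.truncn e^-1); rewrite -[leRHS]invrK lef_pV2 ?posrE ?invr_gt0 ?ltr0n //.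
    by rewrite ltW // truncnS_gt.
  apply: le_trans (_ : P (U j) <= _)%E.
    by apply: le_measure; rewrite ?inE // => w; apply.
  by apply: le_trans (PU j) _; rewrite lee_fin.
have aN : {ae P, forall w, ~ N w}.
  by exists N; split => // w /= /contrapT.
apply: filterS2 mE aN => w mE nN.
have [j hj] : exists j, ~ U j w.
  by apply: contrapT => /forallNP hn; apply: nN => j _; exact: contrapT.
exists (s j) => n; rewrite leNgt; apply/negP => hlt; apply: hj; exists n => //=.
rewrite /Q; under eq_bigr => i _.
  rewrite TE -(sm_int_step madd mE (hk n i)).
  over.
exact: hlt.
Qed.

End StepIntegral.

(** * Haar functions and coefficients *)

Section HaarFunctions.
Variable R : realType.
Local Notation haar := (@haar R).

(** [lev 1] is 0 since [trunc_log 2 0] is 0, so the constant function shares level 0 with the first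
    genuine Haar function. *)
Definition lev n := trunc_log 2 n.-1.
Definition amp n : R := Num.sqrt (2 ^ lev n)%:R.
Definition hlo n : R := (n - 2 ^ lev n).-1%:R / (2 ^ lev n)%:R.
Definition hmid n : R := (n - 2 ^ lev n).*2.-1%:R / (2 ^ (lev n).+1)%:R.
Definition hhi n : R := (n - 2 ^ lev n)%:R / (2 ^ lev n)%:R.
Definition hwid n : R := (2 ^ (lev n).+1)%:R^-1.

Lemma lev_bounds n : (1 < n)%N -> (2 ^ lev n < n <= 2 ^ (lev n).+1)%N.
Proof.
move=> n1; have n0 : (0 < n.-1)%N by case: n n1 => [|[]].
have /andP[h1 h2] := trunc_log_bounds (isT : (1 < 2)%N) n0.
by rewrite -/(lev n) in h1 h2; case: n n1 h1 h2 {n0} => //= n _; rewrite !ltnS => -> ->.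
Qed.

Lemma pow2_gt0 j : 0 < (2 ^ j)%:R :> R.
Proof. by rewrite ltr0n expn_gt0. Qed.

Lemma amp_gt0 n : 0 < amp n.
Proof. by rewrite sqrtr_gt0 pow2_gt0. Qed.

Lemma amp1 : amp 1 = 1.
Proof. by rewrite /amp /lev /= trunc_log0 expn0 sqrtr1. Qed.

Lemma amp_sqr n : amp n ^+ 2 = (2 ^ lev n)%:R.
Proof. by rewrite sqr_sqrtr // ltW // pow2_gt0. Qed.

Lemma hmid_lo n : (1 < n)%N -> hmid n = hlo n + hwid n.
Proof.
move=> /lev_bounds/andP[h1 _]; rewrite /hmid /hlo /hwid expnS natrM.
have : (0 < n - 2 ^ lev n)%N by rewrite subn_gt0.
case: (n - 2 ^ lev n)%N => //= i _.
rewrite -muln2 -natr1 natrM; field; exact: lt0r_neq0 (pow2_gt0 _).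
Qed.

Lemma hhi_mid n : (1 < n)%N -> hhi n = hmid n + hwid n.
Proof.
move=> /lev_bounds/andP[h1 _]; rewrite /hmid /hhi /hwid expnS natrM.
have : (0 < n - 2 ^ lev n)%N by rewrite subn_gt0.
case: (n - 2 ^ lev n)%N => //= i _.
rewrite -muln2 -!natr1 natrM; field; exact: lt0r_neq0 (pow2_gt0 _).
Qed.

Lemma hwid_gt0 n : 0 < hwid n.
Proof. by rewrite invr_gt0 pow2_gt0. Qed.

Lemma hlo_ge0 n : 0 <= hlo n.
Proof. by rewrite divr_ge0. Qed.

Lemma hhi_le1 n : (1 < n)%N -> hhi n <= 1.
Proof.
move=> /lev_bounds/andP[_]; rewrite expnS mul2n -addnn => h.
by rewrite /hhi ler_pdivrMr ?pow2_gt0 // mul1r ler_nat leq_subLR.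
Qed.

Lemma haar1 x : haar 1 x = 1. Proof. by []. Qed.

Lemma haarE n x : (1 < n)%N -> haar n x =
  if (hlo n < x) && (x < hmid n) then amp n
  else if (hmid n < x) && (x < hhi n) then - amp n
  else if x == hmid n then 0
  else if x == hlo n then (if hlo n == 0 then amp n else amp n / 2)
  else if x == hhi n then (if hhi n == 1 then - amp n else - amp n / 2)
  else 0.
Proof. by case: n => [|[|n]]. Qed.

Lemma normr_haar_le n x : (0 < n)%N -> `|haar n x| <= amp n.
Proof.
have a0 := amp_gt0 n.
have a1 : `|amp n| <= amp n by rewrite gtr0_norm.
have a2 : `|amp n / 2| <= amp n by rewrite gtr0_norm; lra.
case: (ltnP 1 n) => [n1 _|n1 n0]; last first.
  have -> : n = 1%N by case: n n1 n0 {a0 a1 a2} => [|[]].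
  by rewrite haar1 amp1 normr1.
rewrite haarE //; do ![case: ifP => _]; rewrite ?mulNr ?normrN ?normr0 //; exact: ltW.
Qed.

Lemma haar_out n x : (1 < n)%N -> haar n x != 0 -> hlo n <= x <= hhi n.
Proof.
move=> n1; rewrite haarE //.
have h1 := hmid_lo n1; have h2 := hhi_mid n1; have h3 := hwid_gt0 n.
case: ifP => [/andP[? ?] _|_]; first lra.
case: ifP => [/andP[? ?] _|_]; first lra.
case: (x =P hmid n) => [_|_]; first by rewrite eqxx.
case: (x =P hlo n) => [-> _|_]; first lra.
case: (x =P hhi n) => [-> _|_]; first lra.
by rewrite eqxx.
Qed.

Lemma lev_lt n k : (1 < n)%N -> (n <= 2 ^ k)%N -> (lev n < k)%N.
Proof.
move=> n1 nk; have /andP[h _] := lev_bounds n1.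
by rewrite -(ltn_exp2l _ _ (isT : 1 < 2)%N); exact: leq_trans h nk.
Qed.

Lemma lev_eq j i : (i < 2 ^ j)%N -> lev (2 ^ j + i.+1) = j.
Proof.
move=> ij; rewrite /lev addnS /=; apply: trunc_log_eq => //.
by rewrite leq_addr /= expnS mul2n -addnn ltn_add2l.
Qed.

Lemma sum_levels (F : nat -> R) k :
  \sum_(i < 2 ^ k) F i.+1 = F 1%N + \sum_(j < k) \sum_(i < 2 ^ j) F (2 ^ j + i.+1)%N.
Proof.
elim: k => [|k IH]; first by rewrite big_ord0 addr0 expn0 big_ord1.
rewrite big_ord_recr /= addrA -IH.
rewrite -(big_mkord xpredT (fun i => F i.+1)) (@big_cat_nat _ _ _ (2 ^ k)) //=; last first.
  by rewrite leq_exp2l.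
rewrite big_mkord; congr (_ + _).
rewrite -{1}[(2 ^ k)%N]add0n big_addn expnS mul2n -addnn addnK big_mkord.
by apply: eq_bigr => i _; rewrite addnC -addnS.
Qed.

(** Closed intervals share endpoints, whence 2 and not 1; the two bounds for y beyond N carry the
    induction. *)
Lemma count_unit_intervals N (y : R) :
  [/\ N%:R < y -> \sum_(i < N) indb R (i%:R <= y <= i.+1%:R) = 0,
      N%:R <= y -> \sum_(i < N) indb R (i%:R <= y <= i.+1%:R) <= 1 &
      \sum_(i < N) indb R (i%:R <= y <= i.+1%:R) <= 2].
Proof.
elim: N => [|N [h1 h2 h3]]; first by rewrite big_ord0; split.
have N1 : N%:R < N.+1%:R :> R by rewrite ltr_nat.
rewrite big_ord_recr /= {2 4 6}/indb; split => [h|h|].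
- by rewrite h1 ?(lt_trans N1) // add0r (lt_geF h) andbF.
- by rewrite h1 ?(lt_le_trans N1) // add0r; case: ifP.
- case: ifP => [/andP[h _]|_]; last by rewrite addr0.
  by have := h2 h; lra.
Qed.

(** Haar functions normalized to be bounded by 1, the scale on which the square function bound is
    stated. *)
Definition psi n x := haar n x / amp n.

Lemma normr_psi_le1 n x : (0 < n)%N -> `|psi n x| <= 1.
Proof.
move=> n0; rewrite /psi normrM normfV (gtr0_norm (amp_gt0 n)).
by rewrite ler_pdivrMr ?amp_gt0 // mul1r normr_haar_le.
Qed.

Lemma sum_psi_level j x : \sum_(i < 2 ^ j) `|psi (2 ^ j + i.+1) x| <= 2.
Proof.
have [_ _ h] := count_unit_intervals (2 ^ j) (x * (2 ^ j)%:R).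
apply: le_trans h; apply: ler_sum => i _; rewrite /indb.
have n1 : (1 < 2 ^ j + i.+1)%N by rewrite addnS ltnS addn_gt0 expn_gt0.
case: ifP => h; first by rewrite normr_psi_le1 // ltnW.
suff -> : psi (2 ^ j + i.+1) x = 0 by rewrite normr0.
rewrite /psi; apply/eqP; rewrite mulf_eq0; apply/orP; left; apply/negPn/negP => hx.
move/negP: h; apply; have := haar_out n1 hx.
rewrite /hlo /hhi lev_eq // addKn /=.
by rewrite ler_pdivrMr ?pow2_gt0 // ler_pdivlMr ?pow2_gt0.
Qed.

Lemma geo_le (q : R) k : 0 <= q < 1 -> \sum_(j < k) q ^+ j <= (1 - q)^-1.
Proof.
move=> /andP[q0 q1]; have q1' : 0 < 1 - q by lra.
rewrite -div1r ler_pdivlMr // mulrC -opprB mulNr -subrX1 opprB.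
by rewrite gerBl exprn_ge0.
Qed.

Lemma sum_psi_weighted (q : R) k x : 0 <= q < 1 ->
  \sum_(i < 2 ^ k) q ^+ lev i.+1 * `|psi i.+1 x| <= 1 + 2 / (1 - q).
Proof.
move=> hq; rewrite (sum_levels (fun n => q ^+ lev n * `|psi n x|)).
apply: lerD.
  by rewrite /lev trunc_log0 expr0 mul1r normr_psi_le1.
apply: le_trans (_ : \sum_(j < k) 2 * q ^+ j <= _); last first.
  by rewrite -mulr_sumr ler_pM2l // geo_le.
apply: ler_sum => j _; have /andP[q0 _] := hq.
under eq_bigr do rewrite lev_eq //.
by rewrite -mulr_sumr mulrC ler_wpM2r ?exprn_ge0 // sum_psi_level.
Qed.

(** Level j holds 2^j functions, hence the condition 2 q < 1. In [sum_psi_weighted] q < 1 is enough,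
    because at a fixed point at most two functions of a level contribute. *)
Lemma sum_lev_weighted (q : R) k : 0 <= q -> 2 * q < 1 ->
  \sum_(i < 2 ^ k) q ^+ lev i.+1 <= 1 + (1 - 2 * q)^-1.
Proof.
move=> q0 q1; rewrite (sum_levels (fun n => q ^+ lev n)).
apply: lerD; first by rewrite /lev trunc_log0 expr0.
apply: le_trans (_ : \sum_(j < k) (2 * q) ^+ j <= _); last first.
  by apply: geo_le; rewrite mulr_ge0.
apply: ler_sum => j _; under eq_bigr do rewrite lev_eq //.
by rewrite sumr_const card_ord exprMn -natrX mulr_natl.
Qed.

Lemma haar_step1 n k (x y : R) : (0 < n <= 2 ^ k)%N ->
  (forall j i, (j <= k)%N -> (i <= 2 ^ k)%N ->
     let q := i%:R / (2 ^ j)%:R in (q < x) = (q < y) /\ (x < q) = (y < q)) ->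
  haar n x = haar n y.
Proof.
move=> /andP[n0 nk] h; case: (ltnP 1 n) => [n1|n1]; last first.
  by have -> : n = 1%N by case: n n1 n0 {nk} => [|[]].
have lk := lev_lt n1 nk.
have /andP[b1 b2] := lev_bounds n1.
have heq q : (q < x) = (q < y) -> (x < q) = (y < q) -> (x == q) = (y == q).
  by move=> e1 e2; rewrite !eq_le !leNgt e1 e2.
have le1 : (n - 2 ^ lev n <= 2 ^ k)%N by apply: leq_trans nk; exact: leq_subr.
have [l1 l2] := h (lev n) (n - 2 ^ lev n).-1 (ltnW lk) (leq_trans (leq_pred _) le1).
have [r1 r2] := h (lev n) (n - 2 ^ lev n)%N (ltnW lk) le1.
have [|m1 m2] := h (lev n).+1 (n - 2 ^ lev n).*2.-1 lk.
  apply: leq_trans (leq_pred _) _; apply: (@leq_trans (2 ^ (lev n).+1)).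
    by move: b2; rewrite expnS; lia.
  by rewrite leq_exp2l.
rewrite -/(hlo n) in l1 l2; rewrite -/(hhi n) in r1 r2; rewrite -/(hmid n) in m1 m2.
by rewrite !haarE // l1 m1 m2 r2 (heq _ l1 l2) (heq _ r1 r2) (heq _ m1 m2).
Qed.

End HaarFunctions.

(** * One-dimensional Haar integrals *)

Section HaarIntegral.
Variable R : realType.
Local Notation haar := (@haar R).
Local Notation leb := (@lebesgue_measure R).
Local Notation amp := (amp R).
Local Notation hlo := (hlo R).
Local Notation hmid := (hmid R).
Local Notation hhi := (hhi R).
Local Notation hwid := (hwid R).

Definition hint n (G : R -> R) : R := \int[leb]_(t in `[0, 1]) (G t * haar n t).

Lemma continuous_meas (G : R -> R) (D : set R) : measurable D -> continuous G ->
  measurable_fun D G.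
Proof.
by move=> mD cG; apply: (measurable_funS measurableT) => //; exact: continuous_measurable_fun.
Qed.

Lemma continuous_integrable (G : R -> R) a b : continuous G ->
  leb.-integrable `[a, b] (EFin \o G).
Proof.
move=> cG; apply: continuous_compact_integrable; first exact: segment_compact.
exact: continuous_subspaceT.
Qed.

Lemma haar_measurable n : (1 < n)%N -> measurable_fun setT (haar n).
Proof.
move=> n1; rewrite (funext (fun x => haarE x n1)).
have mlt (q : R) : measurable_fun setT (fun x : R => x < q) by apply: measurable_fun_ltr.
have mgt (q : R) : measurable_fun setT (fun x : R => q < x) by apply: measurable_fun_ltr.
have meq (q : R) : measurable_fun setT (fun x : R => x == q) by apply: measurable_fun_eqr.
by do ![apply: measurable_fun_ifT => //; try exact: measurable_and].
Qed.

Lemma integral_FTC (G F : R -> R) a b : 0 <= a -> a <= b -> b <= 1 -> continuous G ->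
  (forall t : R, 0 <= t <= 1 -> is_derive t 1 F (G t)) ->
  \int[leb]_(t in `[a, b]) G t = F b - F a.
Proof.
move=> a0; rewrite le_eqVlt => /orP[/eqP -> b1 _ _|ab b1 cG hF].
  by rewrite set_itv1 Rintegral_set1 subrr.
have hc (t : R) : 0 <= t <= 1 -> {for t, continuous F}.
  by move=> /hF[dF _]; exact/differentiable_continuous/derivable1_diffP.
rewrite /Rintegral (@continuous_FTC2 _ G F) //.
- exact: continuous_subspaceT.
- split.
  + by move=> t; rewrite in_itv /= => /andP[at_ tb]; have [] : is_derive t 1 F (G t) by apply: hF; lra.
  + by apply: cvg_at_right_filter; apply: hc; lra.
  + by apply: cvg_at_left_filter; apply: hc; lra.
- move=> t; rewrite in_itv /= => /andP[at_ tb]; rewrite derive1E.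
  by have [_ ->] : is_derive t 1 F (G t) by apply: hF; lra.
Qed.

(** Integrating from -1 inside [-1, 2] makes every point of [0, 1] interior, so the primitive has
    two-sided derivatives at 0 and 1. *)
Lemma primitive_exists (G : R -> R) : continuous G ->
  exists F, forall t : R, 0 <= t <= 1 -> is_derive t 1 F (G t).
Proof.
move=> cG; exists (fun x => \int[leb]_(t in `[-1, x]) G t) => t /andP[t0 t1].
have t2 : t < 2 by lra.
have tm : -1 < t by lra.
have [h1 h2] := continuous_FTC1_closed t2 (continuous_integrable (-1) 2 cG) tm (cG t).
by rewrite -h2 derive1E; split.
Qed.

Lemma restrict_integrable (G : R -> R) a b : continuous G ->
  leb.-integrable `[0, 1] (EFin \o (G \_ `[a, b])).
Proof.
move=> cG; have h := continuous_integrable a b cG.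
apply: (integrableS measurableT) => //.
have := (@integrable_mkcond _ _ R leb `[a, b] (EFin \o G) (measurable_itv _)).1 h; congr (integrable _ _ _).
by apply/funext => x /=; rewrite /patch; case: ifP.
Qed.

Lemma restrict_integral (G : R -> R) a b : 0 <= a -> b <= 1 ->
  \int[leb]_(t in `[0, 1]) (G \_ `[a, b]) t = \int[leb]_(t in `[a, b]) G t.
Proof.
move=> a0 b1; rewrite -Rintegral_mkcondr setIidr // => x /=.
by rewrite !in_itv /= => /andP[h1 h2]; lra.
Qed.

(** The Haar function is [amp] times the difference of the indicators of the two closed halves,
    except possibly at the three jump points, which form a null set. *)
Lemma hint_FTC n (G F : R -> R) : (1 < n)%N -> continuous G ->
  (forall t : R, 0 <= t <= 1 -> is_derive t 1 F (G t)) ->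
  hint n G = amp n * ((F (hmid n) - F (hlo n)) - (F (hhi n) - F (hmid n))).
Proof.
move=> n1 cG hF.
have e1 := hmid_lo R n1; have e2 := hhi_mid R n1; have w0 := hwid_gt0 R n.
have l0 := hlo_ge0 R n; have h1 := hhi_le1 R n1.
rewrite -(integral_FTC (G := G) (a := hlo n)) //; try lra.
rewrite -(integral_FTC (G := G) (a := hmid n)) //; try lra.
have r1 : 0 <= hmid n by lra.
have r2 : hmid n <= 1 by lra.
rewrite -(restrict_integral G l0 r2) -(restrict_integral G r1 h1).
have i1 := restrict_integrable (hlo n) (hmid n) cG.
have i2 := restrict_integrable (hmid n) (hhi n) cG.
rewrite -RintegralB // -RintegralZl //; last first.
  by have := @integrableB _ _ R leb `[0, 1] (measurable_itv _) _ _ i1 i2; congr (integrable _ _ _).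
rewrite /hint /Rintegral; congr fine; apply: ae_eq_integral => //.
- apply/measurable_EFinP; apply: measurable_funM; first exact: continuous_meas.
  by apply: (measurable_funS measurableT) => //; exact: haar_measurable.
- apply/measurable_EFinP; apply: measurable_funM; first exact: measurable_cst.
  by apply: measurable_funB; apply/measurable_EFinP; apply: (measurable_int leb).
exists ([set hlo n] `|` [set hmid n] `|` [set hhi n]); split.
- by apply: measurableU; [apply: measurableU|].
- apply/eqP; rewrite eq_le measure_ge0 andbT.
  apply: le_trans (measureU2 _ _ _) _ => //; first exact: measurableU.
  rewrite [X in (_ + X)%E]lebesgue_measure_set1 adde0.
  apply: le_trans (measureU2 _ _ _) _ => //.
  by rewrite [X in (X + _)%E]lebesgue_measure_set1 [X in (_ + X)%E]lebesgue_measure_set1 adde0.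
move=> x /= h; apply: contrapT => hx; apply: h => _ /=; congr (_%:E).
have [x1 x2 x3] : [/\ x != hlo n, x != hmid n & x != hhi n].
  by split; apply/eqP => e; apply: hx; rewrite e; [left; left|left; right|right].
rewrite haarE // /patch (negbTE x1) (negbTE x2) (negbTE x3).
rewrite !mem_setE !in_itv /=.
rewrite !lt_neqAle [hlo n == x]eq_sym [hmid n == x]eq_sym x1 x2 x3 /=.
case: (lerP (hlo n) x) => c1; case: (lerP x (hmid n)) => c2;
  case: (lerP (hmid n) x) => c3; case: (lerP x (hhi n)) => c4 /=;
  rewrite ?subr0 ?sub0r ?subrr ?mulr0 ?mulrN //; try ring; try (exfalso; lra).
Qed.

Lemma hint1_FTC (G F : R -> R) : continuous G ->
  (forall t : R, 0 <= t <= 1 -> is_derive t 1 F (G t)) -> hint 1 G = F 1 - F 0.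
Proof.
move=> cG hF; rewrite -(integral_FTC (G := G)) //.
by rewrite /hint; apply: eq_Rintegral => t _; rewrite haar1 mulr1.
Qed.

Lemma hint_linear n a (G H : R -> R) : (0 < n)%N -> continuous G -> continuous H ->
  hint n (fun t => a * G t + H t) = a * hint n G + hint n H.
Proof.
move=> n0 cG cH; have [F hF] := primitive_exists cG; have [K hK] := primitive_exists cH.
have hFK (t : R) : 0 <= t <= 1 -> is_derive t 1 (fun t => a * F t + K t) (a * G t + H t).
  move=> ht; have := hF t ht; have := hK t ht => ? ?.
  exact: is_deriveD.
have cGH : continuous (fun t => a * G t + H t).
  by move=> t; apply: cvgD; [apply: cvgMr; exact: cG|exact: cH].
case: (ltnP 1 n) => n1.
  by rewrite !(hint_FTC n1 _ hF, hint_FTC n1 _ hK, hint_FTC n1 _ hFK) //; ring.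
have -> : n = 1%N by case: n n1 n0 => [|[]].
by rewrite (hint1_FTC _ hF) ?(hint1_FTC _ hK) ?(hint1_FTC _ hFK) //; ring.
Qed.

(** The left integral minus the right one is an increment of H(t) = F(t) - F(t + w) over an interval
    of length w = [hwid n], so the mean value theorem gives w times a single difference of G. *)
Lemma hint_bound n (G : R -> R) (K : R) : (1 < n)%N -> continuous G ->
  (forall t, hlo n <= t <= hmid n -> `|G t - G (t + hwid n)| <= K) ->
  `|hint n G| <= amp n * hwid n * K.
Proof.
move=> n1 cG hK; have [F hF] := primitive_exists cG.
have e1 := hmid_lo R n1; have e2 := hhi_mid R n1; have w0 := hwid_gt0 R n.
have l0 := hlo_ge0 R n; have h1 := hhi_le1 R n1.
rewrite (hint_FTC n1 cG hF) normrM (gtr0_norm (amp_gt0 R n)) -mulrA ler_pM2l ?amp_gt0 //.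
pose H t := F t - F (t + hwid n).
have dH (t : R) : hlo n <= t <= hmid n -> is_derive t 1 H (G t - G (t + hwid n)).
  move=> ht; have d1 : is_derive t 1 F (G t) by apply: hF; lra.
  have d2 : is_derive (t + hwid n) 1 F (G (t + hwid n)) by apply: hF; lra.
  apply: is_deriveB.
  have d3 : is_derive t 1 (fun t => t + hwid n) 1.
    by rewrite -[X in is_derive _ _ _ X]addr0; apply: is_deriveD.
  rewrite -[X in is_derive _ _ _ X]mulr1.
  exact: (@is_derive1_comp _ F (fun t => t + hwid n) t _ _ d2 d3).
have lm : hlo n <= hmid n by lra.
have [c hc hMVT] : exists2 c, c \in `[hlo n, hmid n] &
    H (hmid n) - H (hlo n) = (G c - G (c + hwid n)) * (hmid n - hlo n).
  apply: (@MVT_segment _ H (fun t => G t - G (t + hwid n))) => //.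
    by move=> t; rewrite in_itv /= => /andP[ta tb]; apply: dH; lra.
  apply: derivable_within_continuous => t; rewrite in_itv /= => ht.
  by have [] := dH t ht.
have -> : F (hmid n) - F (hlo n) - (F (hhi n) - F (hmid n)) = H (hmid n) - H (hlo n).
  by rewrite /H -e1 -e2; ring.
rewrite hMVT normrM (_ : hmid n - hlo n = hwid n) ?(gtr0_norm w0) 1?mulrC ?ler_pM2l //; last lra.
by apply: hK; move: hc; rewrite in_itv.
Qed.

Lemma hint1_bound (G : R -> R) (K : R) : continuous G ->
  (forall t, 0 <= t <= 1 -> `|G t| <= K) -> `|hint 1 G| <= K.
Proof.
move=> cG hK; have [F hF] := primitive_exists cG.
rewrite (hint1_FTC cG hF).
have [c hc ->] : exists2 c, c \in `[0, 1] & F 1 - F 0 = G c * (1 - 0).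
  apply: MVT_segment => //.
    by move=> t; rewrite in_itv /= => /andP[ta tb]; apply: hF; lra.
  apply: derivable_within_continuous => t; rewrite in_itv /= => ht.
  by have [] := hF t ht.
by rewrite subr0 mulr1; apply: hK; move: hc; rewrite in_itv.
Qed.

End HaarIntegral.

(** * Product Haar coefficients as mixed differences *)

Section HaarCoefficients.
Variables (R : realType) (d : nat).
Local Notation V := 'rV[R]_d.
Local Notation cube := (@cube R d).
Local Notation haar := (@haar R).
Local Notation amp := (amp R).
Local Notation hlo := (hlo R).
Local Notation hmid := (hmid R).
Local Notation hhi := (hhi R).
Local Notation hwid := (hwid R).
Implicit Types (g : V -> R) (x y : V) (L : seq (nat * R)).

Lemma hint_le n (G : R -> R) (K : R) : (0 < n)%N -> continuous G ->
  (forall t, 0 <= t <= 1 -> `|G t| <= K) -> `|hint n G| <= amp n * K.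
Proof.
move=> n0 cG hK; have K0 : 0 <= K by apply: le_trans (hK 0 _); rewrite ?normr_ge0 ?lexx ?ler01.
case: (ltnP 1 n) => [n1|n1]; last first.
  have -> : n = 1%N by case: n n1 n0 => [|[]].
  by rewrite amp1 mul1r; exact: hint1_bound.
have a0 := amp_gt0 R n; have w0 := hwid_gt0 R n.
have e1 := hmid_lo R n1; have e2 := hhi_mid R n1.
have l0 := hlo_ge0 R n; have h1 := hhi_le1 R n1.
apply: le_trans (hint_bound (K := 2 * K) n1 cG _) _.
  move=> t ht; apply: le_trans (ler_normB _ _) _.
  have : `|G t| <= K by apply: hK; lra.
  have : `|G (t + hwid n)| <= K by apply: hK; lra.
  lra.
have : hwid n * 2 <= 1 by lra.
by move: (hwid n) (amp n) a0 w0 => w a a0 w0 hw; rewrite -mulrA ler_pM2l // mulrA; nra.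
Qed.

Lemma hint_integrable n (G : R -> R) : (0 < n)%N -> continuous G ->
  (@lebesgue_measure R).-integrable `[0, 1] (EFin \o (fun t => G t * haar n t)).
Proof.
move=> n0 cG; have cG' : continuous (fun t => amp n * G t) by move=> t; apply: cvgMr; exact: cG.
apply: (le_integrable _ _ _ (continuous_integrable 0 1 cG')) => //.
- apply/measurable_EFinP; apply: measurable_funM; first exact: continuous_meas.
  case: (ltnP 1 n) => [n1|n1].
    by apply: (measurable_funS measurableT) => //; exact: haar_measurable.
  have -> : n = 1%N by case: n n1 n0 {cG'} => [|[]].
  by rewrite (_ : haar 1 = cst 1) //; exact: measurable_cst.
- move=> t _ /=; rewrite lee_fin !normrM mulrC ler_wpM2r //.
  by rewrite (gtr0_norm (amp_gt0 R n)) normr_haar_le.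
Qed.

(** Uniform continuity on the whole space in the maximum distance. The class is stable under
    translation and under Haar integration in one coordinate, so every integrand of an iterated
    integral is continuous. *)
Definition ucont g := forall e : R, 0 < e -> exists2 dl : R, 0 < dl &
  forall x y, (forall s, `|x ord0 s - y ord0 s| < dl) -> `|g x - g y| < e.

Definition trl k (h : R) x : V := \row_(j < d) (x ord0 j + if (j : nat) == k then h else 0).

Lemma setcoordE x k t s : setcoord x k t ord0 s = if (s : nat) == k then t else x ord0 s.
Proof. by rewrite mxE. Qed.

Lemma trlE k h x s : trl k h x ord0 s = x ord0 s + if (s : nat) == k then h else 0.
Proof. by rewrite mxE. Qed.

Lemma trlC k h k' h' x : trl k h (trl k' h' x) = trl k' h' (trl k h x).
Proof. by apply/rowP => s; rewrite !trlE addrAC. Qed.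

Lemma trl_setcoord k h k' t x : k != k' ->
  setcoord (trl k h x) k' t = trl k h (setcoord x k' t).
Proof.
move=> kk; apply/rowP => s; rewrite trlE !setcoordE trlE.
by case: (eqVneq (s : nat) k') => [->|_] //; rewrite eq_sym (negbTE kk) addr0.
Qed.

Lemma setcoord_trl k h t x : setcoord x k (t + h) = trl k h (setcoord x k t).
Proof.
by apply/rowP => s; rewrite trlE !setcoordE; case: eqP => //; rewrite addr0.
Qed.

Lemma ucont_trl k h g : ucont g -> ucont (fun x => g (trl k h x)).
Proof.
move=> hg e e0; have [dl d0 hd] := hg e e0; exists dl => // x y hxy; apply: hd => s.
by rewrite !trlE opprD addrACA subrr addr0.
Qed.

Lemma ucont_linear a g g' : ucont g -> ucont g' -> ucont (fun x => a * g x + g' x).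
Proof.
move=> hg hg' e e0; have e2 : 0 < e / 2 by lra.
have a0 : 0 < `|a| + 1 by have := normr_ge0 a; lra.
have [d1 d10 h1] := hg (e / 2 / (`|a| + 1)) (divr_gt0 e2 a0).
have [d2 d20 h2] := hg' _ e2.
exists (Num.min d1 d2) => [|x y hxy]; first by rewrite lt_min d10.
have -> : a * g x + g' x - (a * g y + g' y) = a * (g x - g y) + (g' x - g' y) by ring.
apply: le_lt_trans (ler_normD _ _) _; rewrite normrM.
have k1 : `|g x - g y| < e / 2 / (`|a| + 1).
  by apply: h1 => s; apply: lt_le_trans (hxy s) _; rewrite ge_min lexx.
have k2 : `|g' x - g' y| < e / 2.
  by apply: h2 => s; apply: lt_le_trans (hxy s) _; rewrite ge_min lexx orbT.
move: k1; rewrite ltr_pdivlMr // => k1.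
by have := normr_ge0 (g x - g y); nra.
Qed.

Lemma ucont_setcoord g x k : ucont g -> continuous (fun t => g (setcoord x k t)).
Proof.
move=> hg t; apply/cvgrPdist_lt => e e0; have [dl d0 hd] := hg e e0.
near=> u; apply: hd => s; rewrite !setcoordE; case: ifP => _; last by rewrite subrr normr0.
near: u; exact: cvgr_dist_lt.
Unshelve. all: by end_near. Qed.

Variable n : nat -> nat.
Hypothesis n_gt0 : forall k, (0 < n k)%N.

Fixpoint hiter k g x : R :=
  if k is k'.+1 then hint (n k') (fun t => hiter k' g (setcoord x k' t)) else g x.

Lemma hiter_ucont k g : ucont g -> ucont (hiter k g).
Proof.
move=> hg; elim: k => [|k IH] //= e e0.
have a0 := amp_gt0 R (n k); have e2 : 0 < e / 2 by lra.
have [dl d0 hd] := IH _ (divr_gt0 e2 a0).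
exists dl => // x y hxy.
have c1 := @ucont_setcoord _ x k IH; have c2 := @ucont_setcoord _ y k IH.
rewrite -mulN1r addrC -hint_linear //.
apply: le_lt_trans (hint_le (K := e / 2 / amp (n k)) _ _ _) _ => //.
- by move=> t; apply: cvgD; [apply: cvgMr; exact: c2|exact: c1].
- move=> t _; rewrite addrC mulN1r ltW //; apply: hd => s.
  by rewrite !setcoordE; case: ifP => //; rewrite subrr normr0.
- by rewrite mulrC mulfVK ?gt_eqF //; lra.
Qed.

Lemma hiter_linear k a g g' x : ucont g -> ucont g' ->
  hiter k (fun x => a * g x + g' x) x = a * hiter k g x + hiter k g' x.
Proof.
move=> hg hg'; elim: k x => [|k IH] x //=.
under eq_fun do rewrite IH.
by rewrite hint_linear //; apply: ucont_setcoord; exact: hiter_ucont.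
Qed.

Lemma hiter_trl k k' h g x : (k <= k')%N ->
  hiter k (fun x => g (trl k' h x)) x = hiter k g (trl k' h x).
Proof.
elim: k x => [|k IH] x //= kk; congr hint; apply/funext => t.
by rewrite IH ?(ltnW kk) // trl_setcoord // gtn_eqF.
Qed.

(* entries of L are pairs (coordinate, increment) *)
Fixpoint Dl L g x : R :=
  if L is p :: L' then Dl L' g x - Dl L' g (trl p.1 p.2 x) else g x.

Lemma Dl_linear L a g g' x : Dl L (fun x => a * g x + g' x) x = a * Dl L g x + Dl L g' x.
Proof. by elim: L x => //= p L IH x; rewrite !IH; ring. Qed.

Lemma Dl_trl L k h g x : Dl L (fun x => g (trl k h x)) x = Dl L g (trl k h x).
Proof. by elim: L x => //= p L IH x; rewrite !IH trlC. Qed.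

Lemma Dl_diff L k h g x :
  Dl L (fun x => -1 * g (trl k h x) + g x) x = Dl ((k, h) :: L) g x.
Proof. by rewrite Dl_linear Dl_trl /=; ring. Qed.

(** Coordinates with index 1 are left out: integration against the constant function gives a mean,
    not a difference. *)
Fixpoint hlist k : seq (nat * R) :=
  if k is k'.+1 then
    if (1 < n k')%N then (k', hwid (n k')) :: hlist k' else hlist k'
  else [::].

Definition hcst m : R := if (1 < m)%N then amp m * hwid m else 1.

(** By [hint_bound] the outermost integral yields a difference in coordinate k of the inner iterated
    integral; linearity and translation move this difference onto g, to which the induction
    hypothesis applies. *)
Lemma hiter_bound k g x (K : R) : ucont g ->
  (forall y, (forall s : 'I_d, (s < k)%N ->
      if (1 < n s)%N then hlo (n s) <= y ord0 s <= hmid (n s) else 0 <= y ord0 s <= 1) ->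
    (forall s : 'I_d, (k <= s)%N -> y ord0 s = x ord0 s) -> `|Dl (hlist k) g y| <= K) ->
  `|hiter k g x| <= (\prod_(i < k) hcst (n i)) * K.
Proof.
elim: k g x => [|k IH] g x hg hK /=; first by rewrite big_ord0 mul1r; apply: hK.
have ck := @ucont_setcoord _ x k (hiter_ucont k hg).
rewrite big_ord_recr /= [X in X * _]mulrC -mulrA {1}/hcst.
case: (ltnP 1 (n k)) => n1; last first.
  have e1 : n k = 1%N by have := n_gt0 k; case: (n k) n1 => [|[]].
  rewrite mul1r e1; apply: hint1_bound => // t ht; apply: IH => // y h1 h2.
  have hl : hlist k.+1 = hlist k by rewrite /= e1.
  rewrite -hl; apply: hK => s hs.
    move: hs; rewrite ltnS leq_eqVlt => /orP[/eqP sk|/h1 //].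
    by rewrite sk e1 /= h2 ?sk // setcoordE sk eqxx.
  by rewrite h2 ?(ltnW hs) // setcoordE gtn_eqF.
apply: hint_bound => // t ht.
rewrite setcoord_trl -hiter_trl // -mulN1r addrC -hiter_linear //; last exact: ucont_trl.
apply: IH; first by apply: ucont_linear => //; exact: ucont_trl.
move=> y h1 h2; rewrite Dl_diff.
have hl : hlist k.+1 = (k, hwid (n k)) :: hlist k by rewrite /= n1.
rewrite -hl; apply: hK => s hs.
  move: hs; rewrite ltnS leq_eqVlt => /orP[/eqP sk|/h1 //].
  by rewrite sk n1 h2 ?sk // setcoordE sk eqxx.
by rewrite h2 ?(ltnW hs) // setcoordE gtn_eqF.
Qed.

(** Haar factors of coordinates not yet integrated are constant in the current variable and are
    pulled out; for k = d none remain. *)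
Lemma iint_hiter k g x : (k <= d)%N -> ucont g ->
  iint k (fun x => g x * haar_d (fun s => n s) x) x =
  hiter k g x * \prod_(s < d | (k <= s)%N) haar (n s) (x ord0 s).
Proof.
move=> + hg; elim: k x => [|k IH] x kd //=.
have ck := @ucont_setcoord _ x k (hiter_ucont k hg).
rewrite /hint -RintegralZr //; last exact: hint_integrable.
apply: eq_Rintegral => t _; rewrite IH ?(ltnW kd) // -mulrA; congr (_ * _).
rewrite (bigD1 (Ordinal kd)) //= setcoordE eqxx; congr (_ * _).
apply: eq_big => [s|s /andP[_ hs]].
  by rewrite -val_eqE /= [(k < s)%N]ltn_neqAle andbC eq_sym.
by rewrite setcoordE; move: hs; rewrite -val_eqE /= => /negbTE ->.
Qed.

Lemma eq_iint k (h h' : V -> R) x :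
  (forall y, (forall s : 'I_d, (s < k)%N -> 0 <= y ord0 s <= 1) ->
     (forall s : 'I_d, (k <= s)%N -> y ord0 s = x ord0 s) -> h y = h' y) ->
  iint k h x = iint k h' x.
Proof.
elim: k x => [|k IH] x hh /=; first exact: hh.
apply: eq_Rintegral => t; rewrite inE /= in_itv /= => ht; apply: IH => y h1 h2.
apply: hh => s hs.
  move: hs; rewrite ltnS leq_eqVlt => /orP[/eqP sk|/h1 //].
  by rewrite h2 ?sk // setcoordE sk eqxx.
by rewrite h2 ?(ltnW hs) // setcoordE gtn_eqF.
Qed.

Definition tot L (s : nat) : R := \sum_(p <- L) if p.1 == s then p.2 else 0.

(** As increments are nonnegative, this ensures that all points at which [Dl L] evaluates its
    function lie in the cube. *)
Definition fits L y := all (fun p => 0 <= p.2) L /\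
  forall s : 'I_d, 0 <= y ord0 s /\ y ord0 s + tot L s <= 1.

Lemma tot_ge0 L s : all (fun p => 0 <= p.2) L -> 0 <= tot L s.
Proof.
rewrite /tot; elim: L => [|p L IH] /=; first by rewrite big_nil.
by case/andP => p0 /IH h; rewrite big_cons addr_ge0 //; case: ifP.
Qed.

Lemma fits_cons k h L y : fits ((k, h) :: L) y ->
  0 <= h /\ forall t, 0 <= t <= h -> fits L (trl k t y).
Proof.
move=> [/= /andP[h0 hL] hy]; split => // t /andP[t0 th]; split => // s.
have [y0 y1] := hy s; rewrite trlE; move: y1; rewrite /tot big_cons /= -/(tot L s) eq_sym.
by case: ifP => _ ?; split; lra.
Qed.

Lemma trl0 k y : trl k 0 y = y.
Proof. by apply/rowP => s; rewrite trlE; case: ifP; rewrite addr0. Qed.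

Lemma fits_cube L y : fits L y -> cube y.
Proof. by move=> [hL hy] s; have [y0 y1] := hy s; have := tot_ge0 s hL; lra. Qed.

Lemma eq_Dl L g g' y : (forall x, cube x -> g x = g' x) -> fits L y -> Dl L g y = Dl L g' y.
Proof.
move=> hg; elim: L y => [|[k h] L IH] y hy /=; first by apply: hg; exact: fits_cube hy.
have [h0 ht] := fits_cons hy.
rewrite !IH //; first by apply: ht; rewrite h0 lexx.
by rewrite -[y](trl0 k); apply: ht; rewrite h0 lexx.
Qed.

Lemma tot_hlist k s : tot (hlist k) s = if (s < k)%N && (1 < n s)%N then hwid (n s) else 0.
Proof.
elim: k => [|k IH] /=; first by rewrite /tot big_nil.
rewrite [(s < k.+1)%N]ltnS [(s <= k)%N]leq_eqVlt; case: (eqVneq s k) IH => [->|sk] IH /=.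
  case: ifP => h; last by rewrite IH ltnn.
  by rewrite /tot big_cons /= eqxx -/(tot _ _) IH ltnn addr0.
case: ifP => h; last by rewrite IH.
by rewrite /tot big_cons /= eq_sym (negbTE sk) add0r -/(tot _ _) IH.
Qed.

Lemma hlist_ge0 k : all (fun p => 0 <= p.2) (hlist k).
Proof. by elim: k => //= k IH; case: ifP => //= _; rewrite IH ltW // hwid_gt0. Qed.

(** Functions are controlled only near the cube, while [hiter] needs uniform continuity everywhere;
    the extension is harmless because coefficients see only the cube. *)
Definition ccont g := exists2 g', ucont g' & forall x, cube x -> g' x = g x.

Lemma coef_hiter g g' : ucont g' -> (forall x, cube x -> g' x = g x) ->
  haar_coef g (fun s => n s) = hiter d g' 0.
Proof.
move=> hg' e; rewrite /haar_coef /cube_integral.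
have -> : iint d (fun x => g x * haar_d (fun s => n s) x) 0 =
          iint d (fun x => g' x * haar_d (fun s => n s) x) 0.
  by apply: eq_iint => y hy _; rewrite e // => s; apply: hy.
by rewrite iint_hiter // big_pred0 ?mulr1 // => s; rewrite leqNgt ltn_ord.
Qed.

Lemma coef_linear a g1 g2 : ccont g1 -> ccont g2 ->
  haar_coef (fun x => a * g1 x + g2 x) (fun s => n s) =
  a * haar_coef g1 (fun s => n s) + haar_coef g2 (fun s => n s).
Proof.
move=> [h1 c1 e1] [h2 c2 e2].
rewrite (coef_hiter c1 e1) (coef_hiter c2 e2) -hiter_linear //.
by apply: coef_hiter; [exact: ucont_linear|move=> x cx; rewrite e1 // e2].
Qed.

(** The additional factor [amp] turns the constant amp * hwid of each genuine Haar function into 2^j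
    / 2^(j+1) = 1/2, so the bound no longer involves the levels. *)
Lemma coef_bound g (K : R) : ccont g -> 0 <= K ->
  (forall y, fits (hlist d) y -> `|Dl (hlist d) g y| <= K) ->
  `|haar_coef g (fun s => n s)| * \prod_(s < d) amp (n s) <= K.
Proof.
move=> [g' cg' e] K0 hK; rewrite (coef_hiter cg' e).
have a0 : 0 <= \prod_(s < d) amp (n s) by apply: prodr_ge0 => s _; rewrite ltW // amp_gt0.
apply: le_trans (ler_wpM2r a0 (hiter_bound (K := K) cg' _)) _.
  move=> y hy _.
  have fy : fits (hlist d) y.
    split; first exact: hlist_ge0.
    move=> s; have := hy s (ltn_ord s); rewrite tot_hlist ltn_ord /=.
    case: ifP => n1 /andP[h1 h2]; last by rewrite addr0.
    have e1 := hmid_lo R n1; have e2 := hhi_mid R n1; have l0 := hlo_ge0 R (n s).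
    have l1 := hhi_le1 R n1; have w0 := hwid_gt0 R (n s).
    by split; lra.
  by rewrite (eq_Dl e fy); exact: hK.
rewrite mulrAC -big_split /= ler_piMl //; apply: prodr_ile1 => s _.
rewrite /hcst; case: ifP => n1.
  have -> : amp (n s) * hwid (n s) * amp (n s) = 2^-1.
    rewrite mulrAC -expr2 amp_sqr /hwid expnS natrM; field.
    by rewrite lt0r_neq0 // pow2_gt0.
  by apply/andP; split; lra.
have -> : n s = 1%N by have := n_gt0 s; case: (n s) n1 => [|[]].
by rewrite amp1 mul1r ler01 lexx.
Qed.

End HaarCoefficients.

(** * Decay of the coefficients of smooth functions *)

Section MixedDifferences.
Variables (R : realType) (d : nat).
Local Notation V := 'rV[R]_d.
Local Notation hwid := (hwid R).
Implicit Types (g : V -> R) (x y : V) (L : seq (nat * R)).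

Lemma Dl_cat L1 L2 g y : Dl (L1 ++ L2) g y = Dl L1 (Dl L2 g) y.
Proof. by elim: L1 y => //= p L1 IH y; rewrite !IH. Qed.

Lemma Dl_catC L1 L2 g y : Dl (L1 ++ L2) g y = Dl (L2 ++ L1) g y.
Proof.
elim: L1 L2 g y => [|p L1 IH] L2 g y; first by rewrite cats0.
rewrite /= !IH; elim: L2 y {IH} => //= q L2 IH y.
by rewrite -!IH trlC; ring.
Qed.

Lemma Dl_perm L1 L2 g y : perm_eq L1 L2 -> Dl L1 g y = Dl L2 g y.
Proof.
move: L1 L2; apply: (catCA_perm_subst (F := fun L => Dl L g y)) => L1 L2 L3.
by rewrite !catA Dl_cat [RHS]Dl_cat Dl_catC.
Qed.

Lemma fits_perm L1 L2 y : perm_eq L1 L2 -> fits L1 y -> fits L2 y.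
Proof.
move=> p [h1 h2]; split; first by rewrite -(perm_all _ p).
by move=> s; have := h2 s; rewrite /tot (perm_big _ p).
Qed.

(** Differences for which no smoothness is left cost a factor 2 each. *)
Lemma Dl_cat_bound L1 L2 g y (K : R) :
  (forall y', fits L2 y' -> `|Dl L2 g y'| <= K) -> fits (L1 ++ L2) y ->
  `|Dl (L1 ++ L2) g y| <= 2 ^+ size L1 * K.
Proof.
move=> hK; elim: L1 y => [|[k h] L1 IH] y /= hy; first by rewrite expr0 mul1r; exact: hK.
have [h0 ht] := fits_cons hy.
have h1 : fits (L1 ++ L2) y by rewrite -[y](trl0 k); apply: ht; rewrite h0 lexx.
have h2 : fits (L1 ++ L2) (trl k h y) by apply: ht; rewrite h0 lexx.
apply: le_trans (ler_normB _ _) _.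
by rewrite exprS -mulrA; have := IH _ h1; have := IH _ h2; lra.
Qed.

(* what bounded partial derivatives of order <= l, those of order l being alpha-Hoelder,
   imply for mixed differences *)
Definition smooth_class l (alpha K : R) g :=
  (forall L y, (size L <= l)%N -> all (fun p => (p.1 < d)%N) L -> fits L y ->
     `|Dl L g y| <= K * \prod_(p <- L) p.2) /\
  (forall L p y, size L = l -> all (fun p => (p.1 < d)%N) (rcons L p) -> fits (rcons L p) y ->
     `|Dl (rcons L p) g y| <= K * (\prod_(p <- L) p.2) * p.2 `^ alpha).

(** Both sides are the entry of s at position r + i modulo its size. *)
Lemma nth_rot_sym (T : Type) (x0 : T) (s : seq T) r i : (r < size s)%N -> (i < size s)%N ->
  nth x0 (rot r s) i = nth x0 (rot i s) r.
Proof.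
move=> hr hi; rewrite /rot !nth_cat !size_drop !nth_drop.
case: (ltnP i (size s - r)) => h1; case: (ltnP r (size s - i)) => h2; try lia.
  by rewrite addnC.
by rewrite !nth_take; [congr nth; lia|lia|lia].
Qed.

(* Averaging over the rotations of s replaces a sorting argument. *)
Lemma good_rotation (T : eqType) (x0 : T) (s : seq T) (j : T -> R) l (alpha : R) :
  (l < size s)%N ->
  exists r, (l%:R + alpha) / (size s)%:R * \sum_(x <- s) j x <=
    \sum_(x <- take l (rot r s)) j x + alpha * j (nth x0 (rot r s) l).
Proof.
move=> ls; apply: contrapT => /forallNP hn.
have s0 : 0 < (size s)%:R :> R by rewrite ltr0n; exact: leq_ltn_trans ls.
pose S := \sum_(x <- s) j x.
(* Over all rotations each position runs once through all entries; hence the right-hand side of the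
   claim has mean equal to its left-hand side. *)
have hr i : (i < size s)%N -> \sum_(r < size s) j (nth x0 (rot r s) i) = S.
  move=> hi; rewrite /S -(perm_big s (permEl (perm_rot i s))) /= (big_nth x0) size_rot big_mkord.
  by apply: eq_bigr => r _; rewrite nth_rot_sym.
have e : \sum_(r < size s) (\sum_(x <- take l (rot r s)) j x + alpha * j (nth x0 (rot r s) l)) =
    (l%:R + alpha) * S.
  rewrite big_split /= -mulr_sumr hr // mulrDl; congr (_ + _).
  under eq_bigr => r _.
    rewrite (big_nth x0) size_take size_rot ls big_mkord.
    under eq_bigr => i _ do rewrite nth_take //.
    over.
  rewrite exchange_big /=; under eq_bigr => i _ do rewrite hr ?(ltn_trans (ltn_ord i)) //.
  by rewrite sumr_const card_ord mulr_natl.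
have : \sum_(r < size s) (\sum_(x <- take l (rot r s)) j x + alpha * j (nth x0 (rot r s) l)) <
    \sum_(r < size s) ((l%:R + alpha) / (size s)%:R * S).
  apply: ltr_sum => [|r _]; last by rewrite ltNge; apply/negP; exact: hn.
  by apply/hasP; exists (Ordinal (leq_ltn_trans (leq0n l) ls)); rewrite ?mem_index_enum.
rewrite e sumr_const card_ord -[X in _ < X]mulr_natl.
rewrite (_ : (size s)%:R * _ = (l%:R + alpha) * S) ?ltxx //.
by field; rewrite lt0r_neq0.
Qed.

Definition coords (n : nat -> nat) k := rev [seq s <- iota 0 k | (1 < n s)%N].

Lemma hlistE n k : hlist R n k = [seq (s, hwid (n s)) | s <- coords n k].
Proof.
elim: k => [//|k IH]; rewrite [LHS]/= IH /coords.
rewrite (_ : iota 0 k.+1 = iota 0 k ++ [:: k]); last by rewrite -addn1 iotaD.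
by rewrite filter_cat /=; case: ifP => _; rewrite ?cats0 // rev_cat.
Qed.

Lemma coords_lt n k s : s \in coords n k -> (s < k)%N.
Proof. by rewrite mem_rev mem_filter mem_iota add0n => /and3P[]. Qed.

Lemma sum_coords (n : nat -> nat) : (forall k, (0 < n k)%N) ->
  (\sum_(s < d) lev (n s))%N = (\sum_(s <- coords n d) lev (n s))%N.
Proof.
move=> n0; rewrite /coords big_rev /= big_filter -(big_mkord xpredT (fun s => lev (n s))).
rewrite /index_iota subn0 [in RHS]big_mkcond /=; apply: eq_bigr => s _.
case: ifP => // h; have -> : n s = 1%N by have := n0 s; case: (n s) h => [|[]].
by rewrite /lev trunc_log0.
Qed.

Lemma hwid_le n : hwid n <= 2 `^ (- (lev n)%:R).
Proof.
rewrite powRN powR_mulrn // /hwid -natrX lef_pV2 ?posrE ?pow2_gt0 //.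
by rewrite ler_nat leq_exp2l.
Qed.

Lemma prod_hwid_le (n : nat -> nat) (s : seq nat) :
  \prod_(x <- s) hwid (n x) <= 2 `^ (- \sum_(x <- s) (lev (n x))%:R).
Proof.
elim: s => [|x s IH]; first by rewrite !big_nil oppr0 powRr0.
rewrite !big_cons opprD powRD; last by rewrite pnatr_eq0 implybT.
apply: ler_pM => //; [exact: ltW (hwid_gt0 _ _)| |exact: hwid_le].
by apply: prodr_ge0 => i _; exact: ltW (hwid_gt0 _ _).
Qed.

(** With more than l genuine coordinates, a good rotation picks l of them for differentiation and
    one for the Hoelder bound; their share of the exponent is at least (l + alpha) / size cs, which
    is at least gam as size cs <= d. With at most l coordinates all are differentiated, and gam <= 1
    suffices. *)
Lemma smooth_class_hlist l (alpha K gam : R) g (n : nat -> nat) : 0 < alpha -> 0 <= K -> (0 < d)%N ->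
  gam <= 1 -> 0 <= gam -> gam * d%:R <= l%:R + alpha ->
  (forall k, (0 < n k)%N) -> smooth_class l alpha K g ->
  forall y, fits (hlist R n d) y ->
  `|Dl (hlist R n d) g y| <= 2 ^+ d * K * (2 `^ (- gam)) ^+ (\sum_(s < d) lev (n s))%N.
Proof.
move=> al0 K0 d0 g1 g0 gd n0 [hA hB] y.
pose cs := coords n d; pose J : R := \sum_(s <- cs) (lev (n s))%:R.
have Jge : 0 <= J by apply: sumr_ge0.
have -> : (2 `^ (- gam)) ^+ (\sum_(s < d) lev (n s))%N = 2 `^ (- (gam * J)).
  rewrite -powR_mulrn ?powR_ge0 // -powRrM mulNr; congr (2 `^ (- (gam * _))).
  by rewrite sum_coords // natr_sum.
have one2 : 1 <= (2 : R) by rewrite ler1n.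
pose w s := (s, hwid (n s)).
have wall (s : seq nat) : {subset s <= cs} -> all (fun p => (p.1 < d)%N) (map w s).
  by move=> hs; apply/allP => p /mapP[x /hs xs ->] /=; exact: coords_lt xs.
have prodw (s : seq nat) : \prod_(p <- map w s) p.2 = \prod_(x <- s) hwid (n x).
  by rewrite big_map.
have scs : (size cs <= d)%N.
  rewrite /cs /coords size_rev size_filter -[leqRHS](size_iota 0); exact: count_size.
have p2 (q : nat) : 1 <= 2 ^+ q :> R by apply: exprn_ege1.
rewrite hlistE -/cs -/w.
case: (leqP (size cs) l) => hl hy.
  apply: le_trans (hA _ _ _ _ hy) _; [by rewrite size_map|exact: wall|].
  rewrite prodw [2 ^+ d * K]mulrC -mulrA; apply: ler_wpM2l => //.
  apply: le_trans (prod_hwid_le n cs) _; rewrite -/J.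
  apply: le_trans (_ : 2 `^ (- (gam * J)) <= _); last first.
    by rewrite ler_peMl ?powR_ge0.
  by apply: ler_powR => //; rewrite lerN2; nra.
have [r hr] := good_rotation 0%N (fun s => (lev (n s))%:R) alpha hl.
set t := take l (rot r cs) in hr; set x := nth 0%N (rot r cs) l in hr.
have szr : (l < size (rot r cs))%N by rewrite size_rot.
have eR : rot r cs = t ++ x :: drop l.+1 (rot r cs).
  by rewrite -drop_nth // cat_take_drop.
have pe : perm_eq (map w cs) (map w (drop l.+1 (rot r cs)) ++ rcons (map w t) (w x)).
  apply: perm_trans (_ : perm_eq (map w (rot r cs)) _).
    by rewrite perm_sym perm_map // perm_rot.
  rewrite [X in perm_eq (map w X)]eR map_cat /= -cat_rcons perm_catC perm_refl //.
have sub_t : {subset rcons t x <= cs}.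
  move=> s hs; rewrite -(mem_rot r) eR mem_cat inE.
  by move: hs; rewrite mem_rcons inE => /orP[->|->]; rewrite ?orbT.
rewrite (Dl_perm _ _ pe); have {}hy := fits_perm pe hy.
apply: le_trans (Dl_cat_bound (K := K * 2 `^ (- (gam * J))) _ hy) _; last first.
  rewrite mulrA; apply: ler_wpM2r; first exact: powR_ge0.
  apply: ler_wpM2r => //; rewrite ler_eXn2l ?ltr1n // size_map size_drop size_rot.
  exact: leq_trans (leq_subr _ _) scs.
move=> y' hy'.
apply: le_trans (hB _ _ _ _ _ hy') _.
- by rewrite size_map size_take szr.
- by rewrite -map_rcons; exact: wall.
rewrite prodw /w /= -mulrA; apply: ler_wpM2l => //.
apply: le_trans (_ : 2 `^ (- \sum_(x <- t) (lev (n x))%:R) * 2 `^ (- (alpha * (lev (n x))%:R)) <= _).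
  apply: ler_pM; [|exact: powR_ge0|exact: prod_hwid_le|].
    by apply: prodr_ge0 => i _; exact: ltW (hwid_gt0 _ _).
  rewrite (_ : - (alpha * _) = - (lev (n x))%:R * alpha) ?powRrM; last by rewrite mulNr mulrC.
  apply: ge0_ler_powR; rewrite ?nnegrE ?powR_ge0 //; first exact: ltW.
    exact: ltW (hwid_gt0 _ _).
  exact: hwid_le.
rewrite -powRD; last by rewrite pnatr_eq0 implybT.
apply: ler_powR => //; rewrite -opprD lerN2; apply: le_trans hr; rewrite -/J.
apply: ler_wpM2r => //; have sc0 : 0 < (size cs)%:R :> R by rewrite ltr0n (leq_ltn_trans _ hl).
rewrite ler_pdivlMr //; apply: le_trans gd; apply: ler_wpM2l => //.
by rewrite ler_nat.
Qed.

End MixedDifferences.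

(** * Mixed differences of smooth functions *)

Section Regularity.
Variables (R : realType) (d : nat).
Local Notation V := 'rV[R]_d.
Local Notation cube := (@cube R d).
Implicit Types (g : V -> R) (x y : V) (L : seq (nat * R)).

(** Only p has to lie in K: continuity at the points of K controls F on neighbourhoods whose size is
    made uniform by the covering form of compactness. *)
Lemma heine (T : pseudoMetricType R) (K : set T) (F : T -> R) : compact K ->
  (forall p, K p -> {for p, continuous F}) -> forall e : R, 0 < e ->
  exists2 dl : R, 0 < dl & forall p q, K p -> ball p dl q -> `|F p - F q| < e.
Proof.
move=> cK cF e e0.
have e2 : 0 < e / 2 by rewrite divr_gt0.
have : \forall dl \near 0^'+, K `<=` (fun p => forall q, ball p dl q -> `|F p - F q| < e).
  move/compact_near_coveringP: cK; apply => p Kp.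
  have /cvgrPdist_lt /(_ _ e2) := cF p Kp => /nbhs_ballP[r /= r0 hr].
  have r2 : 0 < r / 2 by rewrite divr_gt0.
  exists (ball p (r / 2), [set dl : R | dl < r / 2]).
    by split; [exact: nbhsx_ballx|exact: nbhs_right_lt].
  move=> [p' dl] /= [hp' hdl] q hq.
  have k1 : `|F p - F p'| < e / 2.
    by apply: hr; apply: le_ball hp'; lra.
  have k2 : `|F p - F q| < e / 2.
    apply: hr; rewrite /= (splitr r); apply: ball_triangle hp' _.
    by apply: le_ball hq; exact: ltW.
  rewrite -(subrKA (F p)); apply: le_lt_trans (ler_normD _ _) _.
  by rewrite distrC; lra.
move=> h; have [dl [d0 hd]] : exists dl : R, 0 < dl /\
    K `<=` (fun p => forall q, ball p dl q -> `|F p - F q| < e).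
  apply: (@filter_ex _ (0^'+ : set_system R)); near=> dl; split; first by near: dl; exact: nbhs_right_gt.
  by near: dl.
by exists dl => // p q Kp; apply: hd.
Unshelve. all: by end_near. Qed.

Lemma ball_row x y (e : R) : 0 < e -> (forall s, `|x ord0 s - y ord0 s| < e) -> ball x e y.
Proof. by move=> e0 h; split => // i j; rewrite (ord1 i); exact: h. Qed.

Lemma cube_compact : compact cube.
Proof.
have := @rV_compact R d (fun=> `[0, 1]%classic) (fun=> @segment_compact R 0 1).
by congr compact; apply/seteqP; split => x h s; have := h s; rewrite /= in_itv.
Qed.

(** Coordinatewise projection onto the cube. It increases no coordinate distance, so composition
    with it extends a continuous function on the cube to a uniformly continuous one. *)
Definition clamp x : V := \row_(s < d) Num.max 0 (Num.min 1 (x ord0 s)).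

Lemma clamp_cube x : cube (clamp x).
Proof.
move=> s; rewrite mxE le_max lexx /= ge_max ler01 /=.
by rewrite ge_min lexx.
Qed.

Lemma clamp_id x : cube x -> clamp x = x.
Proof.
move=> cx; apply/rowP => s; rewrite mxE; have /andP[h0 h1] := cx s.
by rewrite (min_idPr h1) (max_idPr h0).
Qed.

Lemma clamp_dist x y s : `|clamp x ord0 s - clamp y ord0 s| <= `|x ord0 s - y ord0 s|.
Proof.
have e (w : R) : Num.max 0 (Num.min 1 w) = if w <= 0 then 0 else if 1 <= w then 1 else w.
  case: (leP w 0) => h0; first by rewrite min_r ?max_l //; lra.
  by case: (leP 1 w) => h1; rewrite max_r //; lra.
rewrite !mxE !e; move: (x ord0 s) (y ord0 s) => u v.
have := ler_norm (u - v); have := ler_norm (- (u - v)); rewrite normrN ler_norml => h1 h2.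
by apply/andP; split; do !(case: ifPn; rewrite -?ltNge => ?); lra.
Qed.

Lemma ccont_continuous g : (forall x, cube x -> {for x, continuous g}) -> ccont g.
Proof.
move=> cg; exists (fun x => g (clamp x)); last by move=> x /clamp_id ->.
move=> e e0; have [dl d0 h] := heine cube_compact cg e0.
exists dl => // x y hxy; apply: h; first exact: clamp_cube.
by apply: ball_row => // s; apply: le_lt_trans (clamp_dist x y s) (hxy s).
Qed.

Lemma cube0 : cube 0.
Proof. by move=> s; rewrite mxE lexx ler01. Qed.

Lemma continuous_bounded g : (forall x, cube x -> {for x, continuous g}) ->
  exists2 K : R, 0 <= K & forall x, cube x -> `|g x| <= K.
Proof.
move=> cg.
have cg' : {within cube, continuous (fun x => `|g x|)}.
  apply: continuous_in_subspaceT => x; rewrite inE => cx.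
  by apply: continuous_comp; [exact: cg|exact: norm_continuous].
have [c _ hc] := compact_EVT_max (ex_intro _ _ cube0) cube_compact cg'.
by exists `|g c| => // x cx; apply: hc; rewrite inE.
Qed.

Lemma trl_delta (k : 'I_d) t x : trl k t x = x + t *: delta_mx ord0 k :> V.
Proof.
apply/rowP => s; rewrite trlE !mxE eqxx /= eq_sym -val_eqE /= eq_sym.
by case: (_ == _); rewrite ?mulr1 ?mulr0.
Qed.

Lemma trl_trl k t u x : trl k t (trl k u x) = trl k (t + u) x.
Proof.
by apply/rowP => s; rewrite !trlE -addrA; congr (_ + _); case: ifP; rewrite ?addr0 // addrC.
Qed.

Lemma is_derive_line g (k : 'I_d) (c : R) t y :
  is_derive (trl k t y) (delta_mx ord0 k) g c ->
  is_derive t 1 (fun t => g (trl k t y)) c.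
Proof.
have e : (fun h : R => h^-1 *: (((fun t => g (trl k t y)) \o shift t) (h *: 1) - g (trl k t y))) =
    (fun h : R => h^-1 *: ((g \o shift (trl k t y)) (h *: delta_mx ord0 k) - g (trl k t y))).
  apply/funext => h /=; congr (_ *: (g _ - _)).
  by rewrite [h *: 1]mulr1 -trl_trl trl_delta addrC.
move=> [hd he]; split.
  by move: hd; rewrite /derivable -e.
by rewrite -he /derive -e.
Qed.

Lemma Dl_is_derive L g g' (k : 'I_d) t y :
  (forall x, cube x -> is_derive x (delta_mx ord0 k) g (g' x)) -> fits L (trl k t y) ->
  is_derive t 1 (fun t => Dl L g (trl k t y)) (Dl L g' (trl k t y)).
Proof.
move=> hg; elim: L y => [|[j h] L IH] y hy /=.
  by apply: is_derive_line; apply: hg; exact: fits_cube hy.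
have [h0 ht] := fits_cons hy.
have h1 : fits L (trl k t y) by rewrite -[trl k t y](trl0 j); apply: ht; rewrite h0 lexx.
have h2 : fits L (trl k t (trl j h y)) by rewrite trlC; apply: ht; rewrite h0 lexx.
apply: is_deriveB; first exact: IH.
have := IH _ h2; rewrite trlC; congr (is_derive _ _ _ _).
by apply/funext => u; rewrite trlC.
Qed.

Lemma MVT_bound (phi phi' : R -> R) (a b K z z' : R) :
  (forall t, a <= t <= b -> is_derive t 1 phi (phi' t)) ->
  (forall t, a <= t <= b -> `|phi' t| <= K) ->
  a <= z <= b -> a <= z' <= b -> `|phi z' - phi z| <= K * `|z' - z|.
Proof.
move=> hd hK; wlog zz : z z' / z <= z'.
  move=> H hz hz'; have [h|/ltW h] := leP z z'; first exact: H.
  by rewrite distrC [`|z' - z|]distrC; apply: H.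
move=> hz hz'.
have [c] : exists2 c, c \in `[z, z'] & phi z' - phi z = phi' c * (z' - z).
  apply: MVT_segment => //.
    by move=> t; rewrite in_itv /= => ht; apply: hd; lra.
  apply: derivable_within_continuous => t; rewrite in_itv /= => ht.
  by have [] : is_derive t 1 phi (phi' t) by apply: hd; lra.
rewrite in_itv /= => hc ->; rewrite normrM; apply: ler_wpM2r => //.
by apply: hK; lra.
Qed.

(** The mean value theorem is applied to t -> Dl L g (trl k t y), whose derivative is the mixed
    difference of g' over the remaining entries. *)
Lemma Dl_MVT L g g' (k : 'I_d) (h K : R) y :
  (forall x, cube x -> is_derive x (delta_mx ord0 k) g (g' x)) ->
  (forall y, fits L y -> `|Dl L g' y| <= K) -> fits (((k : nat), h) :: L) y ->
  `|Dl (((k : nat), h) :: L) g y| <= h * K.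
Proof.
move=> hg hK hy; have [h0 ht] := fits_cons hy.
have := @MVT_bound (fun t => Dl L g (trl k t y)) (fun t => Dl L g' (trl k t y)) 0 h K 0 h.
rewrite /= trl0 subr0 (ger0_norm h0) distrC mulrC; apply.
- by move=> t hth; apply: Dl_is_derive => //; exact: ht.
- by move=> t hth; apply: hK; exact: ht.
- by rewrite lexx.
- by rewrite h0 lexx.
Qed.

Variables (a b : R) (l : nat) (alpha Cf : R) (f : R -> V -> R).
Hypothesis f_smooth : Ck_box l.+1 a b f.

Lemma pderivable_box o ds z x : (size ds <= l)%N -> a <= z <= b -> cube x ->
  pderivable o ds f z x.
Proof.
by have [U [_ [hU [hd _]]]] := f_smooth => sd hz cx; apply: (hd ds _ o (z, x)) => //; exact: hU.
Qed.

Lemma pderiv_continuous ds z x : (size ds <= l.+1)%N -> a <= z <= b -> cube x ->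
  {for (z, x), continuous (fun q : R * V => pderiv ds f q.1 q.2)}.
Proof.
by have [U [_ [hU [_ hc]]]] := f_smooth => sd hz cx; apply: hc => //; exact: hU.
Qed.

Lemma pderiv_continuous_x ds z x : (size ds <= l.+1)%N -> a <= z <= b -> cube x ->
  {for x, continuous (pderiv ds f z)}.
Proof.
move=> sd hz cx; have h := pderiv_continuous sd hz cx.
apply/(cvgrPdist_lt (F := nbhs x)) => e e0.
have /cvgrPdist_lt /(_ _ e0) /nbhs_ballP[r r0 hr] := h.
apply/nbhs_ballP; exists r => // y hy; apply: (hr (z, y)).
by split => //=; exact: ballxx.
Qed.

Lemma pderiv_z ds z x : (size ds <= l)%N -> a <= z <= b -> cube x ->
  is_derive z 1 (fun z => pderiv ds f z x) (pderiv (None :: ds) f z x).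
Proof. by move=> sd hz cx; split => //; exact: (pderivable_box None sd hz cx). Qed.

Lemma pderiv_x ds (k : 'I_d) z x : (size ds <= l)%N -> a <= z <= b -> cube x ->
  is_derive x (delta_mx ord0 k) (pderiv ds f z) (pderiv (Some k :: ds) f z x).
Proof. by move=> sd hz cx; split => //; exact: (pderivable_box (Some k) sd hz cx). Qed.

Hypothesis f_bound : forall s : seq 'I_d, (size s <= l)%N ->
  forall z x, a <= z <= b -> cube x -> `|pderiv (None :: map Some s) f z x| <= Cf.
Hypothesis f_holder : forall s : seq 'I_d, size s = l ->
  forall z x1 x2, a <= z <= b -> cube x1 -> cube x2 ->
    `|pderiv (None :: map Some s) f z x1 - pderiv (None :: map Some s) f z x2|
      <= Cf * enorm (x1 - x2) `^ alpha.

Lemma enorm_trl k h y : 0 <= h -> (k < d)%N -> enorm (y - trl k h y) = h.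
Proof.
move=> h0 kd; rewrite /enorm (bigD1 (Ordinal kd)) //= big1 => [|s hs].
  rewrite addr0 !mxE eqxx opprD addrA subrr sub0r sqrrN sqrtr_sqr ger0_norm //.
rewrite !mxE; move: hs; rewrite -val_eqE /= => /negbTE ->.
by rewrite addr0 subrr expr0n.
Qed.

(** Differences in x are traded for partial derivatives in x, and the remaining increment in z is
    estimated by the mean value theorem. The derivative in z thus comes last, as in the hypotheses,
    and no partial derivatives are interchanged. *)
Lemma smooth_class_diff z z' : a <= z <= b -> a <= z' <= b ->
  smooth_class l alpha (Cf * `|z' - z|) (fun x => f z' x - f z x).
Proof.
move=> hz hz'.
pose pd (ds : seq 'I_d) x := pderiv (map Some ds) f z' x - pderiv (map Some ds) f z x.
(* [L2] holds the differences that are not traded: none for the first property, the single Hoelder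
   difference for the second. *)
have descend L2 r (K : R) : (r <= l)%N ->
    (forall ds y, size ds = r -> fits L2 y -> `|Dl L2 (pd ds) y| <= K) ->
    forall L ds y, (size L + size ds)%N = r -> all (fun p => (p.1 < d)%N) L ->
      fits (L ++ L2) y -> `|Dl (L ++ L2) (pd ds) y| <= (\prod_(p <- L) p.2) * K.
  move=> rl hK; elim=> [|[k h] L IH] ds y.
    by move=> sd _ hy; rewrite big_nil mul1r; exact: hK.
  move=> sd /= /andP[kd hL] hy; rewrite big_cons -mulrA.
  apply: (Dl_MVT (k := Ordinal kd) (g' := pd (Ordinal kd :: ds))) => //.
    move=> x cx; have sds : (size (map (@Some 'I_d) ds) <= l)%N.
      by rewrite size_map; move: sd rl => /=; lia.
    by apply: is_deriveB; exact: pderiv_x.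
  by move=> y' hy'; apply: IH => //; rewrite -sd /= addnS.
split.
  move=> L y sL hL hy; rewrite -[L]cats0 mulrC big_cat big_nil /= mulr1.
  have := descend [::] (size L) (Cf * `|z' - z|) sL _ L [::] y.
  rewrite cats0 addn0; apply => // ds x sds fx.
  have cx := fits_cube fx.
  apply: (@MVT_bound (fun z => pderiv (map Some ds) f z x)
    (fun z => pderiv (None :: map Some ds) f z x) a b) => //.
    by move=> t ht; apply: pderiv_z => //; rewrite size_map sds.
  by move=> t ht; apply: f_bound => //; rewrite sds.
move=> L [k h] y sL; rewrite all_rcons => /andP[/= kd hL] hy.
have := descend [:: (k, h)] l (Cf * h `^ alpha * `|z' - z|) (leqnn l) _ L [::] y.
rewrite cats1 addn0 => H; apply: le_trans (H _ sL hL hy) _; last first.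
  by rewrite le_eqVlt; apply/orP; left; apply/eqP; rewrite /=; ring.
move=> ds x sds fx.
have [h0 ht] := fits_cons fx.
have cx : cube x by exact: fits_cube fx.
have cx' : cube (trl k h x).
  by apply: (@fits_cube _ _ [::]); apply: ht; rewrite h0 lexx.
have sds' : (size (map (@Some 'I_d) ds) <= l)%N by rewrite size_map sds.
pose phi u := pderiv (map Some ds) f u x - pderiv (map Some ds) f u (trl k h x).
pose phi' u := pderiv (None :: map Some ds) f u x - pderiv (None :: map Some ds) f u (trl k h x).
have -> : Dl [:: (k, h)] (pd ds) x = phi z' - phi z by rewrite /phi /pd /=; ring.
apply: (@MVT_bound phi phi' a b) => //.
  by move=> t htt; apply: is_deriveB; apply: pderiv_z.
move=> t htt; apply: le_trans (f_holder sds htt cx cx') _.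
by rewrite enorm_trl.
Qed.

(** The bounds by Cf concern only derivatives including one in z. For f z itself, compactness bounds
    the first derivatives, giving the weak class with l = 0 and alpha = 1. *)
Lemma smooth_class_lipschitz z : a <= z <= b ->
  exists2 K : R, 0 <= K & smooth_class 0 1 K (f z).
Proof.
move=> hz.
have [K0 K00 hK0] := continuous_bounded (fun x cx => pderiv_continuous_x (ds := [::]) isT hz cx).
have /choice[K hK] : forall k : 'I_d, exists K : R, 0 <= K /\
    forall x, cube x -> `|pderiv [:: Some k] f z x| <= K.
  move=> k; have [K1 h1 h2] :=
    continuous_bounded (fun x cx => pderiv_continuous_x (ds := [:: Some k]) isT hz cx).
  by exists K1.
have S0 : 0 <= \sum_k K k by apply: sumr_ge0 => k _; have [] := hK k.
exists (K0 + \sum_k K k); first exact: addr_ge0.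
split.
  move=> [|p L] y //= _ _ fy; rewrite big_nil mulr1.
  have := hK0 y (fits_cube fy); rewrite /=; lra.
move=> [|//] [k h] y _ /= /andP[kd _] fy.
have [h0 ht] := fits_cons fy.
rewrite big_nil mulr1 powRr1 // mulrC.
apply: (Dl_MVT (L := [::]) (k := Ordinal kd) (g' := pderiv [:: Some (Ordinal kd)] f z)) => //.
  by move=> x cx; exact: (pderiv_x (ds := [::])).
move=> y' fy' /=; have cy := fits_cube fy'; have [_ /(_ y' cy)] := hK (Ordinal kd).
have : K (Ordinal kd) <= \sum_k K k.
  by rewrite (bigD1 (Ordinal kd)) //= lerDl; apply: sumr_ge0 => i _; have [] := hK i.
rewrite /=; lra.
Qed.

Lemma ccont_pderiv ds z : (size ds <= l.+1)%N -> a <= z <= b -> ccont (pderiv ds f z).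
Proof. by move=> sd hz; apply: ccont_continuous => x cx; exact: pderiv_continuous_x. Qed.

(** After subtraction of the slope at z, the derivative in u is the change of the z-derivative
    between z and u, which uniform continuity on [a, b] times the cube makes small uniformly in
    x. *)
Lemma diff_quotient_uniform z (e : R) : a <= z <= b -> 0 < e -> exists2 dl : R, 0 < dl &
  forall z', a <= z' <= b -> z' != z -> `|z' - z| < dl -> forall x, cube x ->
    `|(z' - z)^-1 * (f z' x - f z x) - pderiv [:: None] f z x| <= e.
Proof.
move=> hz e0.
have cK : compact (`[a, b] `*` cube) by apply: compact_setX; [exact: segment_compact|exact: cube_compact].
have cF p : (`[a, b] `*` cube) p ->
    {for p, continuous (fun q : R * V => pderiv [:: None] f q.1 q.2)}.
  by case: p => u x [/=]; rewrite in_itv /= => hu cx; exact: (pderiv_continuous (ds := [:: None])).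
have [dl d0 h] := heine cK cF e0; exists dl => // z' hz' zz' hd x cx.
have zz0 : z' - z != 0 by rewrite subr_eq0.
pose phi u := f u x - u * pderiv [:: None] f z x.
have hphi : `|phi z' - phi z| <= e * `|z' - z|.
  pose lo := Num.min z z'; pose hi := Num.max z z'.
  have hin u : lo <= u <= hi -> a <= u <= b /\ `|u - z| <= `|z' - z|.
    rewrite /lo /hi; case: (leP z z') => h' /andP[u1 u2].
      by rewrite !ger0_norm; lra.
    by rewrite !ler0_norm; lra.
  apply: (@MVT_bound _ (fun u => pderiv [:: None] f u x - pderiv [:: None] f z x) lo hi).
  - move=> u /hin[hu _]; apply: is_deriveB; first exact: (pderiv_z (ds := [::])).
    rewrite -[X in is_derive _ _ _ X]mul1r.
    have -> : (fun u : R => u * pderiv [:: None] f z x) =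
        (fun u : R => pderiv [:: None] f z x *: u) by apply/funext => v; rewrite mulrC.
    by rewrite mulrC; apply: is_deriveZ.
  - move=> u /hin[hu hu']; apply/ltW; rewrite distrC.
    apply: (h (z, x) (u, x)) => /=; first by split => //=; rewrite in_itv.
    split; last exact: ballxx.
    by rewrite /ball /= distrC; exact: le_lt_trans hu' hd.
  - by rewrite /lo /hi ge_min lexx le_max lexx.
  - by rewrite /lo /hi ge_min le_max !lexx !orbT.
have -> : (z' - z)^-1 * (f z' x - f z x) - pderiv [:: None] f z x =
    (phi z' - phi z) / (z' - z) by rewrite /phi; field.
by rewrite normrM normfV ler_pdivrMr ?normr_gt0.
Qed.

End Regularity.

(** * Differentiation of the random series *)

Section TermwiseDerivative.
Variable R : realType.

Lemma bounded_series_cvg (u : nat -> R) (M : R) :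
  (forall n, \sum_(i < n) `|u i| <= M) -> cvgn (series u).
Proof.
move=> hM; apply: normed_cvg.
have e n : series [eta fun k => `|u k|] n = \sum_(i < n) `|u i|.
  by rewrite /series /= big_mkord.
apply: nondecreasing_is_cvgn.
  by apply: nondecreasing_series => i _ _; exact: normr_ge0.
by exists M => _ [n _ <-]; rewrite /= e.
Qed.

Lemma series_bound (u : nat -> R) (N : nat) (x K : R) :
  series u @ \oo --> x -> (forall n, (N <= n)%N -> `|series u n| <= K) -> `|x| <= K.
Proof.
move=> ux hK; apply: (@closed_cvg _ _ _ eventually_filter (fun n => `|series u n|) (fun y => y <= K)).
- exact: closed_le.
- by exists N => // n /= hn; exact: hK.
- exact: cvg_norm.
Qed.

(** V k is a Lipschitz constant of A k and hence, in the limit, a bound of B k; its summability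
    reduces the claim to finitely many terms. Absolute convergence at a alone is enough because the
    increments from a are dominated. *)
Lemma termwise_derivative (a b : R) (A B : nat -> R -> R) (V : nat -> R) (M Ma : R) : a < b ->
  (forall k, 0 <= V k) -> (forall n, \sum_(k < n) V k <= M) ->
  (forall n, \sum_(k < n) `|A k a| <= Ma) ->
  (forall k z z', a <= z <= b -> a <= z' <= b -> `|A k z' - A k z| <= `|z' - z| * V k) ->
  (forall k z, a <= z <= b -> forall e : R, 0 < e -> exists2 dl : R, 0 < dl &
     forall z', a <= z' <= b -> z' != z -> `|z' - z| < dl ->
       `|(z' - z)^-1 * (A k z' - A k z) - B k z| <= e) ->
  exists eta D : R -> R,
     (forall z, a <= z <= b -> series (fun k => A k z) @ \oo --> eta z) /\
     (forall z, a <= z <= b -> series (fun k => B k z) @ \oo --> D z) /\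
     (forall z, a <= z <= b -> forall e : R, 0 < e -> exists del : R, 0 < del /\
        forall h : R, h != 0 -> `|h| < del -> a <= z + h <= b ->
          `|(eta (z + h) - eta z) / h - D z| < e) /\
     (exists M : R, forall z, a <= z <= b -> `|D z| <= M).
Proof.
move=> ab V0 hM hMa hA hB.
have BV k z : a <= z <= b -> `|B k z| <= V k.
  move=> hz; apply/ler_addgt0Pr => e e0; have [dl d0 hd] := hB k z hz e e0.
  (* A point of [a, b] near z, chosen on the side of the farther endpoint. *)
  have [z' [hz' zz' dz]] : exists z', [/\ a <= z' <= b, z' != z & `|z' - z| < dl].
    pose s := Num.min (dl / 2) ((b - a) / 2).
    have s0 : 0 < s by rewrite lt_min; apply/andP; split; lra.
    have s1 : s <= dl / 2 by rewrite ge_min lexx.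
    have s2 : s <= (b - a) / 2 by rewrite ge_min lexx orbT.
    have [h|h] := leP z ((a + b) / 2).
      exists (z + s); split; first lra.
        by rewrite -subr_eq0 addrC addKr gt_eqF.
      by rewrite addrC addKr gtr0_norm //; lra.
    exists (z - s); split; first lra.
      by rewrite -subr_eq0 addrC addKr oppr_eq0 gt_eqF.
    by rewrite addrC addKr normrN gtr0_norm //; lra.
  have h1 := hd z' hz' zz' dz; have h2 := hA k z z' hz hz'.
  have z0 : 0 < `|z' - z| by rewrite normr_gt0 subr_eq0.
  have h3 : `|(z' - z)^-1 * (A k z' - A k z)| <= V k.
    by rewrite normrM normfV mulrC ler_pdivrMr // mulrC.
  rewrite -[B k z](subKr ((z' - z)^-1 * (A k z' - A k z))).
  by apply: le_trans (ler_normB _ _) _; apply: lerD.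
have sumV_le (u : nat -> R) n (c : R) : (forall k, `|u k| <= c * V k) -> 0 <= c ->
    \sum_(k < n) `|u k| <= c * M.
  move=> hu c0; apply: le_trans (_ : c * \sum_(k < n) V k <= _).
    by rewrite mulr_sumr; apply: ler_sum => k _.
  exact: ler_wpM2l.
have cA z : a <= z <= b -> cvgn (series (fun k => A k z)).
  move=> hz; have ha : a <= a <= b by rewrite lexx ltW.
  apply: (@bounded_series_cvg _ (`|z - a| * M + Ma)) => n.
  apply: le_trans (_ : \sum_(k < n) (`|A k z - A k a| + `|A k a|) <= _).
    apply: ler_sum => k _; apply: le_trans (ler_normD _ _).
    by rewrite subrK.
  rewrite big_split /=; apply: lerD; last exact: hMa.
  by apply: (sumV_le (fun k => A k z - A k a)) => // k; exact: hA.
have cB z : a <= z <= b -> cvgn (series (fun k => B k z)).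
  move=> hz; apply: (@bounded_series_cvg _ M) => n.
  by rewrite -[M]mul1r; apply: (sumV_le (fun k => B k z)) => // k; rewrite mul1r; exact: BV.
exists (fun z => limn (series (fun k => A k z))), (fun z => limn (series (fun k => B k z))).
split; first by move=> z /cA.
split; first by move=> z /cB.
split; last first.
  exists M => z hz; apply: (series_bound (N := 0%N) (cB z hz)) => n _.
  rewrite /series /= big_mkord; apply: le_trans (ler_norm_sum _ _ _) _.
  by rewrite -[M]mul1r; apply: (sumV_le (fun k => B k z)) => // k; rewrite mul1r; exact: BV.
move=> z hz e e0.
have cV : cvgn (series V).
  apply: (@bounded_series_cvg _ M) => n.
  rewrite (eq_bigr (fun k : 'I_n => V k)); first exact: hM.
  by move=> k _; rewrite ger0_norm.
have e8 : 0 < e / 8 by lra.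
have [N hN] : exists N, forall n, (N <= n)%N -> \sum_(N <= k < n) V k <= e / 4.
  have /cvgrPdist_le /(_ _ e8)[N _ hN] := cV.
  exists N => n Nn; have h1 := hN N (leqnn N); have h2 := hN n Nn.
  have -> : \sum_(N <= k < n) V k = series V n - series V N.
    by rewrite /series /= (@big_cat_nat _ _ _ N 0 n) //= addrC addrK.
  move: h1 h2; rewrite !ler_norml => /andP[_ h1] /andP[h2 _]; rewrite /= in h1 h2; lra.
have [dl d0 hd] : exists2 dl : R, 0 < dl & forall z', a <= z' <= b -> z' != z -> `|z' - z| < dl ->
    \sum_(k < N) `|(z' - z)^-1 * (A k z' - A k z) - B k z| <= e / 4.
  pose e' := e / 4 / N.+1%:R.
  have e'0 : 0 < e' by rewrite divr_gt0 ?ltr0n //; lra.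
  have hall : exists2 dl : R, 0 < dl & forall z', a <= z' <= b -> z' != z -> `|z' - z| < dl ->
      forall k, (k < N)%N -> `|(z' - z)^-1 * (A k z' - A k z) - B k z| <= e'.
    elim: (N) => [|n [d1 d10 h1]]; first by exists 1.
    have [d2 d20 h2] := hB n z hz e' e'0.
    exists (Num.min d1 d2) => [|z' hz' zz']; first by rewrite lt_min d10.
    rewrite lt_min => /andP[k1 k2] k; rewrite ltnS leq_eqVlt => /orP[/eqP ->|kn].
      exact: h2.
    exact: h1.
  have [dl d0 h] := hall; exists dl => // z' hz' zz' dz.
  apply: le_trans (_ : \sum_(k < N) e' <= _).
    by apply: ler_sum => k _; exact: h.
  have <- : e' * N.+1%:R = e / 4 by rewrite /e' mulfVK.
  by rewrite sumr_const card_ord -[e' *+ N]mulr_natr ler_pM2l // ler_nat.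
exists dl; split => // h h0 hdl hzh.
have zz : z + h - z = h by rewrite addrC addKr.
have zz' : z + h != z by rewrite -subr_eq0 zz.
pose u k := h^-1 * (A k (z + h) - A k z) - B k z.
have cu : series u @ \oo --> (limn (series (fun k => A k (z + h))) -
    limn (series (fun k => A k z))) / h - limn (series (fun k => B k z)).
  have -> : series u = (fun n => (series (fun k => A k (z + h)) n -
      series (fun k => A k z) n) / h - series (fun k => B k z) n).
    apply/funext => n; rewrite /series /= -!sumrB mulr_suml -sumrB.
    by apply: eq_bigr => k _; rewrite /u mulrC.
  apply: cvgB; last exact: cB.
  by apply: cvgMl; apply: cvgB; [exact: cA|exact: cA].
(* The first N terms contribute e / 4; in the tail the difference quotient and the derivative
   contribute at most e / 4 each. *)
apply: le_lt_trans (_ : 3 * e / 4 < e); last lra.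
apply: (series_bound (N := N) cu) => n Nn.
rewrite /series /= (@big_cat_nat _ _ _ N 0 n) //= big_mkord.
apply: le_trans (ler_normD _ _) _.
have k1 : `|\sum_(k < N) u k| <= e / 4.
  apply: le_trans (ler_norm_sum _ _ _) _.
  by have := hd (z + h) hzh zz'; rewrite zz => /(_ hdl).
have k2 : `|\sum_(N <= k < n) u k| <= 2 * (e / 4).
  apply: le_trans (ler_norm_sum _ _ _) _.
  apply: le_trans (_ : 2 * \sum_(N <= k < n) V k <= _).
    rewrite mulr_sumr; apply: ler_sum => k _; rewrite /u.
    apply: le_trans (ler_normB _ _) _.
    have := hA k z (z + h) hz hzh; rewrite zz => h1.
    have h2 : `|h^-1 * (A k (z + h) - A k z)| <= V k.
      by rewrite normrM normfV mulrC ler_pdivrMr ?normr_gt0 // mulrC.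
    by have := BV k z hz; lra.
  by rewrite ler_pM2l //; exact: hN.
lra.
Qed.

End TermwiseDerivative.

(** * Block expansion and almost sure absolute convergence *)

Section HaarExpansion.
Variables (R : realType) (d : nat).
Local Notation V := 'rV[R]_d.
Local Notation cube := (@cube R d).
Local Notation ix k := {ffun 'I_d -> 'I_(2 ^ k)}.
Implicit Types (n : 'I_d -> nat) (g : V -> R).

Definition levd n := (\sum_s lev (n s).+1)%N.
Definition ampd n : R := \prod_s amp R (n s).+1.
Definition psid n (x : V) : R := \prod_s psi (n s).+1 (x ord0 s).
(** Coefficient of g with respect to the functions [psid], which are bounded by 1; this is the
    quantity estimated by [coef_bound]. *)
Definition ec g n : R := haar_coef g (fun s => (n s).+1) * ampd n.

Lemma haar_d_psid n x : haar_d (fun s => (n s).+1) x = ampd n * psid n x.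
Proof.
rewrite -big_split; apply: eq_bigr => s _ /=.
by rewrite /psi mulrC mulfVK // gt_eqF // amp_gt0.
Qed.

Lemma expr_levd (q : R) n : q ^+ levd n = \prod_s q ^+ lev (n s).+1.
Proof. exact: (big_morph (fun k => q ^+ k) (exprD q) (expr0 q)). Qed.

Lemma sum_ffun_widen N M (Phi : ('I_d -> nat) -> R) : (0 < N <= M)%N ->
  \sum_(m : {ffun 'I_d -> 'I_N}) Phi (fun s => m s) =
  \sum_(m : {ffun 'I_d -> 'I_M} | [forall s, (m s < N)%N]) Phi (fun s => m s).
Proof.
move=> /andP[N0 NM].
pose h (m : {ffun 'I_d -> 'I_N}) : {ffun 'I_d -> 'I_M} := [ffun s => widen_ord NM (m s)].
pose h' (m : {ffun 'I_d -> 'I_M}) : {ffun 'I_d -> 'I_N} :=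
  [ffun s => insubd (Ordinal N0) (m s : nat)].
rewrite [RHS](reindex_onto h h') /=; last first.
  move=> m /forallP hm; apply/ffunP => s; apply/val_inj; rewrite !ffunE /=.
  by rewrite insubdK // -topredE /= hm.
apply: eq_big => [m|m _].
  symmetry; apply/andP; split; first by apply/forallP => s; rewrite ffunE /=.
  by apply/eqP/ffunP => s; apply/val_inj; rewrite !ffunE /= insubdK // -topredE /=.
by congr Phi; apply/funext => s; rewrite ffunE.
Qed.

Lemma sum_ix_le k (Phi : ('I_d -> nat) -> R) : (forall n, 0 <= Phi n) ->
  \sum_(m : ix k) Phi (fun s => m s) <= \sum_(m : ix k.+1) Phi (fun s => m s).
Proof.
move=> h; rewrite (@sum_ffun_widen _ (2 ^ k.+1)); last by rewrite expn_gt0 leq_exp2l ?leqnSn.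
by rewrite [leRHS](bigID (fun m : ix k.+1 => [forall s, (m s < 2 ^ k)%N])) /= lerDl sumr_ge0.
Qed.

Lemma sum_psid_weighted (q : R) k x : 0 <= q < 1 ->
  \sum_(m : ix k) q ^+ levd (fun s => m s) * `|psid (fun s => m s) x| <=
  (1 + 2 / (1 - q)) ^+ d.
Proof.
move=> hq; under eq_bigr do rewrite expr_levd /psid normr_prod -big_split /=.
rewrite -(bigA_distr_bigA (fun (s : 'I_d) (i : 'I_(2 ^ k)) => q ^+ lev i.+1 * `|psi i.+1 (x ord0 s)|)).
rewrite -[X in _ ^+ X]card_ord -prodr_const; apply: ler_prod => s _; apply/andP; split.
  by apply: sumr_ge0 => i _; rewrite mulr_ge0 // exprn_ge0 //; have /andP[] := hq.
exact: sum_psi_weighted.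
Qed.

Lemma sum_levd_weighted (q : R) k : 0 <= q -> 2 * q < 1 ->
  \sum_(m : ix k) q ^+ levd (fun s => m s) <= (1 + (1 - 2 * q)^-1) ^+ d.
Proof.
move=> q0 q1; under eq_bigr do rewrite expr_levd.
rewrite -(bigA_distr_bigA (fun (s : 'I_d) (i : 'I_(2 ^ k)) => q ^+ lev i.+1)).
rewrite -[X in _ ^+ X]card_ord -prodr_const; apply: ler_prod => s _; apply/andP; split.
  by apply: sumr_ge0 => i _; rewrite exprn_ge0.
exact: sum_lev_weighted.
Qed.

Lemma step_psid k (m : ix k) : step k (psid (fun s => m s)).
Proof.
move=> x y _ _ e; apply: eq_bigr => s _; rewrite /psi; congr (_ / _).
apply: (@haar_step1 _ _ k); first by rewrite /= ltn_ord.
move=> j i jk ik q.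
have j' : (j < k.+1)%N by [].
have i' : (i < (2 ^ k).+1)%N by [].
have := congr1 (fun c : codeT d k => c (s, Ordinal j', Ordinal i')) e.
by rewrite !ffunE /= => -[-> ->].
Qed.

(** The indices that first appear in block k. For k > 0 some coordinate has level at least k - 1,
    which drives the decay of the blocks. *)
Definition fresh k (m : ix k) : bool := (k == 0%N) || ~~ [forall s, (m s < 2 ^ k.-1)%N].

Lemma fresh_lev k (m : ix k) : fresh m -> (k.-1 <= levd (fun s => m s))%N.
Proof.
case: k m => [|k] m; first by [].
rewrite /fresh /= => /forallPn[s]; rewrite -leqNgt => hs.
rewrite /levd (bigD1 s) //=; apply: leq_trans (leq_addr _ _).
by rewrite /lev /=; apply: trunc_log_max.
Qed.

Definition haar_block k g x : R :=
  if k == 0%N then haar_S 0 g x else haar_S k g x - haar_S k.-1 g x.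

Lemma haar_blockE k g x : haar_block k g x =
  \sum_(m : ix k) (if fresh m then ec g (fun s => m s) else 0) * psid (fun s => m s) x.
Proof.
pose Phi n := ec g n * psid n x.
have SE j : haar_S j g x = \sum_(m : ix j) Phi (fun s => m s).
  by apply: eq_bigr => m _; rewrite (haar_d_psid (fun s => m s)) /Phi /ec mulrA.
rewrite /haar_block; case: k => [|k] /=.
  by rewrite SE; apply: eq_bigr => m _; rewrite /fresh.
rewrite !SE [X in _ - X](@sum_ffun_widen _ (2 ^ k.+1)); last by rewrite expn_gt0 leq_exp2l ?leqnSn.
rewrite [X in X - _](bigID (fun m : ix k.+1 => [forall s, (m s < 2 ^ k)%N])) /=.
rewrite addrAC subrr add0r.
rewrite big_mkcond; apply: eq_bigr => m _; rewrite /fresh /=.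
by case: ifP => _; rewrite // mul0r.
Qed.

Lemma sum_fresh (Phi : ('I_d -> nat) -> R) (n : nat) :
  \sum_(k < n.+1) \sum_(m : ix k | fresh m) Phi (fun s => m s) = \sum_(m : ix n) Phi (fun s => m s).
Proof.
elim: n => [|n IH].
  by rewrite big_ord_recr big_ord0 /= add0r; apply: eq_bigl => m; rewrite /fresh.
rewrite big_ord_recr /= IH (@sum_ffun_widen _ (2 ^ n.+1)); last by rewrite expn_gt0 leq_exp2l ?leqnSn.
rewrite [RHS](bigID (fun m : ix n.+1 => [forall s, (m s < 2 ^ n)%N])) /=.
by congr (_ + _); apply: eq_bigl => m; rewrite /fresh.
Qed.

(* the indices are shifted to 1-based ones, and extended by 1 outside 'I_d *)
Definition ext n (k : nat) : nat := if insub k is Some s then (n s).+1 else 1%N.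

Lemma ext_gt0 n k : (0 < ext n k)%N.
Proof. by rewrite /ext; case: insub. Qed.

Lemma extE n (s : 'I_d) : ext n s = (n s).+1.
Proof. by rewrite /ext valK. Qed.

Lemma ec_ext g n : ec g n = haar_coef g (fun s => ext n s) * \prod_(s < d) amp R (ext n s).
Proof.
rewrite /ec /ampd; congr (haar_coef g _ * _); first by apply/funext => s; rewrite extE.
by apply: eq_bigr => s _; rewrite extE.
Qed.

Lemma ec_linear a g1 g2 n : ccont g1 -> ccont g2 ->
  ec (fun x => a * g1 x + g2 x) n = a * ec g1 n + ec g2 n.
Proof.
by move=> c1 c2; rewrite !ec_ext (coef_linear (ext_gt0 n)) // mulrDl mulrA.
Qed.

(** At most d differences, each at most doubling the supremum. Through this bound, uniform
    convergence of difference quotients passes to the coefficients. *)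
Lemma ec_sup g n (K : R) : ccont g -> (forall x, cube x -> `|g x| <= K) ->
  `|ec g n| <= 2 ^+ d * K.
Proof.
move=> cg hK; have K0 : 0 <= K by apply: le_trans (hK 0 (@cube0 R d)).
have p2 (q : nat) : 1 <= 2 ^+ q :> R by apply: exprn_ege1; rewrite ler1n.
rewrite ec_ext normrM [X in _ * X]ger0_norm; last first.
  by apply: prodr_ge0 => s _; rewrite ltW // amp_gt0.
apply: coef_bound => //; [exact: ext_gt0|by rewrite mulr_ge0 // exprn_ge0|].
move=> y hy; have := @Dl_cat_bound R d (hlist R (ext n) d) [::] g y K.
rewrite cats0 => /(_ _ hy) h; apply: le_trans (h _) _.
  by move=> y' /fits_cube; exact: hK.
apply: ler_wpM2r => //; rewrite hlistE size_map ler_eXn2l ?ltr1n //.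
by rewrite /coords size_rev size_filter -[leqRHS](size_iota 0); exact: count_size.
Qed.

Lemma ec_smooth l (alpha K gam : R) g n : 0 < alpha -> 0 <= K -> (0 < d)%N ->
  gam <= 1 -> 0 <= gam -> gam * d%:R <= l%:R + alpha -> ccont g ->
  smooth_class l alpha K g -> `|ec g n| <= 2 ^+ d * K * (2 `^ (- gam)) ^+ levd n.
Proof.
move=> al0 K0 d0 g1 g0 gd cg hg.
rewrite ec_ext normrM [X in _ * X]ger0_norm; last first.
  by apply: prodr_ge0 => s _; rewrite ltW // amp_gt0.
apply: coef_bound => //; first exact: ext_gt0.
  by rewrite mulr_ge0 ?exprn_ge0 ?powR_ge0 // mulr_ge0 // exprn_ge0.
move=> y hy; have := smooth_class_hlist al0 K0 d0 g1 g0 gd (ext_gt0 n) hg hy.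
by congr (_ <= _ * _ ^+ _); apply: eq_bigr => s _; rewrite extE.
Qed.

Section Paths.
Variables (dO : measure_display) (Omega : measurableType dO) (P : probability Omega R).
Variable mu : set V -> Omega -> R.
Hypothesis hmu : stochastic_measure P mu.
Local Notation T n w := (sm_int mu (psid n) w).

Lemma haar_term_block g k w : haar_term mu g k w = sm_int mu (haar_block k g) w.
Proof.
by rewrite /haar_term; case: eqP => [->|/eqP/negbTE e]; congr sm_int; apply/funext => x;
  rewrite /haar_block ?e.
Qed.

Lemma step_haar_block k g : step k (haar_block k g).
Proof.
move=> x y cx cy e; rewrite !haar_blockE; apply: eq_bigr => m _; congr (_ * _).
exact: (step_psid m).
Qed.

(** The null set depends on neither g nor k, so the formula holds for f z with all z
    simultaneously. *)
Theorem haar_termE : {ae P, forall w, forall g k, haar_term mu g k w =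
  \sum_(m : ix k) (if fresh m then ec g (fun s => m s) else 0) * T (fun s => m s) w}.
Proof.
have := sm_int_linear hmu; apply: filterS => w hw g k; rewrite haar_term_block.
apply: (hw k _ _ _ (fun (m : ix k) => psid (fun s => m s))).
  by move=> m; exact: step_psid.
by move=> x _; exact: haar_blockE.
Qed.

Lemma sm_int_scale : {ae P, forall w, forall k h (c : R), step k h ->
  sm_int mu (fun x => c * h x) w = c * sm_int mu h w}.
Proof.
have := sm_int_linear hmu; apply: filterS => w hw k h c hs.
have := hw k unit [:: tt] (fun=> c) (fun=> h) (fun x => c * h x) (fun=> hs).
by rewrite big_seq1; apply => x _; rewrite big_seq1.
Qed.

(** With r^2 = q1 q2, one has r^J |T| <= (q1^J + q2^J T^2) / 2. The first part is summable over all
    indices because 2 q1 < 1, the second by the square function bound for q3^J psid, where q3^2 = q2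
    < 1 makes the pointwise sum of absolute values bounded. *)
Theorem weighted_psid_sum (r : R) : 0 < r -> 2 * r ^+ 2 < 1 ->
  {ae P, forall w, exists M : R, forall k,
    \sum_(m : ix k) r ^+ levd (fun s => m s) * `|T (fun s => m s) w| <= M}.
Proof.
(* [q2] is the midpoint of 2 r^2 and 1, which gives both q2 < 1 and 2 q1 = 2 r^2 / q2 < 1. *)
move=> r0 r1; pose q2 := (1 + 2 * r ^+ 2) / 2; pose q1 := r ^+ 2 / q2.
have r20 : 0 < r ^+ 2 by rewrite exprn_gt0.
have q20 : 0 < q2 by rewrite /q2; lra.
have q21 : q2 < 1 by rewrite /q2; lra.
have q10 : 0 < q1 by rewrite divr_gt0.
have q11 : 2 * q1 < 1 by rewrite mulrA ltr_pdivrMr // mul1r /q2; lra.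
have q12 : q1 * q2 = r ^+ 2 by rewrite mulfVK // gt_eqF.
pose q3 := Num.sqrt q2; have q30 : 0 < q3 by rewrite sqrtr_gt0.
have q32 : q3 ^+ 2 = q2 by rewrite sqr_sqrtr // ltW.
have q31 : q3 < 1 by rewrite -sqrtr1 ltr_sqrt.
pose kap := ((1 + 2 / (1 - q3)) ^+ d)^-1.
have kap0 : 0 < kap.
  rewrite invr_gt0 exprn_gt0 // addr_gt0 // divr_gt0 //; lra.
pose h n (x : V) := kap * q3 ^+ levd n * psid n x.
have hsq := sm_int_square_bounded hmu (r := fun k => index_enum (ix k))
  (h := fun k (m : ix k) => h (fun s => m s)).
have {}hsq : {ae P, forall w, exists M : R, forall k,
    \sum_(m : ix k) sm_int mu (h (fun s => m s)) w ^+ 2 <= M}.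
  apply: hsq.
  - move=> k; exists k => m x y cx cy e; rewrite /h; congr (_ * _).
    exact: (step_psid m).
  - move=> k x _.
    rewrite (eq_bigr (fun m : ix k => kap * (q3 ^+ levd (fun s => m s) * `|psid (fun s => m s) x|))).
      rewrite -mulr_sumr mulrC ler_pdivrMr; last by rewrite -[X in 0 < X]invrK invr_gt0.
      by rewrite mul1r; apply: sum_psid_weighted; rewrite ltW.
    move=> m _; rewrite /h !normrM (gtr0_norm kap0) ger0_norm ?mulrA //.
    by rewrite exprn_ge0 // ltW.
  - move=> k phi; apply: (sum_ix_le k (Phi := fun n => phi (h n) ^+ 2)) => n.
    exact: sqr_ge0.
apply: filterS2 (sm_int_scale) hsq => w hsc [M hM].
exists (2^-1 * ((1 + (1 - 2 * q1)^-1) ^+ d + M / kap ^+ 2)) => k.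
have hM' : \sum_(m : ix k) q2 ^+ levd (fun s => m s) * T (fun s => m s) w ^+ 2 <= M / kap ^+ 2.
  rewrite ler_pdivlMr ?exprn_gt0 //; apply: le_trans (hM k); rewrite mulr_suml.
  rewrite le_eqVlt; apply/orP; left; apply/eqP; apply: eq_bigr => m _.
  rewrite (hsc k _ _ (step_psid m)) -q32 exprAC !exprMn; ring.
apply: le_trans (_ : \sum_(m : ix k) 2^-1 * (q1 ^+ levd (fun s => m s) +
    q2 ^+ levd (fun s => m s) * T (fun s => m s) w ^+ 2) <= _).
  apply: ler_sum => m _; set J := levd _; set y := T _ w.
  have u0 : 0 < q1 ^+ J by exact: exprn_gt0.
  have e : (r ^+ J) ^+ 2 = q1 ^+ J * q2 ^+ J by rewrite -exprM mulnC exprM -q12 exprMn.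
  have v0 : 0 < q2 ^+ J by exact: exprn_gt0.
  have z0 : 0 < r ^+ J by exact: exprn_gt0.
  rewrite -[y ^+ 2]real_normK ?num_real //; move: `|y| (normr_ge0 y) => t t0.
  move: (q1 ^+ J) (q2 ^+ J) (r ^+ J) u0 v0 z0 e => u v z u0 v0 z0 e.
  (* Multiplication by u > 0 produces a perfect square, because z^2 = u v. *)
  suff : 0 <= u * (u + v * t ^+ 2 - 2 * z * t) by rewrite pmulr_rge0 //; lra.
  have -> : u * (u + v * t ^+ 2 - 2 * z * t) = (u - z * t) ^+ 2.
    have -> : u * (u + v * t ^+ 2 - 2 * z * t) = u ^+ 2 + (u * v) * t ^+ 2 - 2 * u * z * t by ring.
    by rewrite -e; ring.
  exact: sqr_ge0.
rewrite -mulr_sumr ler_pM2l ?invr_gt0 // big_split /=; apply: lerD => //.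
by apply: sum_levd_weighted => //; exact: ltW.
Qed.

(** For a single function any geometric decay r < 1 suffices: the blocks are geometrically small in
    sup norm, and the square function bound is applied to the sequence of blocks. The null set
    obtained here depends on g. *)
Theorem haar_series_absolute g (K r : R) : 0 <= K -> 0 < r < 1 ->
  (forall n, `|ec g n| <= K * r ^+ levd n) ->
  {ae P, forall w, exists M : R, forall N, \sum_(k < N) `|haar_term mu g k w| <= M}.
Proof.
move=> K0 /andP[r0 r1] hec.
have sqrt01 (x : R) : 0 < x < 1 -> 0 < Num.sqrt x < 1 /\ Num.sqrt x ^+ 2 = x.
  by move=> /andP[x0 x1]; rewrite sqrtr_gt0 x0 -[X in _ < X]sqrtr1 ltr_sqrt // x1 sqr_sqrtr // ltW.
have [|] := sqrt01 r; first by rewrite r0.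
move: (Num.sqrt r) => q /andP[q0 q1] qr.
have [|] := sqrt01 q; first by rewrite q0.
move: (Num.sqrt q) => p /andP[p0 p1] pq.
pose C := (1 + 2 / (1 - q)) ^+ d.
have C0 : 0 <= C by rewrite exprn_ge0 // addr_ge0 // divr_ge0 //; lra.
(* Since r = q^2 and fresh indices have level at least k - 1, one factor q^J supplies q^(k-1) and
   the other makes the pointwise sum over the block bounded. *)
have hb k x : `|haar_block k g x| <= K * C / q * q ^+ k.
  rewrite haar_blockE; apply: le_trans (ler_norm_sum _ _ _) _.
  apply: le_trans (_ : \sum_(m : ix k) K * q ^+ k.-1 *
      (q ^+ levd (fun s => m s) * `|psid (fun s => m s) x|) <= _).
    apply: ler_sum => m _; rewrite normrM mulrA; apply: ler_wpM2r => //.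
    case: ifP => fm; last by rewrite normr0 !mulr_ge0 // exprn_ge0 // ltW.
    apply: le_trans (hec _) _; rewrite -mulrA; apply: ler_wpM2l => //.
    rewrite -qr exprAC expr2; apply: ler_wpM2r; first by rewrite exprn_ge0 // ltW.
    by apply: ler_wiXn2l; [exact: ltW|exact: ltW|exact: fresh_lev].
  rewrite -mulr_sumr; apply: le_trans (_ : K * q ^+ k.-1 * C <= _).
    by apply: ler_wpM2l; [rewrite mulr_ge0 // exprn_ge0 // ltW|apply: sum_psid_weighted; rewrite ltW].
  rewrite -!mulrA; apply: ler_wpM2l => //; rewrite mulrC; apply: ler_wpM2l => //.
  case: k => [|k] /=; first by rewrite expr0 mulr1 invf_ge1 // ltW.
  by rewrite exprS mulrA mulVf ?mul1r // gt_eqF.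
pose K' := K * C / q.
have K'0 : 0 <= K' by rewrite divr_ge0 // ?mulr_ge0 // ltW.
rewrite -/K' in hb; clearbody K'.
pose kap := (K' / (1 - p) + 1)^-1.
have kap0 : 0 < kap by rewrite invr_gt0 ltr_wpDl // divr_ge0 //; lra.
(* As q = p^2, the weight p^-k still leaves blocks of size p^k, summable in k, while the bound on
   squares gains the factor q^-k needed for Cauchy-Schwarz. *)
pose h k (x : V) := (kap * p^-1 ^+ k) * haar_block k g x.
have hsq := sm_int_square_bounded hmu (r := fun N => index_enum 'I_N)
  (h := fun N (i : 'I_N) => h i).
have {}hsq : {ae P, forall w, exists M : R, forall N,
    \sum_(i < N) sm_int mu (h i) w ^+ 2 <= M}.
  apply: hsq.
  - move=> n; exists n => i; apply: (step_le (ltnW (ltn_ord i))) => x y cx cy e.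
    by rewrite /h (step_haar_block g cx cy e).
  - move=> n x _; apply: le_trans (_ : \sum_(i < n) kap * K' * p ^+ i <= _).
      apply: ler_sum => i _; rewrite /h !normrM (gtr0_norm kap0) -!mulrA; apply: ler_wpM2l.
        exact: ltW.
      rewrite ger0_norm; last by rewrite exprn_ge0 // invr_ge0 ltW.
      rewrite exprVn mulrC ler_pdivrMr ?exprn_gt0 // -mulrA -exprD addnn -mul2n exprM pq.
      exact: hb.
    rewrite -mulr_sumr; apply: le_trans (_ : kap * K' * (1 - p)^-1 <= _).
      apply: ler_wpM2l; first by rewrite mulr_ge0 // ltW.
      by apply: geo_le; rewrite ltW.
    rewrite -mulrA mulrC ler_pdivrMr; last by rewrite -[X in 0 < X]invrK invr_gt0.
    by rewrite mul1r lerDl.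
  - by move=> n phi; rewrite [leRHS]big_ord_recr /= lerDl sqr_ge0.
apply: filterS2 (sm_int_scale) hsq => w hsc [M hM].
exists (2^-1 * ((1 - q)^-1 + M / kap ^+ 2)) => n.
have hM' : \sum_(k < n) q^-1 ^+ k * haar_term mu g k w ^+ 2 <= M / kap ^+ 2.
  rewrite ler_pdivlMr ?exprn_gt0 //; apply: le_trans (hM n); rewrite mulr_suml.
  rewrite le_eqVlt; apply/orP; left; apply/eqP; apply: eq_bigr => k _.
  rewrite (hsc k _ _ (@step_haar_block k g)) -haar_term_block -pq -exprVn exprAC !exprMn; ring.
apply: le_trans (_ : \sum_(k < n) 2^-1 * (q ^+ k + q^-1 ^+ k * haar_term mu g k w ^+ 2) <= _).
  apply: ler_sum => k _; rewrite -[_ ^+ 2]real_normK ?num_real //.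
  move: `|_| => t; rewrite exprVn; have u0 : 0 < q ^+ k by exact: exprn_gt0.
  move: (q ^+ k) u0 => u u0.
  suff -> : 2^-1 * (u + u^-1 * t ^+ 2) = t + 2^-1 * u^-1 * (u - t) ^+ 2.
    by rewrite lerDl mulr_ge0 ?sqr_ge0 // mulr_ge0 // invr_ge0 ltW.
  by field; rewrite gt_eqF.
rewrite -mulr_sumr ler_pM2l ?invr_gt0 // big_split /=; apply: lerD => //.
by apply: geo_le; rewrite ltW.
Qed.

End Paths.
End HaarExpansion.
Lemma powR2_lt1 (R : realType) (x : R) : x < 0 -> 2 `^ x < 1.
Proof.
by move=> x0; rewrite /powR pnatr_eq0 /= expR_lt1 nmulr_rlt0 // ln_gt0 // ltr1n.
Qed.

Lemma ccont_linear (R : realType) (d : nat) (a : R) (g1 g2 : 'rV[R]_d -> R) :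
  ccont g1 -> ccont g2 -> ccont (fun x => a * g1 x + g2 x).
Proof.
move=> [h1 c1 e1] [h2 c2 e2]; exists (fun x => a * h1 x + h2 x); first exact: ucont_linear.
by move=> x cx; rewrite e1 // e2.
Qed.

(** gam > 1/2 means 2 (2^-gam)^2 = 2^(1 - 2 gam) < 1, the condition of [weighted_psid_sum]. *)
Lemma decay_exponent (R : realType) (d l : nat) (alpha : R) : (0 < d)%N ->
  d%:R / 2 < l%:R + alpha ->
  exists2 gam : R, 0 <= gam <= 1 /\ gam * d%:R <= l%:R + alpha & 2 * (2 `^ (- gam)) ^+ 2 < 1.
Proof.
move=> d0 hd; have d1 : 0 < d%:R :> R by rewrite ltr0n.
pose gam := Num.min 1 ((l%:R + alpha) / d%:R).
have hgam : 2^-1 < gam.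
  by rewrite lt_min invf_lt1 ?ltr1n // ltr_pdivlMr // mulrC hd.
exists gam; first split.
- by rewrite ge_min lexx /= andbT; lra.
- by rewrite -ler_pdivlMr // ge_min lexx orbT.
rewrite -[X in X * _]powRr1 // -powR_mulrn ?powR_ge0 // -powRrM -powRD; last first.
  by apply/implyP => _; rewrite pnatr_eq0.
apply: powR2_lt1; lra.
Qed.

Theorem theorem3 (R : realType) (dO : measure_display) (Omega : measurableType dO)
  (P : probability Omega R) (a b : R) (d l : nat) (alpha Cf : R)
  (f : R -> 'rV[R]_d -> R) (mu : set 'rV[R]_d -> Omega -> R) :
  complete_prob P ->
  a < b -> (0 < d)%N -> 0 < alpha -> 0 < Cf ->
  Ck_box l.+1 a b f ->
  (forall s : seq 'I_d, (size s <= l)%N ->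
     forall z x, a <= z <= b -> @cube R d x ->
       `|pderiv (None :: map Some s) f z x| <= Cf) ->
  (forall s : seq 'I_d, size s = l ->
     forall z x1 x2, a <= z <= b -> @cube R d x1 -> @cube R d x2 ->
       `|pderiv (None :: map Some s) f z x1 - pderiv (None :: map Some s) f z x2|
         <= Cf * enorm (x1 - x2) `^ alpha) ->
  stochastic_measure P mu ->
  d%:R / 2 < l%:R + alpha ->
  {ae P, forall w, exists eta D : R -> R,
     (forall z, a <= z <= b ->
        series (fun k => haar_term mu (f z) k w) @ \oo --> eta z) /\
     (forall z, a <= z <= b ->
        series (fun k => haar_term mu (pderiv [:: None] f z) k w) @ \oo --> D z) /\
     (forall z, a <= z <= b -> forall e : R, 0 < e -> exists del : R, 0 < del /\
        forall h : R, h != 0 -> `|h| < del -> a <= z + h <= b ->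
          `|(eta (z + h) - eta z) / h - D z| < e) /\
     (exists M : R, forall z, a <= z <= b -> `|D z| <= M)}.
Proof.
move=> _ ab d0 al0 Cf0 fs fb fh hmu hd.
have [gam [/andP[gam0 gam1] gamd]] := decay_exponent d0 hd.
set r := 2 `^ (- gam) => r2; have r0 : 0 < r by rewrite powR_gt0.
have haa : a <= a <= b by rewrite lexx ltW.
have cf z : a <= z <= b -> ccont (f z) := @ccont_pderiv _ _ _ _ _ _ fs [::] z isT.
have cdf z : a <= z <= b -> ccont (pderiv [:: None] f z) :=
  @ccont_pderiv _ _ _ _ _ _ fs [:: None] z isT.
have d1 : 0 < d%:R :> R by rewrite ltr0n.
have [K K0 hK] := smooth_class_lipschitz fs haa.
have r1 : 0 < (2 : R) `^ (- d%:R^-1) < 1.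
  by rewrite powR_gt0 //= powR2_lt1 // oppr_lt0 invr_gt0.
(* At z = a the exponent 1 / d, from the class with l = 0 and alpha = 1, is all that
   [haar_series_absolute] needs. *)
have eca n : `|ec (f a) n| <= 2 ^+ d * K * ((2 : R) `^ (- d%:R^-1)) ^+ levd n.
  apply: (ec_smooth (l := 0) (alpha := 1)) => //; last exact: cf.
  - by rewrite invf_le1 // ler1n.
  - by rewrite mulVf ?gt_eqF // add0r.
have K'0 : 0 <= 2 ^+ d * K by rewrite mulr_ge0 // exprn_ge0.
have hA := haar_series_absolute hmu K'0 r1 eca.
have hM := weighted_psid_sum hmu r0 r2.
apply: filterS3 (haar_termE hmu) hM hA => w hT [M hM] [Ma hA].
pose T n := sm_int mu (@psid R d n) w.
have hlin c g1 g2 k : ccont g1 -> ccont g2 ->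
    haar_term mu (fun x => c * g1 x + g2 x) k w = c * haar_term mu g1 k w + haar_term mu g2 k w.
  move=> c1 c2; rewrite !hT mulr_sumr -big_split; apply: eq_bigr => m _ /=.
  by case: ifP => _; rewrite ?mul0r ?mulr0 ?add0r // ec_linear // mulrDl mulrA.
have subE z z' : (fun x => f z' x - f z x) = (fun x => -1 * f z x + f z' x).
  by apply/funext => x; rewrite mulN1r addrC.
have hdiff z z' k : a <= z <= b -> a <= z' <= b ->
    haar_term mu (fun x => f z' x - f z x) k w = haar_term mu (f z') k w - haar_term mu (f z) k w.
  by move=> hz hz'; rewrite subE hlin ?mulN1r 1?addrC //; exact: cf.
have cdiff z z' : a <= z <= b -> a <= z' <= b -> ccont (fun x => f z' x - f z x).
  by move=> hz hz'; rewrite subE; apply: ccont_linear; exact: cf.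
(* A Lipschitz constant in z of the k-th term. The fresh indices of different blocks are disjoint,
   so the V k add up to parts of the sum bounded by M. *)
pose V k := 2 ^+ d * Cf * \sum_(m : {ffun 'I_d -> 'I_(2 ^ k)} | fresh m)
  r ^+ levd (fun s => m s) * `|T (fun s => m s)|.
apply: (@termwise_derivative _ _ _ _ _ V (2 ^+ d * Cf * M) Ma) => //.
- move=> k; apply: mulr_ge0; first by rewrite mulr_ge0 ?exprn_ge0 // ltW.
  by apply: sumr_ge0 => m _; rewrite mulr_ge0 // exprn_ge0 // ltW.
- move=> n; rewrite -mulr_sumr; apply: ler_wpM2l; first by rewrite mulr_ge0 ?exprn_ge0 // ltW.
  apply: le_trans (_ : \sum_(k < n.+1) \sum_(m : {ffun 'I_d -> 'I_(2 ^ k)} | fresh m)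
      r ^+ levd (fun s => m s) * `|T (fun s => m s)| <= _).
    rewrite [leRHS]big_ord_recr /= lerDl; apply: sumr_ge0 => m _.
    by rewrite mulr_ge0 // exprn_ge0 // ltW.
  by rewrite (sum_fresh (fun n => r ^+ levd n * `|T n|)); exact: hM.
- move=> k z z' hz hz'; rewrite -hdiff // hT; apply: le_trans (ler_norm_sum _ _ _) _.
  rewrite /V !mulr_sumr [leRHS]big_mkcond; apply: ler_sum => m _ /=.
  case: ifP => fm; last by rewrite mul0r normr0.
  rewrite normrM !mulrA; apply: ler_wpM2r => //.
  apply: le_trans (ec_smooth _ al0 _ d0 gam1 gam0 gamd (cdiff _ _ hz hz')
    (smooth_class_diff fs fb fh hz hz')) _.
    by rewrite mulr_ge0 // ltW.
  by rewrite -/r le_eqVlt; apply/orP; left; apply/eqP; ring.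
move=> k z hz e e0.
pose S := \sum_(m : {ffun 'I_d -> 'I_(2 ^ k)}) `|T (fun s => m s)|.
have S0 : 0 <= S by apply: sumr_ge0.
(* 2^d is the cost of [ec_sup] and S that of summation over the block; S + 1 keeps C positive. *)
pose C := 2 ^+ d * (S + 1); have C0 : 0 < C by rewrite mulr_gt0 ?exprn_gt0 // ltr_wpDl.
have eC : 0 < e / C by rewrite divr_gt0.
have [dl dl0 hdl] := diff_quotient_uniform fs hz eC.
exists dl => // z' hz' zz' dz.
have c1 := ccont_linear (- (z' - z)) (cdf _ hz) (cdiff _ _ hz hz').
have zz0 : z' - z != 0 by rewrite subr_eq0.
(* By linearity the error is a Haar term of the first order remainder of f in z, which on the cube
   is at most e / C times |z' - z|. *)
have -> : (z' - z)^-1 * (haar_term mu (f z') k w - haar_term mu (f z) k w) -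
    haar_term mu (pderiv [:: None] f z) k w = (z' - z)^-1 *
    haar_term mu (fun x => - (z' - z) * pderiv [:: None] f z x + (f z' x - f z x)) k w.
  rewrite (hlin _ _ _ _ (cdf _ hz) (cdiff _ _ hz hz')) hdiff //.
  by field.
rewrite normrM normfV mulrC ler_pdivrMr ?normr_gt0 // hT.
apply: le_trans (ler_norm_sum _ _ _) _.
apply: le_trans (_ : \sum_(m : {ffun 'I_d -> 'I_(2 ^ k)})
    2 ^+ d * (e / C * `|z' - z|) * `|T (fun s => m s)| <= _).
  apply: ler_sum => m _; rewrite normrM; apply: ler_wpM2r => //.
  case: ifP => _; last by rewrite normr0 !mulr_ge0 ?exprn_ge0 // ltW // invr_gt0.
  apply: ec_sup c1 _ => x cx; rewrite -ler_pdivrMr ?normr_gt0 // -normf_div.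
  apply: le_trans (hdl z' hz' zz' dz x cx); rewrite le_eqVlt; apply/orP; left; apply/eqP.
  by congr (`|_|); field.
rewrite -mulr_sumr -/S (_ : 2 ^+ d * _ * S = e * `|z' - z| * (S / (S + 1))); last first.
  by rewrite /C; field; rewrite gt_eqF ?ltr_wpDl //= expf_neq0 // pnatr_eq0.
apply: ler_piMr; first by rewrite mulr_ge0 // ltW.
by rewrite ler_pdivrMr ?ltr_wpDl // mul1r lerDl.
Qed.
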